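(* Let $(g,\phi)$ solve the Einstein–massless-scalar equations $\operatorname{Ric}(g)=\mathrm d\phi\otimes\mathrm d\phi$, $\Box_g\phi=0$, and let $\gamma:\mathbb R\to(\mathcal T,\mathsf G)$ be a unit-speed geodesic in a complete Riemannian target. Then $\Phi=\gamma\circ\phi$ together with the same metric $g$ solves $$\operatorname{Ric}(g)=\Phi^*\mathsf G,\qquad D^\mu\partial_\mu\Phi=0 .$$ Consequently every one of the explicitly constructed massless-scalar Heisenberg developments (a), (b), (c) listed in the context, including its discrete quotients, gives a nonlinear sigma-model development with exactly the same completeness, inextendibility and horizon properties. The statement is valid for noncompact and closed target geodesics alike.
   Context: $D^\mu\partial_\mu\Phi=0$ is the wave-map equation for $\Phi$ from the spacetime with metric $g$ to $(\mathcal T,\mathsf G)$: the $g$-trace of the covariant derivative of $\mathrm d\Phi$ (Levi-Civita connections of $g$ on the domain and of $\mathsf G$ on the target) vanishes. Discrete quotients are quotients of the spatial group by a discrete subgroup acting by left translations. The constructed developments are the following. (a) Let $m\ge1$ and let $H_{2m+1}$ be the simply connected Heisenberg group with left-invariant coframe $\omega^0,\dots,\omega^{2m}$, $\mathrm d\omega^0=-\sum_{r=1}^m\omega^{2r-1}\wedge\omega^{2r}$, $\mathrm d\omega^i=0$ for $i>0$. Take $A_a>0$, $\phi_0\in\mathbb R$ and real $(p_0,\dots,p_{2m},q)$ with $\sum_a p_a=1$, $\sum_a p_a^2+q^2=1$ and $\chi_r:=1+p_0-p_{2r-1}-p_{2r}>0$ for $1\le r\le m$. Put $\kappa_r=A_0/(A_{2r-1}A_{2r})$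 and $F_r(\tau)=1+\frac{\kappa_r^2}{4\chi_r^2}e^{2\chi_r\tau}$. On $\mathbb R_\tau\times H_{2m+1}$ the development is $g=-N^2\mathrm d\tau^2+\sum_a a_a^2(\omega^a)^2$ with $a_0=A_0e^{p_0\tau}\prod_rF_r^{-1/2}$, $a_{2r-1}=A_{2r-1}e^{p_{2r-1}\tau}F_r^{1/2}$, $a_{2r}=A_{2r}e^{p_{2r}\tau}F_r^{1/2}$, $N=e^{\tau}\prod_rF_r^{1/2}$, $\phi=q\tau+\phi_0$. For $m=1$ this is, up to relabelling and an affine change of $\tau$, the exact massless Bianchi II family. The case $q=0$ is vacuum. (b) On $H_3\times H_3$ with invariant coframe satisfying $\mathrm d\omega^1=-\omega^2\wedge\omega^3$, $\mathrm d\omega^4=-\omega^5\wedge\omega^6$ and the other $\omega^i$ closed: the maximal expanding homogeneous developments of diagonal solutions $g=-\mathrm dt^2+\sum_{i=1}^6a_i(t)^2(\omega^i)^2$, $\operatorname{Ric}(g)=\mathrm d\phi\otimes\mathrm d\phi$, with $a_i=t^{p_i}(1+O(t^{3/5}))$ and $\phi=q\log t+O(t^{3/5})$ as $t\downarrow0$ (estimates valid after two applications of $t\partial_t$), where either $(p_1,\dots,p_6)=\frac1{20}(-8,-1,7,8,7,7)$, $q=\frac{\sqrt{31}}{10}$, or (vacuum) $(p_1,\dots,p_6)=\frac1{20}(-8,3-\sqrt{78},3+\sqrt{78},8,7,7)$, $q=0$; and the analogous developments (with possibly different positive error exponents) for Kasner data, $\sum_ip_i=\sum_ip_i^2+q^2=1$,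 in a sufficiently small relative neighborhood of either datum. (c) For $n\ge6$, the metric products of the two developments displayed in (b) with Euclidean $\mathbb R^{n-6}$, on $H_3\times H_3\times\mathbb R^{n-6}$, with $\phi$ independent of the added coordinates. *)

(* Defs.v *)
From HB Require Import structures.
From mathcomp Require Import all_boot all_order all_algebra.
From mathcomp Require Import all_classical all_reals all_analysis.

Set Implicit Arguments.
Unset Strict Implicit.
Unset Printing Implicit Defensive.

Import Order.TTheory GRing.Theory Num.Theory.
Import numFieldNormedType.Exports.

Local Open Scope ring_scope.
Local Open Scope classical_set_scope.

(** * Differentiability classes on open subsets of [R^d] *)

Section Calculus.
Context {R : realType} {d : nat}.

Definition pd (i : 'I_d) (f : 'rV[R]_d -> R) (x : 'rV[R]_d) : R :=
  'D_(delta_mx 0 i) f x.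

Definition iter_pd (s : seq 'I_d) (f : 'rV[R]_d -> R) : 'rV[R]_d -> R :=
  foldr pd f s.

(* A regularity is [Some k] for C^k and [None] for C^infinity. *)
Definition reg_le (j : nat) (k : option nat) : bool :=
  if k is Some m then (j <= m)%N else true.

Definition Ck_on (k : option nat) (U : set 'rV[R]_d) (f : 'rV[R]_d -> R) : Prop :=
  forall (s : seq 'I_d) (x : 'rV[R]_d), U x ->
    (reg_le (size s) k -> {for x, continuous (iter_pd s f)}) /\
    (reg_le (size s).+1 k -> differentiable (iter_pd s f) x).

End Calculus.

(** * Smooth manifolds *)

(* A set with an atlas, whose topology is the one induced by the charts.
   [ichart a] is the partial inverse of [chart a]; it is [None] outside the
   image of the chart, and thereby also determines the domain of the chart. *)
Record atlas (R : realType) (d : nat) := Atlas {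
  carrier :> Type;
  ix : Type;
  chart : ix -> carrier -> 'rV[R]_d;
  ichart : ix -> 'rV[R]_d -> option carrier }.

Arguments chart {R d M} : rename.
Arguments ichart {R d M} : rename.

Section Manifold.
Context {R : realType} {d : nat}.
Implicit Types (M : atlas R d).

Definition dom M (a : ix M) : set M := [set p | ichart a (chart a p) = Some p].

Definition in_chart M (a : ix M) (V : set M) : set 'rV[R]_d :=
  [set x | exists2 p, ichart a x = Some p & V p].

Definition image M (a : ix M) : set 'rV[R]_d := in_chart a setT.

(* The coordinate representation of [f] in the chart [a]. *)
Definition loc M (a : ix M) (W : zmodType) (f : M -> W) (x : 'rV[R]_d) : W :=
  oapp f 0 (ichart a x).

Definition mopen M (V : set M) : Prop := forall a : ix M, open (in_chart a V).

Definition manifold M : Prop :=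
  [/\ (forall p : M, exists a : ix M, dom a p) /\
      (forall (a : ix M) x p, ichart a x = Some p -> chart a p = x),
      forall a b : ix M, open (in_chart a (dom b)),
      forall (a b : ix M) (i : 'I_d),
        Ck_on None (in_chart a (dom b)) (fun x => loc a (chart b) x 0 i),
      forall p q : M, p <> q ->
        exists V W : set M, [/\ mopen V, mopen W, V p, W q & V `&` W = set0]
    & exists2 C : set (ix M), countable C &
        forall p : M, exists2 a, C a & dom a p].

Definition mconnected M : Prop :=
  forall V : set M, mopen V -> mopen (~` V) -> V = set0 \/ V = setT.

Definition mclosure M (S : set M) : set M :=
  [set p | forall V : set M, mopen V -> V p -> exists2 q, S q & V q].

Definition mboundary M (S : set M) : set M := mclosure S `&` mclosure (~` S).

End Manifold.

Definition smooth_map {R : realType} {d e : nat} (M : atlas R d) (T : atlas R e)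
    (F : M -> T) : Prop :=
  forall (a : ix M) (b : ix T), open (in_chart a (F @^-1` dom b)) /\
    forall A : 'I_e, Ck_on None (in_chart a (F @^-1` dom b))
      (fun x => loc a (fun p => chart b (F p)) x 0 A).

Definition smooth_scalar {R : realType} {d : nat} (M : atlas R d)
    (phi : M -> R) : Prop :=
  forall a : ix M, Ck_on None (image a) (loc a phi).

(** * Pseudo-Riemannian metrics, given by their components in each chart *)

Definition tensor2 {R : realType} {d : nat} (M : atlas R d) :=
  ix M -> 'rV[R]_d -> 'M[R]_d.

Definition pairing {R : realType} {d : nat} (g : 'M[R]_d) (v w : 'rV[R]_d) : R :=
  (v *m g *m w^T) 0 0.

(* Recall that ['J f x] is the matrix of ['d f x] acting on row vectors, so
   that its rows are the coordinate partial derivatives of [f]. *)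
Definition pullback_mx {R : realType} {d e : nat} (f : 'rV[R]_d -> 'rV[R]_e)
    (h : 'M[R]_e) (x : 'rV[R]_d) : 'M[R]_d :=
  'J f x *m h *m ('J f x)^T.

Section Metric.
Context {R : realType} {d : nat}.
Implicit Types (M : atlas R d).

Definition metric_tensor (k : option nat) M (g : tensor2 M) : Prop :=
  [/\ forall (a : ix M) (i j : 'I_d), Ck_on k (image a) (fun x => g a x i j),
      forall (a : ix M) x, image a x -> (g a x)^T = g a x
    & forall (a b : ix M) x, in_chart a (dom b) x ->
        g a x = pullback_mx (loc a (chart b)) (g b (loc a (chart b) x)) x].

Definition riemannian M (g : tensor2 M) : Prop :=
  metric_tensor None g /\
  forall (a : ix M) x, image a x -> forall v, v != 0 -> 0 < pairing (g a x) v v.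

Definition christoffel (g : 'rV[R]_d -> 'M[R]_d) (k i j : 'I_d) (x : 'rV[R]_d) : R :=
  2^-1 * \sum_l invmx (g x) k l *
    (pd i (fun y => g y l j) x + pd j (fun y => g y l i) x - pd l (fun y => g y i j) x).

(* Sign convention: the round sphere has positive Ricci curvature. *)
Definition ricci (g : 'rV[R]_d -> 'M[R]_d) (x : 'rV[R]_d) : 'M[R]_d :=
  \matrix_(j, k)
    (\sum_i pd i (christoffel g i j k) x - \sum_i pd j (christoffel g i i k) x
     + \sum_i \sum_l (christoffel g i i l x * christoffel g l j k x
                      - christoffel g i j l x * christoffel g l i k x)).

Definition box (g : 'rV[R]_d -> 'M[R]_d) (f : 'rV[R]_d -> R) (x : 'rV[R]_d) : R :=
  \sum_i \sum_j invmx (g x) i j *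
    (pd i (pd j f) x - \sum_k christoffel g k i j x * pd k f x).

Definition einstein_scalar M (g : tensor2 M) (phi : M -> R) : Prop :=
  [/\ smooth_scalar phi,
      forall (a : ix M) x, image a x ->
        ricci (g a) x = \matrix_(i, j) (pd i (loc a phi) x * pd j (loc a phi) x)
    & forall (a : ix M) x, image a x -> box (g a) (loc a phi) x = 0].

(** ** Curves and geodesics *)

Definition open_interval (J : set R) : Prop := [/\ is_interval J, open J & J !=set0].

Definition coord M (a : ix M) (c : R -> M) (k : 'I_d) (t : R) : R := chart a (c t) 0 k.

Definition velocity M (a : ix M) (c : R -> M) (t : R) : 'rV[R]_d :=
  \row_k derive1 (coord a c k) t.

Definition smooth_curve M (J : set R) (c : R -> M) : Prop :=
  forall a : ix M, open (J `&` c @^-1` dom a) /\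
    forall t, J t -> dom a (c t) ->
      forall (k : 'I_d) (m : nat), derivable (derive1n m (coord a c k)) t 1.

Definition geodesic M (g : tensor2 M) (J : set R) (c : R -> M) : Prop :=
  smooth_curve J c /\
  forall (a : ix M) t, J t -> dom a (c t) -> forall k : 'I_d,
    derive1n 2 (coord a c k) t +
      \sum_i \sum_j christoffel (g a) k i j (chart a (c t)) *
        (velocity a c t 0 i * velocity a c t 0 j) = 0.

Definition unit_speed M (g : tensor2 M) (c : R -> M) : Prop :=
  forall (a : ix M) t, dom a (c t) ->
    pairing (g a (chart a (c t))) (velocity a c t) (velocity a c t) = 1.

Definition complete M (g : tensor2 M) : Prop :=
  forall (J : set R) (c : R -> M), open_interval J -> geodesic g J c ->
    exists2 c' : R -> M, geodesic g setT c' & forall t, J t -> c' t = c t.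

Definition upper_limit M (J : set R) (c : R -> M) (q : M) : Prop :=
  forall V : set M, mopen V -> V q ->
    exists2 s, J s & forall t, J t -> s < t -> V (c t).

Definition lower_limit M (J : set R) (c : R -> M) (q : M) : Prop :=
  forall V : set M, mopen V -> V q ->
    exists2 s, J s & forall t, J t -> t < s -> V (c t).

End Metric.

Definition lorentzian {R : realType} {n : nat} (k : option nat)
    (M : atlas R n.+1) (g : tensor2 M) : Prop :=
  metric_tensor k g /\
  forall (a : ix M) x, image a x -> exists2 P : 'M[R]_n.+1, P \in unitmx &
    P *m g a x *m P^T = diag_mx (\row_i (if i == 0 then -1 else 1)).

(** * The Einstein--sigma-model system *)

Section SigmaModel.
Context {R : realType} {d e : nat} {M : atlas R d} {T : atlas R e}.

(* The [A]-th component of the [g]-trace of the covariant derivative of the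
   differential of the map with coordinate representation [u]. *)
Definition tension (g : 'rV[R]_d -> 'M[R]_d) (G : 'rV[R]_e -> 'M[R]_e)
    (u : 'rV[R]_d -> 'rV[R]_e) (A : 'I_e) (x : 'rV[R]_d) : R :=
  let uc B y := u y 0 B in
  \sum_i \sum_j invmx (g x) i j *
    (pd i (pd j (uc A)) x - \sum_k christoffel g k i j x * pd k (uc A) x
     + \sum_B \sum_C christoffel G A B C (u x) * (pd i (uc B) x * pd j (uc C) x)).

Definition einstein_sigma (g : tensor2 M) (G : tensor2 T) (Phi : M -> T) : Prop :=
  smooth_map Phi /\
  forall (a : ix M) (b : ix T) x, in_chart a (Phi @^-1` dom b) x ->
    let u := loc a (fun p => chart b (Phi p)) in
    ricci (g a) x = pullback_mx u (G b (u x)) x /\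
    forall A : 'I_e, tension (g a) (G b) u A x = 0.

End SigmaModel.

(** * Spacetimes and their global properties *)

(* [st_time] is a future-pointing timelike vector field, which gives the time
   orientation and whose integral curves are the comoving observers. *)
Record spacetime (R : realType) (n : nat) := Spacetime {
  st_mfd :> atlas R n.+1;
  st_metric : tensor2 st_mfd;
  st_time : ix st_mfd -> 'rV[R]_n.+1 -> 'rV[R]_n.+1 }.

Arguments st_metric {R n}.
Arguments st_time {R n}.

Variant causal_kind := Timelike | Null | Causal.

Section Spacetime.
Context {R : realType} {n : nat}.
Implicit Types (S : spacetime R n).

Definition spacetime_axioms S : Prop :=
  [/\ manifold S, lorentzian None (st_metric S),
      forall (a : ix S) i, Ck_on None (image a) (fun x => st_time S a x 0 i),
      forall (a : ix S) x, image a x ->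
        pairing (st_metric S a x) (st_time S a x) (st_time S a x) < 0
    & forall (a b : ix S) x, in_chart a (dom b) x ->
        st_time S b (loc a (chart b) x) = st_time S a x *m 'J (loc a (chart b)) x].

Definition has_kind (K : causal_kind) (r : R) : Prop :=
  match K with Timelike => r < 0 | Null => r = 0 | Causal => r <= 0 end.

(* The second condition also excludes a vanishing velocity. *)
Definition future_directed S (K : causal_kind) (J : set R) (c : R -> S) : Prop :=
  forall (a : ix S) t, J t -> dom a (c t) ->
    let g := st_metric S a (chart a (c t)) in
    has_kind K (pairing g (velocity a c t) (velocity a c t)) /\
    pairing g (velocity a c t) (st_time S a (chart a (c t))) < 0.

Definition future_complete S (K : causal_kind) : Prop :=
  forall (J : set R) (c : R -> S), open_interval J ->
    geodesic (st_metric S) J c -> future_directed K J c ->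
    exists2 c' : R -> S,
      geodesic (st_metric S) [set t | exists2 s, J s & s <= t] c' &
      forall t, J t -> c' t = c t.

Definition past_complete S (K : causal_kind) : Prop :=
  forall (J : set R) (c : R -> S), open_interval J ->
    geodesic (st_metric S) J c -> future_directed K J c ->
    exists2 c' : R -> S,
      geodesic (st_metric S) [set t | exists2 s, J s & t <= s] c' &
      forall t, J t -> c' t = c t.

(* A C^k extension: a proper smooth isometric embedding into a connected
   Lorentzian manifold of the same dimension with a C^k metric. *)
Definition extension S (k : option nat) (M : atlas R n.+1) (g : tensor2 M)
    (f : S -> M) : Prop :=
  [/\ manifold M, mconnected M, lorentzian k g,
      [/\ smooth_map f, injective f & exists q, ~ range f q]
    & forall (a : ix S) (b : ix M) x, in_chart a (f @^-1` dom b) x ->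
        let u := loc a (fun p => chart b (f p)) in
        st_metric S a x = pullback_mx u (g b (u x)) x].

Definition inextendible S (k : option nat) : Prop :=
  ~ exists (M : atlas R n.+1) (g : tensor2 M) (f : S -> M), extension k g f.

Definition future_inextendible S (k : option nat) : Prop :=
  ~ exists (M : atlas R n.+1) (g : tensor2 M) (f : S -> M), extension k g f /\
    exists J c q, [/\ open_interval J, smooth_curve J c,
      future_directed Timelike J c, ~ range f q & upper_limit J (f \o c) q].

Definition past_inextendible S (k : option nat) : Prop :=
  ~ exists (M : atlas R n.+1) (g : tensor2 M) (f : S -> M), extension k g f /\
    exists J c q, [/\ open_interval J, smooth_curve J c,
      future_directed Timelike J c, ~ range f q & lower_limit J (f \o c) q].

Definition reaches S (K : causal_kind) (p q : S) : Prop :=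
  exists J c t0 t1, [/\ open_interval J, J t0 /\ J t1, t0 < t1,
    c t0 = p /\ c t1 = q & smooth_curve J c /\ future_directed K `[t0, t1] c].

Definition chron_past S (A : set S) : set S :=
  [set p | exists2 q, A q & reaches Timelike p q].

Definition chron_future S (A : set S) : set S :=
  [set q | exists2 p, A p & reaches Timelike p q].

Definition causal_past S (A : set S) : set S :=
  A `|` [set p | exists2 q, A q & reaches Causal p q].

Definition causal_future S (A : set S) : set S :=
  A `|` [set q | exists2 p, A p & reaches Causal p q].

Definition future_event_horizon S (J : set R) (c : R -> S) : set S :=
  mboundary (causal_past (c @` J)).

Definition past_event_horizon S (J : set R) (c : R -> S) : set S :=
  mboundary (causal_future (c @` J)).

Definition comoving_observer S (J : set R) (c : R -> S) : Prop :=
  [/\ open_interval J, smooth_curve J c,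
      forall (a : ix S) t, J t -> dom a (c t) ->
        velocity a c t = st_time S a (chart a (c t))
    & forall q, ~ upper_limit J c q /\ ~ lower_limit J c q].

(* The events at which some comoving observer has not yet been visible. *)
Definition has_particle_horizon S : set S :=
  [set p | exists J c, comoving_observer J c /\
                       causal_past [set p] `&` c @` J = set0].

Definition future_dependence S (A : set S) : set S :=
  [set p | forall J c t0, open_interval J -> smooth_curve J c ->
     future_directed Causal J c -> J t0 -> c t0 = p ->
     (forall q, ~ lower_limit J c q) ->
     exists t, [/\ J t, t <= t0 & A (c t)]].

Definition past_dependence S (A : set S) : set S :=
  [set p | forall J c t0, open_interval J -> smooth_curve J c ->
     future_directed Causal J c -> J t0 -> c t0 = p ->
     (forall q, ~ upper_limit J c q) ->
     exists t, [/\ J t, t0 <= t & A (c t)]].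

Definition future_cauchy_horizon S (A : set S) : set S :=
  mclosure (future_dependence A) `\` chron_past (future_dependence A).

Definition past_cauchy_horizon S (A : set S) : set S :=
  mclosure (past_dependence A) `\` chron_future (past_dependence A).

End Spacetime.

Arguments has_particle_horizon {R n}.
Arguments future_cauchy_horizon {R n}.
Arguments past_cauchy_horizon {R n}.
Arguments future_event_horizon {R n}.
Arguments past_event_horizon {R n}.

(** * Developments: spacetimes with a matter field valued in [F] *)

Record development (R : realType) (n : nat) (F : Type) := Development {
  dev_st :> spacetime R n;
  dev_field : dev_st -> F }.

Arguments dev_field {R n F}.

Definition scalar_development {R : realType} {n : nat}
    (D : development R n R) : Prop :=
  spacetime_axioms D /\ einstein_scalar (st_metric D) (dev_field D).

Definition sigma_development {R : realType} {n e : nat} {T : atlas R e}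
    (G : tensor2 T) (D : development R n T) : Prop :=
  spacetime_axioms D /\ einstein_sigma (st_metric D) G (dev_field D).

(* Same manifold and metric, matter field composed with [gamma]. *)
Definition compose_field {R : realType} {n : nat} {F F' : Type} (gamma : F -> F')
    (D : development R n F) : development R n F' :=
  @Development R n F' (dev_st D) (gamma \o dev_field D).

Definition same_completeness {R : realType} {n : nat} (S S' : spacetime R n) : Prop :=
  (complete (st_metric S) <-> complete (st_metric S')) /\
  forall K : causal_kind,
    (future_complete S K <-> future_complete S' K) /\
    (past_complete S K <-> past_complete S' K).

Definition same_inextendibility {R : realType} {n : nat} (S S' : spacetime R n) : Prop :=
  forall k : option nat,
    [/\ inextendible S k <-> inextendible S' k,
        future_inextendible S k <-> future_inextendible S' k
      & past_inextendible S k <-> past_inextendible S' k].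

(* [compose_field gamma D] has the events of [D], so the horizons of the two
   can be compared as sets. *)
Definition same_horizons {R : realType} {n : nat} {F F' : Type} (gamma : F -> F')
    (D : development R n F) : Prop :=
  let D' := compose_field gamma D in
  [/\ forall (J : set R) (c : R -> D),
        future_event_horizon D' J c = future_event_horizon D J c /\
        past_event_horizon D' J c = past_event_horizon D J c,
      has_particle_horizon D' = has_particle_horizon D
    & forall A : set D,
        future_cauchy_horizon D' A = future_cauchy_horizon D A /\
        past_cauchy_horizon D' A = past_cauchy_horizon D A].

Definition gives_sigma_development {R : realType} {n e : nat} {T : atlas R e}
    (G : tensor2 T) (gamma : R -> T) (D : development R n R) : Prop :=
  [/\ sigma_development G (compose_field gamma D),
      same_completeness (compose_field gamma D) D,
      same_inextendibility (compose_field gamma D) D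
    & same_horizons gamma D].

(** * Homogeneous spacetimes over two-step nilpotent groups *)

(* [brk k i j] says that [omega^i /\ omega^j] occurs in [- d omega^k].  In the
   groups below, the indices [k] so occurring are central. *)
Definition bracket := nat -> nat -> nat -> bool.

Section Nilpotent.
Context {R : realType} (brk : bracket) {n : nat}.

(* The group is [R^n] with the following product, and its left-invariant
   coframe is [omega^k = dx_k - \sum_(i, j | brk k i j) x_i dx_j]. *)
Definition gmul (x y : 'rV[R]_n) : 'rV[R]_n :=
  \row_k (x 0 k + y 0 k + \sum_(i < n) \sum_(j < n | brk k i j) x 0 i * y 0 j).

Definition coframe (x : 'rV[R]_n) : 'M[R]_n :=
  \matrix_(k, j) ((k == j)%:R - \sum_(i < n | brk k i j) x 0 i).

Definition discrete_subgroup (Gam : set 'rV[R]_n) : Prop :=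
  [/\ Gam 0, forall x y, Gam x -> Gam y -> Gam (gmul x y),
      forall x, Gam x -> exists2 y, Gam y & gmul x y = 0 /\ gmul y x = 0
    & \forall x \near (0 : 'rV[R]_n), Gam x -> x = 0].

Definition time_of (z : 'rV[R]_n.+1) : R := z 0 0.
Definition space_of (z : 'rV[R]_n.+1) : 'rV[R]_n := rsubmx (z : 'rV[R]_(1 + n)).

(* The open subset [I x R^n] of [R^(1+n)], with its single chart. *)
Definition slab (I : set R) : atlas R n.+1 :=
  @Atlas R n.+1 {z : 'rV[R]_n.+1 | `[< I (time_of z) >]} unit
    (fun _ p => val p) (fun _ z => insub z).

(* [- N(t)^2 dt^2 + \sum_i a_i(t)^2 (omega^i)^2] *)
Definition diagonal_metric (N : R -> R) (a : nat -> R -> R) (z : 'rV[R]_n.+1) :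
    'M[R]_n.+1 :=
  let t := time_of z in
  let E := coframe (space_of z) in
  block_mx (- (N t) ^+ 2)%:M 0
           0 (E^T *m diag_mx (\row_(i < n) (a i t) ^+ 2) *m E) : 'M[R]_(1 + n).

Definition homogeneous (I : set R) (N : R -> R) (a : nat -> R -> R) (phi : R -> R) :
    development R n R :=
  @Development R n R
    (@Spacetime R n (slab I) (fun _ => diagonal_metric N a) (fun _ _ => delta_mx 0 0))
    (fun p => phi (time_of (val p))).

(* [Dq] is the quotient of the homogeneous development by [Gam] acting by left
   translations of the spatial group, with projection [pr]: the charts of the
   quotient manifold are local sections of [pr], and the metric, the time
   orientation and the field descend. *)
Definition discrete_quotient (Gam : set 'rV[R]_n) (I : set R) (N : R -> R)
    (a : nat -> R -> R) (phi : R -> R) (Dq : development R n R) : Prop :=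
  let D := homogeneous I N a phi in
  [/\ discrete_subgroup Gam, spacetime_axioms Dq
    & exists pr : D -> Dq,
      [/\ range pr = setT,
          forall p q : D, pr p = pr q <->
            exists2 s, Gam s & time_of (val q) = time_of (val p) /\
              space_of (val q) = gmul s (space_of (val p)),
          forall (b : ix Dq) x y, ichart b x = Some y ->
            exists2 p : D, val p = x & pr p = y,
          forall (b : ix Dq) x, image b x ->
            st_metric Dq b x = diagonal_metric N a x /\
            st_time Dq b x = delta_mx 0 0
        & forall p : D, dev_field Dq (pr p) = dev_field D p]].

Definition development_or_quotient (I : set R) (N : R -> R) (a : nat -> R -> R)
    (phi : R -> R) (D : development R n R) : Prop :=
  D = homogeneous I N a phi \/ exists Gam, discrete_quotient Gam I N a phi D.

End Nilpotent.

Arguments homogeneous {R} brk n.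

(** * The explicit solutions on the Heisenberg group of dimension [2 m + 1] *)

(* [- d omega^0 = \sum_r omega^(2r-1) /\ omega^(2r)] *)
Definition heisenberg : bracket :=
  fun k i j => [&& k == 0%N, odd i & j == i.+1].

Section Heisenberg.
Context {R : realType} (m : nat) (A p : nat -> R).

(* Here [r] ranges over [0, ..., m-1]. *)
Definition chi (r : nat) : R := 1 + p 0%N - p r.*2.+1 - p r.*2.+2.
Definition kappa (r : nat) : R := A 0%N / (A r.*2.+1 * A r.*2.+2).
Definition FF (r : nat) (tau : R) : R :=
  1 + kappa r ^+ 2 / (4 * chi r ^+ 2) * expR (2 * chi r * tau).

Definition heis_lapse (tau : R) : R :=
  expR tau * \prod_(r < m) Num.sqrt (FF r tau).

Definition heis_scale (i : nat) (tau : R) : R :=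
  A i * expR (p i * tau) *
  (if i is j.+1 then Num.sqrt (FF j./2 tau) else (\prod_(r < m) Num.sqrt (FF r tau))^-1).

Definition heis_data (q : R) : Prop :=
  [/\ (1 <= m)%N, forall i, (i <= m.*2)%N -> 0 < A i,
      \sum_(i < m.*2.+1) p i = 1,
      \sum_(i < m.*2.+1) p i ^+ 2 + q ^+ 2 = 1
    & forall r, (r < m)%N -> 0 < chi r].

End Heisenberg.

(** * Diagonal solutions on [H_3 x H_3 x R^(n-6)] with Kasner asymptotics *)

(* With indices starting at 0: [d omega^0 = - omega^1 /\ omega^2] and
   [d omega^3 = - omega^4 /\ omega^5]. *)
Definition heis3_heis3 : bracket :=
  fun k i j => (k, i, j) \in [:: (0, 1, 2); (3, 4, 5)]%N.

Section DoubleHeisenberg.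
Context {R : realType}.

(* The end [b] of the interval of existence may be [+oo]. *)
Definition upto (b : \bar R) : set R := [set t | 0 < t /\ (t%:E < b)%E].

Definition smooth_on (I : set R) (f : R -> R) : Prop :=
  forall (j : nat) t, I t -> derivable (derive1n j f) t 1.

Definition diagonal_solution (b : \bar R) (a : nat -> R -> R) (phi : R -> R) : Prop :=
  [/\ forall i, (i < 6)%N -> smooth_on (upto b) (a i),
      forall i, (i < 6)%N -> forall t, upto b t -> 0 < a i t,
      smooth_on (upto b) phi
    & scalar_development (homogeneous heis3_heis3 6 (upto b) (fun=> 1) a phi)].

Definition euler (f : R -> R) (t : R) : R := t * derive1 f t.

Definition kasner_asymptotics (eps : R) (p : nat -> R) (q : R)
    (a : nat -> R -> R) (phi : R -> R) : Prop :=
  forall j, (j <= 2)%N ->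
    (forall i, (i < 6)%N ->
       iter j euler (fun t => a i t / t `^ p i - 1) =O_ (0^'+) (fun t => t `^ eps)) /\
    iter j euler (fun t => phi t - q * ln t) =O_ (0^'+) (fun t => t `^ eps).

Definition maximal_expanding (b : \bar R) (a : nat -> R -> R) (phi : R -> R) : Prop :=
  [/\ (0 < b)%E, diagonal_solution b a phi,
      forall t, upto b t -> 0 < \sum_(i < 6) derive1 (a i) t / a i t
    & forall b' a' phi', (b < b')%E -> diagonal_solution b' a' phi' ->
        ~ forall t, upto b t -> phi' t = phi t /\
            forall i, (i < 6)%N -> a' i t = a i t].

Definition kasner (p : nat -> R) (q : R) : Prop :=
  \sum_(i < 6) p i = 1 /\ \sum_(i < 6) p i ^+ 2 + q ^+ 2 = 1.

Definition datum : Type := (nat -> R) * R.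

Definition scalar_datum : datum :=
  (nth 0 [seq x / 20 | x <- [:: -8; -1; 7; 8; 7; 7]], Num.sqrt 31 / 10).

Definition vacuum_datum : datum :=
  (nth 0 [seq x / 20 | x <- [:: -8; 3 - Num.sqrt 78; 3 + Num.sqrt 78; 8; 7; 7]], 0).

(* Product with the Euclidean space [R^(n-6)]. *)
Definition euclidean_factors (a : nat -> R -> R) (i : nat) : R -> R :=
  if (i < 6)%N then a i else fun=> 1.

End DoubleHeisenberg.

(* Main.v *)
(* If [gamma] is a unit-speed geodesic, the chain rule gives
   [D^mu d_mu (gamma o phi) = gamma'(phi) Box phi + |d phi|^2 (nabla_gamma' gamma')],
   and [(gamma o phi)^* G = |gamma'|^2 d phi (x) d phi], so the sigma-model
   equations reduce to the scalar ones with the same metric.  All causal and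
   global properties depend on the metric only.

   The scalar equations have to be verified for (a) and (c).  On a two-step
   nilpotent group the coframe is [E = 1 - B] with [B] linear in the coordinates
   and [B^2 = 0].  In this frame the Koszul connection coefficients of the
   diagonal metric depend on time alone, and the coordinate Ricci matrix is
   [E^T Ric(t) E].  This turns the field equations into ordinary differential
   equations in the logarithmic derivatives of the scale factors.  For (a) they
   are checked from the explicit formulas; for (c) the equations in dimension
   [n] involve only the indices of the six-dimensional solution. *)
Require Import Defs.
From mathcomp Require Import all_boot all_order all_algebra.
From mathcomp Require Import all_classical all_reals all_analysis.
From mathcomp Require Import ring.

Import Order.TTheory GRing.Theory Num.Theory.
Import numFieldNormedType.Exports.
Local Open Scope ring_scope.
Local Open Scope classical_set_scope.

Set Implicit Arguments.
Unset Strict Implicit.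
Unset Printing Implicit Defensive.

(** * Partial derivatives and smooth functions *)

(** Christoffel symbols are not expanded from the metric. A candidate connection is written down in
    the frame, torsion and metric compatibility are checked there, and uniqueness of the Levi-Civita
    connection identifies it with the coordinate symbols. Passing to coordinates is a gauge
    transformation, so in the curvature all derivatives of the frame cancel. The lapse is treated as
    one more coefficient, [eta 0 = - N^2], with its own logarithmic derivative [h 0]; this covers
    unit lapse and the lapse of (a) by the same formulas. In (a) the lapse is a constant multiple of
    the product of the scale factors. Hence the sum of all [h k] is [2 * h 0], the damping terms
    disappear, and an affine scalar field solves the wave equation. What remains is that the
    logarithmic derivative [f r] of [F_r] satisfies a logistic equation whose right-hand side is the
    curvature of the r-th pair; [chi_r] is the exponent and [kappa_r^2 / (4 chi_r^2)] the constant
    for which this holds. For (c) the differential equations are recovered from the given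
    six-dimensional solution at the neutral element, where the frame is the coordinate frame. *)

Lemma near_eq_differentiable (R : numFieldType) (V W : normedModType R)
    (f g : V -> W) (x : V) :
  {near x, f =1 g} -> differentiable f x -> differentiable g x.
Proof.
move=> fg df.
(* [f] and [g] have the same increments near [x], so the linear part of [f] also approximates [g] to
   first order; [diff_unique] then identifies it with the differential of [g]. *)
have gE : g \o shift x = cst (g x) + 'd f x +o_ 0 id.
  apply/eqaddoP => e e0.
  have /eqaddoP/(_ e e0) := diff_locally df.
  have fg0 : \forall h \near (0 : V), f (h + x) = g (h + x).
    by rewrite (near_shift x) /= sub0r; near=> y; rewrite /= subrK; near: y.
  rewrite !near_simpl => H; near=> h.
  have : `|(f \o shift x - (cst (f x) + 'd f x)) h| <= e * `|id h|.
    by near: h.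
  rewrite /GRing.add /GRing.opp /= /cst (nbhs_singleton fg).
  by have -> : f (h + x) = g (h + x) by near: h.
have dE := diff_unique (diff_continuous df) gE.
apply/diff_locallyP; split.
  by rewrite dE; exact: diff_continuous.
by rewrite dE.
Unshelve. all: by end_near. Qed.

Section PartialDerivatives.
Context {R : realType} {d : nat}.
Implicit Types (a : R) (U : set 'rV[R]_d) (f g : 'rV[R]_d -> R) (i : 'I_d).

Lemma eq_pd U f g i x : open U -> U x -> {in U, f =1 g} -> pd i f x = pd i g x.
Proof.
move=> oU Ux fg; apply: near_eq_derive.
by apply: filterS (open_nbhs_nbhs (conj oU Ux)) => y Uy; apply: fg; rewrite inE.
Qed.

Lemma eq_differentiable U f g x : open U -> U x -> {in U, f =1 g} ->
  differentiable f x -> differentiable g x.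
Proof.
move=> oU Ux fg; apply: near_eq_differentiable.
by apply: filterS (open_nbhs_nbhs (conj oU Ux)) => y Uy; apply: fg; rewrite inE.
Qed.

Lemma pd_cst a i x : pd i (fun=> a) x = 0.
Proof. exact: derive_cst. Qed.

Lemma pdD f g i x : differentiable f x -> differentiable g x ->
  pd i (fun y => f y + g y) x = pd i f x + pd i g x.
Proof. by move=> df dg; apply: deriveD; exact: diff_derivable. Qed.

Lemma pdN f i x : differentiable f x -> pd i (fun y => - f y) x = - pd i f x.
Proof. by move=> df; apply: deriveN; exact: diff_derivable. Qed.

Lemma pdM f g i x : differentiable f x -> differentiable g x ->
  pd i (fun y => f y * g y) x = pd i f x * g x + f x * pd i g x.
Proof.
move=> df dg; rewrite /pd -[fun _ => _]/(f * g) deriveM; try exact: diff_derivable.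
by rewrite addrC; congr (_ + _); exact: mulrC.
Qed.

Lemma differentiable_big_sum (I : finType) (P : pred I) (F : I -> 'rV[R]_d -> R) x :
  (forall k, P k -> differentiable (F k) x) ->
  differentiable (fun y => \sum_(k | P k) F k y) x.
Proof.
move=> dF; rewrite (_ : (fun _ => _) = \sum_(k | P k) F k); last first.
  by apply/funext => y; rewrite fct_sumE.
apply: (big_ind (fun f => differentiable f x)) => //.
by move=> *; exact: differentiableD.
Qed.

Lemma pd_sum (I : finType) (P : pred I) (F : I -> 'rV[R]_d -> R) i x :
  (forall k, P k -> differentiable (F k) x) ->
  pd i (fun y => \sum_(k | P k) F k y) x = \sum_(k | P k) pd i (F k) x.
Proof.
move=> dF; rewrite (_ : (fun _ => _) = \sum_(k | P k) F k); last first.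
  by apply/funext => y; rewrite fct_sumE.
suff [] : differentiable (\sum_(k | P k) F k) x /\
    pd i (\sum_(k | P k) F k) x = \sum_(k | P k) pd i (F k) x by [].
apply: (big_rec2 (fun f v => differentiable f x /\ pd i f x = v)).
  by split; [exact: (differentiable_cst (0 : R) x) | exact: (derive_cst (0 : R))].
move=> k f v Pk [df <-]; split; first exact: differentiableD (dF _ Pk) df.
by rewrite -pdD //; exact: dF.
Qed.

Lemma differentiable_coor i x : differentiable (fun y : 'rV[R]_d => y 0 i) x.
Proof. exact: differentiable_coord. Qed.

Lemma pd_coor i j x : pd i (fun y : 'rV[R]_d => y 0 j) x = (i == j)%:R.
Proof.
have /(congr1 (fun M : 'rV[R]_d => M 0 j)) :=
  derive_mx (@derivable_id _ _ x (delta_mx 0 i)).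
by rewrite derive_id !mxE eqxx eq_sym.
Qed.

Lemma differentiable_fcomp (c : R -> R) f x :
  derivable c (f x) 1 -> differentiable f x -> differentiable (fun y => c (f y)) x.
Proof. by move=> /derivable1_diffP dc df; exact: differentiable_comp. Qed.

Lemma pd_comp (c : R -> R) f i x : derivable c (f x) 1 -> differentiable f x ->
  pd i (fun y => c (f y)) x = derive1 c (f x) * pd i f x.
Proof.
move=> dc df; rewrite /pd !deriveE //; last exact: differentiable_fcomp.
rewrite -[fun _ => _]/(c \o f) diff_comp //; last exact/derivable1_diffP.
by rewrite /= deriv1E // mulrC.
Qed.

Lemma differentiable_fV f x : differentiable f x -> f x != 0 ->
  differentiable (fun y => (f y)^-1) x.
Proof. by move=> df f0;
  exact: (@differentiable_comp _ _ _ _ f _ _ df (differentiable_Rinv f0)). Qed.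

Lemma pdV f i x : differentiable f x -> f x != 0 ->
  pd i (fun y => (f y)^-1) x = - (f x)^-1 * (f x)^-1 * pd i f x.
Proof.
move=> df f0; rewrite /pd deriveV //; last exact: diff_derivable.
by rewrite /GRing.scale /= expr2 invfM !mulNr.
Qed.

(** Smoothness to finite order, recursive in the innermost derivative. Closure under products and
    compositions follows by induction on [n]; for one fixed sequence of derivatives, as in [Ck_on],
    the Leibniz rule would not close up. *)
Fixpoint diffn n U f : Prop :=
  if n is m.+1 then
    (forall x, U x -> differentiable f x) /\ forall i, diffn m U (pd i f)
  else True.

Lemma iter_pd_rcons s i f : iter_pd (rcons s i) f = iter_pd s (pd i f).
Proof. by rewrite /iter_pd foldr_rcons. Qed.

(** [iter_pd] folds from the right, so the last entry of the sequence is differentiated first;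
    peeling it off with [rcons] matches the recursion of [diffn]. *)
Lemma smoothP U f : Ck_on None U f <-> forall n, diffn n U f.
Proof.
split=> [Cf n|].
  elim: n f Cf => // n IHn f Cf; split=> [x Ux|i].
    by have [_ /(_ isT)] := Cf [::] x Ux.
  by apply: IHn => s x Ux; have := Cf (rcons s i) x Ux; rewrite iter_pd_rcons.
move=> Df s x Ux.
suff dx : differentiable (iter_pd s f) x.
  by split=> // _; exact: differentiable_continuous.
elim/last_ind: s f Df => [|s i IHs] f Df; first by have [/(_ _ Ux)] := Df 1%N.
by rewrite iter_pd_rcons; apply: IHs => n; have [_] := Df n.+1; exact.
Qed.

Lemma smooth_differentiable U f x :
  Ck_on None U f -> U x -> differentiable f x.
Proof. by move=> Cf Ux; have [_ /(_ isT)] := Cf [::] x Ux. Qed.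

Lemma smooth_pd U f i : Ck_on None U f -> Ck_on None U (pd i f).
Proof. by move=> Cf s x Ux; have := Cf (rcons s i) x Ux; rewrite iter_pd_rcons. Qed.

Lemma sub_smooth U U' f : U' `<=` U -> Ck_on None U f -> Ck_on None U' f.
Proof. by move=> sU Cf s x /sU; exact: Cf. Qed.

(** In the Leibniz and chain rules one factor stays undifferentiated and enters the induction
    hypothesis at the lower order. *)
Lemma diffnS n U f : diffn n.+1 U f -> diffn n U f.
Proof.
elim: n f => // n IHn f [df Df]; split=> // i; exact: IHn.
Qed.

Section Open.
Variable U : set 'rV[R]_d.
Hypothesis oU : open U.

Lemma diffn_eq n f g : {in U, f =1 g} -> diffn n U f -> diffn n U g.
Proof.
elim: n f g => // n IHn f g fg [df Df]; split=> [x Ux|i].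
  exact: (eq_differentiable oU Ux fg (df x Ux)).
apply: IHn (Df i) => x; rewrite inE => Ux.
exact: (eq_pd i oU Ux fg).
Qed.

Lemma diffn_cst n a : diffn n U (fun=> a).
Proof.
elim: n a => // n IHn a; split=> [x _|i]; first exact: differentiable_cst.
by apply: diffn_eq (IHn 0) => x _; rewrite pd_cst.
Qed.

Lemma diffnD n f g : diffn n U f -> diffn n U g -> diffn n U (fun y => f y + g y).
Proof.
elim: n f g => // n IHn f g [df Df] [dg Dg]; split=> [x Ux|i].
  by apply: differentiableD; [exact: df|exact: dg].
apply: diffn_eq (IHn _ _ (Df i) (Dg i)) => x; rewrite inE => Ux.
by rewrite pdD //; [exact: df|exact: dg].
Qed.

Lemma diffnM n f g : diffn n U f -> diffn n U g -> diffn n U (fun y => f y * g y).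
Proof.
elim: n f g => // n IHn f g Df' Dg'.
have [[df Df] [dg Dg]] := (Df', Dg'); split=> [x Ux|i].
  by apply: differentiableM; [exact: df|exact: dg].
apply: diffn_eq (diffnD (IHn _ _ (Df i) (diffnS Dg')) (IHn _ _ (diffnS Df') (Dg i))).
by move=> x; rewrite inE => Ux; rewrite pdM //; [exact: df|exact: dg].
Qed.

Lemma diffn_coor n j : diffn n U (fun y => y 0 j).
Proof.
case: n => // n; split=> [x _|i]; first exact: differentiable_coord.
by apply: diffn_eq (diffn_cst n (i == j)%:R) => x _; rewrite pd_coor.
Qed.

Lemma diffnV n f : (forall x, U x -> f x != 0) -> diffn n U f ->
  diffn n U (fun y => (f y)^-1).
Proof.
move=> f0; elim: n => // n IHn Df'.
have [df Df] := Df'; split=> [x Ux|i]; first exact: differentiable_fV (df _ Ux) (f0 _ Ux).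
have DV := IHn (diffnS Df').
apply: diffn_eq (diffnM (diffnM (diffnM (diffn_cst n (- 1)) DV) DV) (Df i)).
by move=> x; rewrite inE => Ux; rewrite pdV ?mulN1r //; [exact: df|exact: f0].
Qed.

(** The induction generalizes over [c], because the chain rule replaces [c] by its derivative, which
    is again smooth on [J]. *)
Lemma diffn_comp n (J : set R) (c : R -> R) f : smooth_on J c ->
  (forall x, U x -> J (f x)) -> diffn n U f -> diffn n U (fun y => c (f y)).
Proof.
move=> + fJ; elim: n c => // n IHn c Sc Df'.
have [df Df] := Df'; split=> [x Ux|i].
  by apply: differentiable_fcomp; [exact: (Sc 0%N _ (fJ _ Ux))|exact: df].
have Sc' : smooth_on J (derive1 c).
  by move=> j t Jt; rewrite -derive1Sn; exact: Sc.
apply: diffn_eq (diffnM (IHn _ Sc' (diffnS Df')) (Df i)) => x; rewrite inE => Ux.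
by rewrite pd_comp //; [exact: (Sc 0%N _ (fJ _ Ux))|exact: df].
Qed.

Lemma smooth_eq f g : {in U, f =1 g} -> Ck_on None U f -> Ck_on None U g.
Proof. by move=> fg /smoothP Df; apply/smoothP => n; exact: diffn_eq (Df n). Qed.

Lemma smooth_cst a : Ck_on None U (fun=> a).
Proof. by apply/smoothP => n; exact: diffn_cst. Qed.

Lemma smooth_coor j : Ck_on None U (fun y => y 0 j).
Proof. by apply/smoothP => n; exact: diffn_coor. Qed.

Lemma smoothD f g : Ck_on None U f -> Ck_on None U g ->
  Ck_on None U (fun y => f y + g y).
Proof. by move=> /smoothP Df /smoothP Dg; apply/smoothP => n; exact: diffnD. Qed.

Lemma smoothM f g : Ck_on None U f -> Ck_on None U g ->
  Ck_on None U (fun y => f y * g y).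
Proof. by move=> /smoothP Df /smoothP Dg; apply/smoothP => n; exact: diffnM. Qed.

Lemma smoothN f : Ck_on None U f -> Ck_on None U (fun y => - f y).
Proof.
move=> /(smoothM (smooth_cst (- 1))); apply: smooth_eq => x _.
by rewrite mulN1r.
Qed.

Lemma smoothX f n : Ck_on None U f -> Ck_on None U (fun y => f y ^+ n).
Proof.
move=> Cf; elim: n => [|n IHn]; first exact: smooth_cst.
by under eq_fun do rewrite exprS; exact: smoothM.
Qed.

Lemma smoothV f : (forall x, U x -> f x != 0) -> Ck_on None U f ->
  Ck_on None U (fun y => (f y)^-1).
Proof. by move=> f0 /smoothP Df; apply/smoothP => n; exact: diffnV. Qed.

Lemma smooth_comp (J : set R) (c : R -> R) f : smooth_on J c ->
  (forall x, U x -> J (f x)) -> Ck_on None U f -> Ck_on None U (fun y => c (f y)).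
Proof. by move=> Sc fJ /smoothP Df; apply/smoothP => n; exact: (diffn_comp Sc). Qed.

Lemma smooth_sum (I : finType) (P : pred I) (F : I -> 'rV[R]_d -> R) :
  (forall k, P k -> Ck_on None U (F k)) ->
  Ck_on None U (fun y => \sum_(k | P k) F k y).
Proof.
move=> CF; rewrite (_ : (fun _ => _) = \sum_(k | P k) F k); last first.
  by apply/funext => y; rewrite fct_sumE.
by apply: big_ind => //; [exact: (smooth_cst 0)|exact: smoothD].
Qed.

Lemma smooth_prod (I : finType) (P : pred I) (F : I -> 'rV[R]_d -> R) :
  (forall k, P k -> Ck_on None U (F k)) ->
  Ck_on None U (fun y => \prod_(k | P k) F k y).
Proof.
move=> CF; rewrite (_ : (fun _ => _) = \prod_(k | P k) F k); last first.
  by apply/funext => y; rewrite fct_prodE.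
by apply: big_ind => //; [exact: (smooth_cst 1)|exact: smoothM].
Qed.

End Open.

End PartialDerivatives.

Lemma jacobianE (R : realType) (d e : nat) (u : 'rV[R]_d -> 'rV[R]_e) x i B :
  differentiable u x -> ('J u x) i B = pd i (fun y => u y 0 B) x.
Proof.
move=> du.
have /(congr1 (fun M : 'rV[R]_e => M 0 B)) := deriveEjacobian (delta_mx 0 i) du.
rewrite derive_mx; last exact: diff_derivable.
by rewrite -rowE mxE [RHS]mxE.
Qed.

Lemma differentiable_row (R : realType) (d e : nat) (u : 'rV[R]_d -> 'rV[R]_e) x :
  (forall B, differentiable (fun y => u y 0 B) x) -> differentiable u x.
Proof.
move=> du; rewrite (_ : u = \sum_B (fun y => u y 0 B *: (delta_mx 0 B : 'rV[R]_e))).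
  by apply: differentiable_sum => B; exact: differentiableZl.
by apply/funext => y; rewrite fct_sumE [LHS]row_sum_delta.
Qed.

(** * Composition with a geodesic *)

(** The axioms make only the overlaps [in_chart a (dom b)] open. Since chart domains cover the
    manifold, the union of the overlaps over [b] is the whole image. *)
Lemma open_image (R : realType) (d : nat) (M : atlas R d) (a : ix M) :
  manifold M -> open (Defs.image a).
Proof.
move=> [[cov _] oM _ _ _].
rewrite (_ : Defs.image a = \bigcup_(b in setT) in_chart a (dom b)).
  by apply: bigcup_open => b _; exact: oM.
apply/seteqP; split=> x [p].
  by move=> xp _; have [b pb] := cov p; exists b => //; exists p.
by move=> _ [q xq _]; exists q.
Qed.

Section GeodesicComposition.
Context {R : realType} {d e : nat} {M : atlas R d} {T : atlas R e}.
Variables (g : tensor2 M) (G : tensor2 T) (phi : M -> R) (gamma : R -> T).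
Hypothesis hM : manifold M.
Hypothesis hgeo : geodesic G setT gamma.
Hypothesis hunit : unit_speed G gamma.
Hypothesis hsol : einstein_scalar g phi.

Local Notation Phi := (gamma \o phi).
Local Notation f a := (loc a phi).
Local Notation u a b := (loc a (fun p => chart b (Phi p))).
Local Notation O b := (gamma @^-1` dom b).

Local Lemma in_chartE (a : ix M) (b : ix T) :
  in_chart a (Phi @^-1` dom b) = Defs.image a `&` (f a) @^-1` O b.
Proof.
apply/seteqP; split=> x.
  by move=> [p xp pb]; split; [exists p|rewrite /preimage /= /loc xp].
by move=> [[p xp _]]; rewrite /preimage /= /loc xp /= => pb; exists p.
Qed.

Local Lemma smooth_coord (b : ix T) A : smooth_on (O b) (Defs.coord b gamma A).
Proof. by move=> j t Ot; have [+ _] := hgeo => /(_ b) [_]; exact. Qed.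

Local Lemma open_O (b : ix T) : open (O b).
Proof. by have [+ _] := hgeo => /(_ b) [+ _]; rewrite setTI. Qed.

Local Lemma smooth_f (a : ix M) : Ck_on None (Defs.image a) (f a).
Proof. by have [] := hsol. Qed.

Local Lemma open_in_chart (a : ix M) (b : ix T) :
  open (in_chart a (Phi @^-1` dom b)).
Proof.
rewrite in_chartE openE => x [ax xb].
have oa := open_image (a := a) hM.
apply: filterI; first exact: open_nbhs_nbhs.
have cf : {for x, continuous (f a)}.
  exact: differentiable_continuous (smooth_differentiable (smooth_f (a := a)) ax).
by apply: cf; exact: open_nbhs_nbhs (conj (open_O (b := b)) xb).
Qed.

Local Lemma uE (a : ix M) (b : ix T) A x : Defs.image a x ->
  u a b x 0 A = Defs.coord b gamma A (f a x).
Proof. by move=> [p xp _]; rewrite /loc xp. Qed.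

Local Lemma smooth_u (a : ix M) (b : ix T) A :
  Ck_on None (in_chart a (Phi @^-1` dom b)) (fun x => u a b x 0 A).
Proof.
have oV := @open_in_chart a b.
have Va : in_chart a (Phi @^-1` dom b) `<=` Defs.image a.
  by rewrite in_chartE => x [].
apply: (smooth_eq oV (f := fun x => Defs.coord b gamma A (f a x))) => [x|].
  by rewrite inE => /Va ax; rewrite uE.
apply: (smooth_comp oV (smooth_coord (b := b) (A := A))).
  by rewrite in_chartE => x [].
exact: sub_smooth (smooth_f (a := a)).
Qed.

Local Lemma pd_u (a : ix M) (b : ix T) A i x :
  in_chart a (Phi @^-1` dom b) x ->
  pd i (fun y => u a b y 0 A) x = velocity b gamma (f a x) 0 A * pd i (f a) x.
Proof.
rewrite in_chartE => -[ax bx].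
rewrite (eq_pd (U := Defs.image a) (g := fun y => Defs.coord b gamma A (f a y))) //.
- rewrite pd_comp ?mxE //; first exact: (smooth_coord (j := 0%N)).
  exact: smooth_differentiable (smooth_f (a := a)) ax.
- exact: open_image.
- by move=> y; rewrite inE => ay; rewrite uE.
Qed.

Local Lemma pd2_u (a : ix M) (b : ix T) A i j x :
  in_chart a (Phi @^-1` dom b) x ->
  pd i (pd j (fun y => u a b y 0 A)) x =
  derive1n 2 (Defs.coord b gamma A) (f a x) * (pd i (f a) x * pd j (f a) x) +
  velocity b gamma (f a x) 0 A * pd i (pd j (f a)) x.
Proof.
move=> Vx; have := Vx; rewrite in_chartE => -[ax bx].
rewrite (eq_pd (g := fun y => derive1 (Defs.coord b gamma A) (f a y) * pd j (f a) y)
  _ (@open_in_chart a b)) //; last first.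
  by move=> y; rewrite inE => Vy; rewrite pd_u // mxE.
have df := smooth_differentiable (smooth_f (a := a)) ax.
have dc : derivable (derive1 (Defs.coord b gamma A)) (f a x) 1.
  exact: (smooth_coord (j := 1%N)).
rewrite pdM; last 2 first.
- exact: differentiable_fcomp.
- exact: smooth_differentiable (smooth_pd j (smooth_f (a := a))) ax.
by rewrite pd_comp // mxE mulrA.
Qed.

Lemma geodesic_einstein_sigma : einstein_sigma g G Phi.
Proof.
split=> [a b|a b x Vx].
  by split; [exact: open_in_chart | exact: smooth_u].
have := Vx; rewrite in_chartE => -[ax bx].
have ux : u a b x = chart b (gamma (f a x)).
  by case: ax => p xp _; rewrite /loc xp.
have [_ /(_ a x ax) ric /(_ a x ax) bx0] := hsol.
set t := f a x; set v := velocity b gamma t.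
have du : differentiable (u a b) x.
  by apply: differentiable_row => B; exact: smooth_differentiable (smooth_u B) Vx.
move=> w; split.
  rewrite ric; apply/matrixP => i j; rewrite /pullback_mx.
  (* The map factors through the line, so its Jacobian has rank one: a gradient column times the
     velocity row. The pullback thus encloses the 1x1 matrix [v G v^T], which unit speed makes the
     identity. *)
  have -> : 'J w x = (\col_k pd k (f a) x) *m v.
    apply/matrixP => k B; rewrite jacobianE // pd_u // !mxE big_ord1 !mxE mulrC.
    by [].
  rewrite trmx_mul -!mulmxA (mulmxA v) (mulmxA (v *m _)).
  rewrite /w ux (_ : v *m _ *m _ = 1%:M).
    by rewrite mul1mx !mxE big_ord1 !mxE.
  by rewrite [LHS]mx11_scalar -[_ 0 0]/(pairing _ _ _) hunit.
move=> A; rewrite /tension.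
(* [c2 + S] is the covariant acceleration of [gamma]; second derivatives of [gamma] and target
   Christoffel terms in the tension assemble into multiples of it. *)
pose S := \sum_i \sum_j christoffel (G b) A i j (chart b (gamma t)) * (v 0 i * v 0 j).
pose c2 := derive1n 2 (Defs.coord b gamma A) t.
have geo : c2 + S = 0 by exact: hgeo.2.
transitivity (v 0 A * box (g a) (f a) x + (\sum_i \sum_j invmx (g a x) i j *
    (pd i (f a) x * pd j (f a) x)) *
    (c2 + S)); last by rewrite bx0 geo !mulr0 addr0.
rewrite /box mulr_sumr mulr_suml -big_split /=.
apply: eq_bigr => i _; rewrite mulr_sumr mulr_suml -big_split /=.
apply: eq_bigr => j _; rewrite pd2_u // -/t -/v -/c2.
have -> : \sum_k christoffel (g a) k i j x * pd k (fun y => u a b y 0 A) x =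
    v 0 A * \sum_k christoffel (g a) k i j x * pd k (f a) x.
  rewrite mulr_sumr; apply: eq_bigr => k _; rewrite pd_u // -/t -/v.
  exact: mulrCA.
rewrite /w ux.
have -> : \sum_B \sum_C christoffel (G b) A B C (chart b (gamma (f a x))) *
    (pd i (fun y => u a b y 0 B) x * pd j (fun y => u a b y 0 C) x) =
    S * (pd i (f a) x * pd j (f a) x).
  rewrite mulr_suml; apply: eq_bigr => B _; rewrite mulr_suml.
  apply: eq_bigr => C _; rewrite !pd_u // -/t -/v.
  by rewrite -[RHS]mulrA; congr (_ * _); exact: mulrACA.
set K := \sum_k _; move: (invmx _ _ _) c2 S K {geo} => *; ring.
Qed.

End GeodesicComposition.

(** * Christoffel symbols and the Ricci tensor in matrix form *)

Section MatrixDerivative.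
Context {R : realType} {d : nat}.

Definition mx_pd m p (i : 'I_d) (f : 'rV[R]_d -> 'M[R]_(m, p)) x : 'M[R]_(m, p) :=
  \matrix_(k, l) pd i (fun y => f y k l) x.

Definition mx_differentiable m p (f : 'rV[R]_d -> 'M[R]_(m, p)) x :=
  forall k l, differentiable (fun y => f y k l) x.

Lemma mx_differentiableD m p (f g : 'rV[R]_d -> 'M[R]_(m, p)) x :
  mx_differentiable f x -> mx_differentiable g x ->
  mx_differentiable (fun y => f y + g y) x.
Proof.
move=> df dg k l; under eq_fun do rewrite mxE.
exact: differentiableD (df k l) (dg k l).
Qed.

Lemma mx_pdD m p i (f g : 'rV[R]_d -> 'M[R]_(m, p)) x :
  mx_differentiable f x -> mx_differentiable g x ->
  mx_pd i (fun y => f y + g y) x = mx_pd i f x + mx_pd i g x.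
Proof.
move=> df dg; apply/matrixP => k l; rewrite !mxE -pdD //.
by congr (pd i _ x); apply/funext => y; rewrite mxE.
Qed.

Lemma mx_differentiableN m p (f : 'rV[R]_d -> 'M[R]_(m, p)) x :
  mx_differentiable f x -> mx_differentiable (fun y => - f y) x.
Proof.
move=> df k l; under eq_fun do rewrite mxE.
exact: differentiableN (df k l).
Qed.

Lemma mx_pdN m p i (f : 'rV[R]_d -> 'M[R]_(m, p)) x :
  mx_differentiable f x -> mx_pd i (fun y => - f y) x = - mx_pd i f x.
Proof.
move=> df; apply/matrixP => k l; rewrite !mxE -pdN //.
by congr (pd i _ x); apply/funext => y; rewrite mxE.
Qed.

Lemma mx_differentiable_cst m p (A : 'M[R]_(m, p)) x : mx_differentiable (fun=> A) x.
Proof. by move=> k l; exact: differentiable_cst. Qed.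

Lemma mx_pd_cst m p i (A : 'M[R]_(m, p)) x : mx_pd i (fun=> A) x = 0.
Proof. by apply/matrixP => k l; rewrite !mxE pd_cst. Qed.

Lemma mx_differentiableM m p q (f : 'rV[R]_d -> 'M[R]_(m, p))
    (g : 'rV[R]_d -> 'M[R]_(p, q)) x :
  mx_differentiable f x -> mx_differentiable g x ->
  mx_differentiable (fun y => f y *m g y) x.
Proof.
move=> df dg k l; under eq_fun do rewrite mxE.
by apply: differentiable_big_sum => j _; exact: differentiableM (df k j) (dg j l).
Qed.

Lemma mx_pdM m p q i (f : 'rV[R]_d -> 'M[R]_(m, p))
    (g : 'rV[R]_d -> 'M[R]_(p, q)) x :
  mx_differentiable f x -> mx_differentiable g x ->
  mx_pd i (fun y => f y *m g y) x = mx_pd i f x *m g x + f x *m mx_pd i g x.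
Proof.
move=> df dg; apply/matrixP => k l; rewrite !mxE -big_split /=.
transitivity (pd i (fun y => \sum_j f y k j * g y j l) x).
  by congr (pd i _ x); apply/funext => y; rewrite mxE.
rewrite pd_sum => [|j _]; last exact: differentiableM (df k j) (dg j l).
by apply: eq_bigr => j _; rewrite pdM ?mxE.
Qed.

Lemma mx_differentiable_tr m p (f : 'rV[R]_d -> 'M[R]_(m, p)) x :
  mx_differentiable f x -> mx_differentiable (fun y => (f y)^T) x.
Proof. by move=> df k l; under eq_fun do rewrite mxE; exact: df. Qed.

Lemma mx_pd_tr m p i (f : 'rV[R]_d -> 'M[R]_(m, p)) x :
  mx_pd i (fun y => (f y)^T) x = (mx_pd i f x)^T.
Proof.
apply/matrixP => k l; rewrite !mxE.
by congr (pd i _ x); apply/funext => y; rewrite mxE.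
Qed.

End MatrixDerivative.

(* The compatibility of a symmetric connection with the metric determines its
   Christoffel symbols; here [Gam i] is the matrix of the [Gamma^k_(i j)]. *)
Lemma christoffel_unique (R : realType) (d : nat) (g : 'rV[R]_d -> 'M[R]_d)
    (Gam : 'I_d -> 'M[R]_d) x :
  g x \in unitmx -> (g x)^T = g x ->
  (forall i j k, Gam i k j = Gam j k i) ->
  (forall i, mx_pd i g x = (Gam i)^T *m g x + g x *m Gam i) ->
  forall i j k, christoffel g k i j x = Gam i k j.
Proof.
move=> gu gT Gs compat i j k.
have dg l p q : pd l (fun y => g y p q) x =
    \sum_m Gam l m p * g x m q + \sum_m g x p m * Gam l m q.
  have /(congr1 (fun A : 'M[R]_d => A p q)) := compat l.
  by rewrite !mxE => ->; congr (_ + _); apply: eq_bigr => m _; rewrite mxE.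
have gs p q : g x p q = g x q p by rewrite -[in LHS]gT mxE.
rewrite /christoffel.
have -> : \sum_l invmx (g x) k l * (pd i (fun y => g y l j) x +
    pd j (fun y => g y l i) x - pd l (fun y => g y i j) x) =
    \sum_l invmx (g x) k l * ((g x *m Gam i) l j *+ 2).
  (* By the symmetries of [Gam] and [g], four of the six sums cancel in pairs and the other two
     coincide. *)
  apply: eq_bigr => l _; congr (_ * _); rewrite !dg mxE.
  have e1 : \sum_m Gam i m l * g x m j = \sum_m Gam l m i * g x m j.
    by apply: eq_bigr => m _; rewrite Gs.
  have e2 : \sum_m Gam j m l * g x m i = \sum_m g x i m * Gam l m j.
    by apply: eq_bigr => m _; rewrite Gs mulrC gs.
  have e3 : \sum_m g x l m * Gam j m i = \sum_m g x l m * Gam i m j.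
    by apply: eq_bigr => m _; rewrite Gs.
  by rewrite e1 e2 e3 mulr2n; set a := \sum_m _; set b := \sum_m _; set a' := \sum_m _;
    ring.
have -> : \sum_l invmx (g x) k l * ((g x *m Gam i) l j *+ 2) =
    (invmx (g x) *m (g x *m Gam i)) k j * 2.
  rewrite [in RHS]mxE mulr_suml; apply: eq_bigr => l _.
  by rewrite -mulrA mulr_natr.
by rewrite mulKmx // mulrC mulfK // pnatr_eq0.
Qed.

(** The summand is the matrix of the curvature endomorphism of the coordinate fields [i] and [j];
    Ricci contracts its row index with [i]. Agreement on an open set allows [Gam] to be
    differentiated in place of the Christoffel symbols. *)
Lemma ricci_mx (R : realType) (d : nat) (g : 'rV[R]_d -> 'M[R]_d)
    (Gam : 'I_d -> 'rV[R]_d -> 'M[R]_d) (U : set 'rV[R]_d) x :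
  open U -> U x ->
  (forall y, U y -> forall i j k, christoffel g k i j y = Gam i y k j) ->
  forall j k, ricci g x j k =
    \sum_i (mx_pd i (Gam j) x - mx_pd j (Gam i) x
            + (Gam i x *m Gam j x - Gam j x *m Gam i x)) i k.
Proof.
move=> oU Ux chE j k; rewrite mxE -sumrB -big_split /=.
apply: eq_bigr => i _; rewrite !mxE; congr (_ - _ + _).
- by apply: eq_pd Ux _ => // y; rewrite inE => Uy; exact: chE.
- by apply: eq_pd Ux _ => // y; rewrite inE => Uy; exact: chE.
- by rewrite -sumrB; apply: eq_bigr => l _; rewrite !chE.
Qed.

(** * Left-invariant frames on two-step nilpotent groups *)

(** The hypotheses let [C] absorb the frame matrices, so each cross term keeps exactly one [C];
    these are the terms that must cancel in [curvature_algebra]. *)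
Lemma connection_mul_algebra (R : pzRingType) (d : nat) (Ci Cj F E wi wj : 'M[R]_d) :
  Ci *m Cj = 0 -> Ci *m F = Ci -> E *m Cj = Cj -> E *m F = 1%:M ->
  (- Ci + F *m wi *m E) *m (- Cj + F *m wj *m E) =
  F *m (wi *m wj) *m E - Ci *m wj *m E - F *m wi *m Cj.
Proof.
move=> CC CF EC EF; rewrite mulmxDr !mulmxDl !mulmxN !mulNmx CC opprK add0r.
rewrite -[_ *m E *m Cj]mulmxA EC !mulmxA CF -[_ *m E *m F]mulmxA EF mulmx1.
by rewrite addrC; congr (_ - _); rewrite addrC.
Qed.

(** Gauge covariance of curvature: the inhomogeneous terms of the two derivatives cancel against
    those of the commutator, leaving a conjugate of the frame expression. *)
Lemma curvature_algebra (R : comNzRingType) (d : nat)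
    (Ci Cj F E wi wj Pij Pji : 'M[R]_d) :
  Ci *m wj *m E + F *m Pij *m E - F *m wj *m Ci
  - (Cj *m wi *m E + F *m Pji *m E - F *m wi *m Cj)
  + (F *m (wi *m wj) *m E - Ci *m wj *m E - F *m wi *m Cj
     - (F *m (wj *m wi) *m E - Cj *m wi *m E - F *m wj *m Ci)) =
  F *m (Pij - Pji + (wi *m wj - wj *m wi)) *m E.
Proof.
rewrite mulmxDr !mulmxBr mulmxDl !mulmxBl.
set x1 := Ci *m _ *m _; set x2 := F *m Pij *m E; set x3 := F *m _ *m Ci.
set y1 := Cj *m _ *m _; set y2 := F *m Pji *m E; set y3 := F *m _ *m Cj.
set u := F *m _ *m E; set v := F *m _ *m E.
clearbody x1 x2 x3 y1 y2 y3 u v.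
by apply/matrixP => k l; rewrite !mxE; ring.
Qed.

(** The left side is the Leibniz expansion of the derivative of [E^T D E], with [- C] the derivative
    of [E]; the right side is the symmetrization of metric times connection. *)
Lemma compat_algebra (R : comNzRingType) (d : nat) (E D C w D' : 'M[R]_d) :
  D^T = D -> D *m w + w^T *m D = D' ->
  ((- C)^T *m D + E^T *m D') *m E + E^T *m D *m - C =
  (- (E^T *m D *m C) + E^T *m (D *m w) *m E)^T +
  (- (E^T *m D *m C) + E^T *m (D *m w) *m E).
Proof.
move=> DT <-; rewrite [in RHS]raddfD !raddfN /= !trmx_mul trmxK DT.
rewrite mulmxDr !mulmxDl !mulNmx ?mulmxN !mulmxA.
by rewrite -!addrA; congr (_ + _); rewrite addrCA; congr (_ + _); rewrite addrC.
Qed.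

Lemma differentiable_coorM (R : realType) (d : nat) (m : 'I_d) (a : R) x :
  differentiable (fun y : 'rV[R]_d => y 0 m * a) x.
Proof.
by apply: differentiableM; [exact: differentiable_coor|exact: differentiable_cst].
Qed.

Lemma pd_coorM (R : realType) (d : nat) (i m : 'I_d) (a : R) x :
  pd i (fun y : 'rV[R]_d => y 0 m * a) x = (i == m)%:R * a.
Proof.
rewrite pdM; [|exact: differentiable_coor|exact: differentiable_cst].
by rewrite pd_coor pd_cst mulr0 addr0.
Qed.

Section Frame.
Context {R : realType} {n : nat}.
Local Notation d := n.+1.
Local Notation I' := 'I_n.+1.

(* The structure constants: [d theta^k = - \sum_(i, j) c k i j theta^i /\ theta^j]
   for the coframe [theta^k = dz_k - \sum_(i, j) c k i j z_i dz_j]. *)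
Variable c : I' -> I' -> I' -> R.
Hypothesis c_l : forall k i j p q, c k i j * c i p q = 0.
Hypothesis c_r : forall k i j p q, c k i j * c j p q = 0.
Hypothesis c0 : forall i j, c 0 i j = 0.

Let Cm (i : I') : 'M[R]_d := \matrix_(k, j) c k i j.
Let B (z : 'rV[R]_d) : 'M[R]_d := \sum_i z 0 i *: Cm i.
Definition frame_coframe (z : 'rV[R]_d) : 'M[R]_d := 1%:M - B z.
Let E := frame_coframe.
Let F (z : 'rV[R]_d) : 'M[R]_d := 1%:M + B z.
(** The bracket coefficients of the dual frame: the bracket of [e_i] and [e_j] is the sum of
    [CC k i j] times [e_k]. *)
Let CC k i j : R := c k i j - c k j i.

Local Lemma CmM i j : Cm i *m Cm j = 0.
Proof.
apply/matrixP => k l; rewrite !mxE big1 // => m _; rewrite !mxE; exact: c_r.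
Qed.

Local Lemma BCm z j : B z *m Cm j = 0.
Proof. by rewrite mulmx_suml big1 // => i _; rewrite -scalemxAl CmM scaler0. Qed.

Local Lemma CmB z j : Cm j *m B z = 0.
Proof. by rewrite mulmx_sumr big1 // => i _; rewrite -scalemxAr CmM scaler0. Qed.

Local Lemma BB z : B z *m B z = 0.
Proof. by rewrite {1}/B mulmx_suml big1 // => i _; rewrite -scalemxAl CmB scaler0. Qed.

Local Lemma FCm z j : F z *m Cm j = Cm j.
Proof. by rewrite mulmxDl mul1mx BCm addr0. Qed.

Local Lemma CmF z j : Cm j *m F z = Cm j.
Proof. by rewrite mulmxDr mulmx1 CmB addr0. Qed.

Local Lemma ECm z j : E z *m Cm j = Cm j.
Proof. by rewrite mulmxBl mul1mx BCm subr0. Qed.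

Lemma frame_coframeK z : E z *m F z = 1%:M.
Proof. by rewrite mulmxDr mulmx1 mulmxBl mul1mx BB subr0 addrC subrKC ?subrK. Qed.

Local Lemma FE z : F z *m E z = 1%:M.
Proof. exact: mulmx1C (frame_coframeK z). Qed.

Local Lemma BE z k j : B z k j = \sum_i z 0 i * c k i j.
Proof. by rewrite summxE; apply: eq_bigr => i _; rewrite !mxE. Qed.

Lemma frame_coframeE z k j : E z k j = (k == j)%:R - \sum_i z 0 i * c k i j.
Proof. by rewrite !mxE BE. Qed.

Local Lemma E0 z j : E z 0 j = (0 == j)%:R.
Proof. by rewrite frame_coframeE big1 ?subr0 // => i _; rewrite c0 mulr0. Qed.

Local Lemma F0 z j : F z 0 j = (0 == j)%:R.
Proof. by rewrite !mxE BE big1 ?addr0 // => i _; rewrite c0 mulr0. Qed.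

(** The frame differs from the coordinate frame only in directions produced by brackets, and [c]
    vanishes on these. Lower indices of [c] may therefore be moved freely between the two frames. *)
Local Lemma sumEc k z i j : \sum_m E z m i * c k m j = c k i j.
Proof.
under eq_bigr => m _ do rewrite frame_coframeE mulrBl.
rewrite sumrB (bigD1 i) //= ?eqxx mul1r big1 => [|m /negPf->]; last by rewrite mul0r.
rewrite addr0 big1 ?subr0 // => m _.
rewrite mulr_suml big1 // => p _; rewrite -mulrA [c m _ _ * _]mulrC.
by rewrite c_l mulr0.
Qed.

Local Lemma sumEc_r k z i j : \sum_m E z m i * c k j m = c k j i.
Proof.
under eq_bigr => m _ do rewrite frame_coframeE mulrBl.
rewrite sumrB (bigD1 i) //= ?eqxx mul1r big1 => [|m /negPf->]; last by rewrite mul0r.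
rewrite addr0 big1 ?subr0 // => m _.
rewrite mulr_suml big1 // => p _; rewrite -mulrA [c m _ _ * _]mulrC.
by rewrite c_r mulr0.
Qed.

Local Lemma CCE p z i j : \sum_m \sum_l CC p m l * (E z m i * E z l j) = CC p i j.
Proof.
transitivity (\sum_m E z m i * (\sum_l E z l j * c p m l - \sum_l E z l j * c p l m)).
  apply: eq_bigr => m _; rewrite -sumrB mulr_sumr; apply: eq_bigr => l _.
  rewrite /CC; ring.
under eq_bigr => m _ do rewrite sumEc sumEc_r mulrBr.
by rewrite sumrB sumEc sumEc_r.
Qed.

Local Lemma mx_differentiableB z : mx_differentiable B z.
Proof.
move=> k j; under eq_fun do rewrite BE.
by apply: differentiable_big_sum => i _; exact: differentiable_coorM.
Qed.

Local Lemma mx_pdB i z : mx_pd i B z = Cm i.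
Proof.
apply/matrixP => k j; rewrite !mxE; under eq_fun do rewrite BE.
rewrite pd_sum => [|m _]; last exact: differentiable_coorM.
rewrite (bigD1 i) //= big1 => [|m /negPf mi]; rewrite pd_coorM.
  by rewrite ?eqxx mul1r addr0.
by rewrite eq_sym mi mul0r.
Qed.

Local Lemma mx_differentiableE z : mx_differentiable E z.
Proof.
apply: mx_differentiableD; first exact: mx_differentiable_cst.
by apply: mx_differentiableN; exact: mx_differentiableB.
Qed.

Local Lemma mx_differentiableF z : mx_differentiable F z.
Proof.
apply: mx_differentiableD; first exact: mx_differentiable_cst.
exact: mx_differentiableB.
Qed.

Local Lemma mx_pdE i z : mx_pd i E z = - Cm i.
Proof.
rewrite mx_pdD; [|exact: mx_differentiable_cst|]; last first.
  by apply: mx_differentiableN; exact: mx_differentiableB.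
by rewrite mx_pd_cst add0r mx_pdN ?mx_pdB //; exact: mx_differentiableB.
Qed.

Local Lemma mx_pdF i z : mx_pd i F z = Cm i.
Proof.
rewrite mx_pdD; [|exact: mx_differentiable_cst|exact: mx_differentiableB].
by rewrite mx_pd_cst add0r mx_pdB.
Qed.

(** * Levi-Civita connection, curvature and wave operator of a time-dependent frame metric *)

Section Connection.
Variables (D D' : R -> 'M[R]_d) (W W' : R -> I' -> 'M[R]_d).

Let tdiff (f : R -> 'M[R]_d) (f' : 'M[R]_d) (z : 'rV[R]_d) :=
  forall k l, is_derive (z 0 0) 1 (fun s => f s k l) (f' k l).

Local Lemma mx_differentiable_time f f' z :
  tdiff f f' z -> mx_differentiable (fun y : 'rV_d => f (y 0 0)) z.
Proof.
move=> df k l; apply: (@differentiable_fcomp _ _ (fun s => f s k l)).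
  by have [] := df k l.
exact: differentiable_coor.
Qed.

Local Lemma mx_pd_time i f f' z :
  tdiff f f' z -> mx_pd i (fun y : 'rV_d => f (y 0 0)) z = (i == 0)%:R *: f'.
Proof.
move=> df; apply/matrixP => k l; rewrite !mxE.
have [df1 df2] := df k l.
rewrite (@pd_comp _ _ (fun s => f s k l) (fun y => y 0 0)) //.
  by rewrite pd_coor derive1E df2 mulrC.
exact: differentiable_coor.
Qed.

Let met z := (E z)^T *m D (z 0 0) *m E z.
Let om i z := \sum_m E z m i *: W (z 0 0) m.
Let om' i z := \sum_m E z m i *: W' (z 0 0) m.
(** The gauge transform of the connection form [om] from the frame to coordinates; the inhomogeneous
    term is [F] times the derivative of [E], which equals [- Cm i] since [F] fixes [Cm i]. *)
Let Gam i z := - Cm i + F z *m om i z *m E z.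

Variable I : set R.
Hypothesis oI : open I.
Hypothesis D_unit : forall s, I s -> D s \in unitmx.
Hypothesis D_sym : forall s, (D s)^T = D s.
Hypothesis dD : forall z : 'rV[R]_d, I (z 0 0) -> tdiff D (D' (z 0 0)) z.
Hypothesis dW : forall (z : 'rV[R]_d) m, I (z 0 0) -> tdiff (W ^~ m) (W' (z 0 0) m) z.
(** Vanishing torsion and metric compatibility, read in the frame. As the coframe has
    [theta^0 = dz_0], functions of time have a derivative along [e_0] only, whence the factor
    [(m == 0)]. *)
Hypothesis W_tors : forall s, I s -> forall k i j, W s i k j - W s j k i = CC k i j.
Hypothesis W_compat : forall s, I s -> forall m,
  D s *m W s m + (D s *m W s m)^T = (m == 0)%:R *: D' s.

Let U : set 'rV[R]_d := [set z | I (z 0 0)].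

Lemma open_time_slab : open U.
Proof.
rewrite /U; apply: (@open_comp _ _ (fun z : 'rV[R]_d => z 0 0)) => // z _.
exact: coord_continuous.
Qed.

(** Antisymmetrizing the frame part gives [F] applied to the bracket coefficients by [W_tors]; [F]
    fixes them, and they cancel the antisymmetric part of [- Cm]. *)
Local Lemma Gam_sym z : U z -> forall i j k, Gam i z k j = Gam j z k i.
Proof.
move=> Uz i j k; apply/eqP; rewrite -subr_eq0; apply/eqP.
have GE a b : (F z *m om a z *m E z) k b =
    \sum_p F z k p * \sum_m \sum_l W (z 0 0) m p l * (E z m a * E z l b).
  rewrite -mulmxA mxE; apply: eq_bigr => p _; congr (_ * _).
  rewrite mulmx_suml summxE; apply: eq_bigr => m _.
  by rewrite -scalemxAl mxE [(W _ _ *m _) _ _]mxE mulr_sumr; apply: eq_bigr => l _;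
    rewrite mulrCA.
have -> : Gam i z k j - Gam j z k i =
    \sum_p F z k p * (\sum_m \sum_l CC p m l * (E z m i * E z l j)) -
    (c k i j - c k j i).
  have GamE a b : Gam a z k b = - c k a b + (F z *m om a z *m E z) k b.
    by rewrite /Gam mxE [(- Cm a) _ _]mxE [Cm a _ _]mxE.
  have swap (a b p q : R) : - a + p - (- b + q) = (p - q) - (a - b) by ring.
  rewrite !GamE !GE swap; congr (_ - _).
  rewrite -sumrB; apply: eq_bigr => p _; rewrite -mulrBr; congr (_ * _).
  rewrite [X in _ - X]exchange_big -sumrB; apply: eq_bigr => m _.
  rewrite -sumrB; apply: eq_bigr => l _; rewrite -(W_tors Uz).
  ring.
under eq_bigr => p _ do rewrite CCE.
rewrite -[X in _ - X]/(CC k i j).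
have -> : \sum_p F z k p * CC p i j = CC k i j.
  have e a b : \sum_p F z k p * c p a b = c k a b.
    have /(congr1 (fun A : 'M[R]_d => A k b)) := FCm z a.
    rewrite mxE [Cm a _ _]mxE => <-; apply: eq_bigr => p _.
    by rewrite [Cm a _ _]mxE.
  by rewrite /CC -(e i j) -(e j i) -sumrB; apply: eq_bigr => p _; rewrite mulrBr.
by rewrite subrr.
Qed.

Local Lemma met_compat z : U z ->
  forall i, mx_pd i met z = (Gam i z)^T *m met z + met z *m Gam i z.
Proof.
move=> Uz i.
have dE := mx_differentiableE z; have dET := mx_differentiable_tr dE.
have dDt := mx_differentiable_time (dD Uz).
have dDE := mx_differentiableM dET dDt.
rewrite /met (mx_pdM i dDE dE) (mx_pdM i dET dDt) mx_pd_tr mx_pdE (mx_pd_time i (dD Uz)).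
set M := (E z)^T *m D (z 0 0) *m E z.
have MT : M^T = M by rewrite /M !trmx_mul trmxK D_sym mulmxA.
have MG : M *m Gam i z = - ((E z)^T *m D (z 0 0) *m Cm i) +
    (E z)^T *m (D (z 0 0) *m om i z) *m E z.
  rewrite /Gam mulmxDr mulmxN /M -[_ *m E z *m Cm i]mulmxA ECm; congr (_ + _).
  by rewrite !mulmxA -[_ *m E z *m F z]mulmxA frame_coframeK mulmx1.
have -> : (Gam i z)^T *m M = (M *m Gam i z)^T by rewrite trmx_mul MT.
rewrite MG; apply: compat_algebra => //.
(* Compatibility along coordinate [i] is the [E]-weighted sum of the frame identities; only [m = 0]
   contributes, with weight [E z 0 i], a Kronecker delta. *)
rewrite -{2}[D (z 0 0)]D_sym -trmx_mul mulmx_sumr raddf_sum /= -big_split /=.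
have trZ x (a : 'M[R]_d) : (x *: a)^T = x *: a^T by exact: linearZ.
under eq_bigr => m _ do rewrite -scalemxAr trZ -scalerDr (W_compat Uz).
rewrite (bigD1 0) //= big1 => [|m /negPf->]; last by rewrite scale0r scaler0.
by rewrite ?eqxx scale1r addr0 E0 eq_sym.
Qed.

Lemma frame_christoffel z : U z ->
  forall i j k, christoffel met k i j z = Gam i z k j.
Proof.
move=> Uz; apply: christoffel_unique.
- have Eu : E z \in unitmx := (mulmx1_unit (frame_coframeK z)).1.
  by rewrite /met !unitmx_mul unitmx_tr D_unit // Eu.
- by rewrite /met !trmx_mul trmxK D_sym mulmxA.
- exact: Gam_sym.
- exact: met_compat.
Qed.

Local Lemma pd_Eom i j m k l z : U z ->
  differentiable (fun y => E y m j * W (y 0 0) m k l) z /\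
  pd i (fun y => E y m j * W (y 0 0) m k l) z =
    - c m i j * W (z 0 0) m k l + E z m j * ((i == 0)%:R * W' (z 0 0) m k l).
Proof.
move=> Uz.
have dE := mx_differentiableE z m j.
have dWt := mx_differentiable_time (dW m Uz) k l.
split; first exact: differentiableM.
have e1 : pd i (fun y => E y m j) z = - c m i j.
  by have /(congr1 (fun A : 'M[R]_d => A m j)) := mx_pdE i z; rewrite !mxE.
have e2 : pd i (fun y => W (y 0 0) m k l) z = (i == 0)%:R * W' (z 0 0) m k l.
  have /(congr1 (fun A : 'M[R]_d => A k l)) := mx_pd_time i (dW m Uz).
  by rewrite !mxE.
by rewrite pdM // e1 e2.
Qed.

Local Lemma omE j k l y : om j y k l = \sum_m E y m j * W (y 0 0) m k l.
Proof. by rewrite summxE; apply: eq_bigr => m _; rewrite mxE. Qed.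

Local Lemma mx_differentiable_om j z : U z -> mx_differentiable (om j) z.
Proof.
move=> Uz k l; under eq_fun do rewrite omE.
by apply: differentiable_big_sum => m _; have [] := pd_Eom 0 j m k l Uz.
Qed.

Local Lemma mx_pd_om i j z : U z -> mx_pd i (om j) z =
  - (\sum_p c p i j *: W (z 0 0) p) + (i == 0)%:R *: om' j z.
Proof.
move=> Uz; apply/matrixP => k l; rewrite [LHS]mxE; under eq_fun do rewrite omE.
rewrite pd_sum => [|m _]; last by have [] := pd_Eom 0 j m k l Uz.
set S := \sum_p _ *: _.
rewrite [RHS]mxE [(- S) _ _]mxE [(_ *: om' j z) _ _]mxE /S !summxE -sumrN mulr_sumr
  -big_split /=.
apply: eq_bigr => m _; have [_ ->] := pd_Eom i j m k l Uz.
by rewrite [(c m i j *: W _ m) _ _]mxE [(E z m j *: W' _ m) _ _]mxE mulNr mulrCA.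
Qed.

Local Lemma mx_pd_Gam i j z : U z -> mx_pd i (Gam j) z =
  Cm i *m om j z *m E z +
  F z *m (- (\sum_p c p i j *: W (z 0 0) p) + (i == 0)%:R *: om' j z) *m E z -
  F z *m om j z *m Cm i.
Proof.
move=> Uz.
have dE := mx_differentiableE z; have dF := mx_differentiableF z.
have dom := mx_differentiable_om j Uz.
have dFom := mx_differentiableM dF dom.
rewrite mx_pdD; [|exact: mx_differentiable_cst|exact: mx_differentiableM].
rewrite mx_pd_cst add0r (mx_pdM i dFom dE) (mx_pdM i dF dom) mx_pdE mx_pdF mx_pd_om //.
by rewrite mulmxN mulmxDl.
Qed.

Local Lemma GamM i j z : Gam i z *m Gam j z =
  F z *m (om i z *m om j z) *m E z - Cm i *m om j z *m E z - F z *m om i z *m Cm j.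
Proof.
by apply: connection_mul_algebra; rewrite ?CmM ?CmF ?ECm ?frame_coframeK.
Qed.

(** The curvature endomorphism of [e_b], [e_a] in a frame whose fields do not commute: the [CC] sum
    is the covariant derivative along their bracket. *)
Let K s b a : 'M[R]_d := - (\sum_p CC p b a *: W s p)
  + (b == 0)%:R *: W' s a - (a == 0)%:R *: W' s b
  + (W s b *m W s a - W s a *m W s b).

Definition frame_ricci_mx s : 'M[R]_d := \matrix_(a, m) \sum_b K s b a b m.

(** Tensoriality of curvature: the two form indices are converted by [E], the endomorphism by
    conjugation. The equalities [e1] to [e5] convert the terms of [K] one at a time. *)
Local Lemma curvatureE i j z : U z ->
  mx_pd i (Gam j) z - mx_pd j (Gam i) z +
    (Gam i z *m Gam j z - Gam j z *m Gam i z) =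
  F z *m (\sum_b \sum_a (E z b i * E z a j) *: K (z 0 0) b a) *m E z.
Proof.
move=> Uz.
have -> : \sum_b \sum_a (E z b i * E z a j) *: K (z 0 0) b a =
    - (\sum_p c p i j *: W (z 0 0) p) + (i == 0)%:R *: om' j z
    - (- (\sum_p c p j i *: W (z 0 0) p) + (j == 0)%:R *: om' i z)
    + (om i z *m om j z - om j z *m om i z).
  have e1 : \sum_b \sum_a (E z b i * E z a j) *: \sum_p CC p b a *: W (z 0 0) p =
      \sum_p c p i j *: W (z 0 0) p - \sum_p c p j i *: W (z 0 0) p.
    rewrite -sumrB; under [RHS]eq_bigr => p _.
      rewrite -scalerBl -[_ - _]/(CC p i j) -(CCE p z) scaler_suml.
      under eq_bigr => b _ do rewrite scaler_suml; over.
    rewrite [RHS]exchange_big /=; apply: eq_bigr => b _.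
    rewrite [RHS]exchange_big /=; apply: eq_bigr => a _.
    rewrite scaler_sumr; apply: eq_bigr => p _.
    by rewrite scalerA [_ * CC _ _ _]mulrC.
  have E0s k : \sum_b E z b k * (b == 0)%:R = (k == 0)%:R.
    rewrite (bigD1 0) //= ?eqxx mulr1 big1 => [|b /negPf->]; last by rewrite mulr0.
    by rewrite addr0 E0 eq_sym.
  have e2 : \sum_b \sum_a (E z b i * E z a j) *: ((b == 0)%:R *: W' (z 0 0) a) =
      (i == 0)%:R *: om' j z.
    rewrite -E0s scaler_suml; apply: eq_bigr => b _.
    rewrite scaler_sumr; apply: eq_bigr => a _; rewrite !scalerA.
    by congr (_ *: _); ring.
  have e3 : \sum_b \sum_a (E z b i * E z a j) *: ((a == 0)%:R *: W' (z 0 0) b) =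
      (j == 0)%:R *: om' i z.
    rewrite exchange_big -E0s scaler_suml; apply: eq_bigr => b _.
    rewrite scaler_sumr; apply: eq_bigr => a _; rewrite !scalerA.
    by congr (_ *: _); ring.
  have e4 : \sum_b \sum_a (E z b i * E z a j) *: (W (z 0 0) b *m W (z 0 0) a) =
      om i z *m om j z.
    rewrite mulmx_suml; apply: eq_bigr => b _.
    rewrite mulmx_sumr; apply: eq_bigr => a _.
    by rewrite -scalemxAl -scalemxAr scalerA.
  have e5 : \sum_b \sum_a (E z b i * E z a j) *: (W (z 0 0) a *m W (z 0 0) b) =
      om j z *m om i z.
    rewrite exchange_big mulmx_suml; apply: eq_bigr => b _.
    rewrite mulmx_sumr; apply: eq_bigr => a _.
    by rewrite -scalemxAl -scalemxAr scalerA; congr (_ *: _); exact: mulrC.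
  have swap (a b p q : 'M[R]_d) : - a + p - (- b + q) = - (a - b) + p - q.
    by rewrite opprD opprK opprB addrACA [- a + b]addrC addrA.
  rewrite swap -e1 -e2 -e3 -e4 -e5.
  rewrite -sumrN -big_split -!sumrB -big_split /=; apply: eq_bigr => b _.
  rewrite -sumrN -big_split -!sumrB -big_split /=; apply: eq_bigr => a _.
  by rewrite /K !scalerDr !scalerN !addrA.
by rewrite !mx_pd_Gam // !GamM curvature_algebra.
Qed.

Lemma frame_ricci z : U z ->
  ricci met z = (E z)^T *m frame_ricci_mx (z 0 0) *m E z.
Proof.
move=> Uz; apply/matrixP => j k.
rewrite (ricci_mx open_time_slab Uz frame_christoffel).
under eq_bigr => i _ do rewrite curvatureE //.
transitivity (\sum_a E z a j * \sum_b (K (z 0 0) b a *m E z) b k).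
  (* Along the contracted index an [E] meets an [F] and their product is the identity, so only the
     two free indices retain a frame factor. *)
  transitivity (\sum_i \sum_b \sum_a E z a j * (E z b i * (F z *m (K (z 0 0) b a *m E z))
    i k)).
    apply: eq_bigr => i _; rewrite mulmx_sumr mulmx_suml summxE.
    apply: eq_bigr => b _; rewrite mulmx_sumr mulmx_suml summxE.
    apply: eq_bigr => a _.
    by rewrite -scalemxAr -scalemxAl mxE -mulmxA -mulrA mulrCA.
  rewrite exchange_big /=.
  transitivity (\sum_b \sum_a E z a j * (K (z 0 0) b a *m E z) b k).
    apply: eq_bigr => b _; rewrite exchange_big /=; apply: eq_bigr => a _.
    rewrite -mulr_sumr; congr (_ * _).
    have := frame_coframeK z => /(congr1 (fun A => (A *m (K (z 0 0) b a *m E z)) b k)).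
    by rewrite mul1mx -mulmxA => <-; rewrite mxE.
  by rewrite exchange_big; apply: eq_bigr => a _; rewrite mulr_sumr.
rewrite -mulmxA mxE; apply: eq_bigr => a _; rewrite [(E z)^T _ _]mxE; congr (_ * _).
rewrite mxE; under eq_bigr => b _ do rewrite mxE.
rewrite exchange_big; apply: eq_bigr => m _.
by rewrite [frame_ricci_mx _ _ _]mxE mulr_suml.
Qed.

(** The differential of [phi] is a multiple of [theta^0], so only the [theta^0] component of the
    traced connection acts on it. *)
Lemma frame_box (phi : R -> R) z : U z ->
  (forall s, I s -> derivable phi s 1) ->
  (forall s, I s -> derivable (derive1 phi) s 1) ->
  box met (fun y => phi (y 0 0)) z =
  invmx (D (z 0 0)) 0 0 * derive1n 2 phi (z 0 0) -
  (\sum_m \sum_l invmx (D (z 0 0)) m l * W (z 0 0) m 0 l) * derive1 phi (z 0 0).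
Proof.
move=> Uz dp ddp.
set G := invmx (met z).
have pd1 j y : U y ->
    pd j (fun y : 'rV_d => phi (y 0 0)) y = derive1 phi (y 0 0) * (j == 0)%:R.
  move=> Uy; rewrite (@pd_comp _ _ phi (fun y => y 0 0)); first by rewrite pd_coor.
    exact: dp.
  exact: differentiable_coor.
have pd2 i j : pd i (pd j (fun y : 'rV_d => phi (y 0 0))) z =
    derive1n 2 phi (z 0 0) * ((i == 0)%:R * (j == 0)%:R).
  rewrite (eq_pd (U := U) (g := fun y => derive1 phi (y 0 0) * (j == 0)%:R)) //;
    last 2 first.
  - exact: open_time_slab.
  - by move=> y; rewrite inE => Uy; exact: pd1.
  have dd : differentiable (fun y : 'rV[R]_d => derive1 phi (y 0 0)) z.
    by apply: differentiable_fcomp; [exact: ddp|exact: differentiable_coor].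
  rewrite (pdM i dd (differentiable_cst _ _)).
  rewrite pd_cst mulr0 addr0 (@pd_comp _ _ (derive1 phi) (fun y => y 0 0)).
  - by rewrite pd_coor mulrA.
  - exact: ddp.
  - exact: differentiable_coor.
have -> : box met (fun y => phi (y 0 0)) z = \sum_i \sum_j G i j *
    (derive1n 2 phi (z 0 0) * ((i == 0)%:R * (j == 0)%:R)
     - Gam i z 0 j * derive1 phi (z 0 0)).
  apply: eq_bigr => i _; apply: eq_bigr => j _; congr (_ * _).
  rewrite pd2; congr (_ - _).
  rewrite (bigD1 0) //= big1 ?addr0 => [|m /negPf m0]; last by rewrite pd1 // m0 !mulr0.
  by rewrite pd1 // ?eqxx mulr1 frame_christoffel.
transitivity (derive1n 2 phi (z 0 0) *
      (\sum_i \sum_j G i j * ((i == 0)%:R * (j == 0)%:R)) -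
    (\sum_i \sum_j G i j * Gam i z 0 j) * derive1 phi (z 0 0)).
  rewrite mulr_sumr mulr_suml -sumrB; apply: eq_bigr => i _.
  rewrite mulr_sumr mulr_suml -sumrB; apply: eq_bigr => j _.
  by rewrite mulrBr; congr (_ - _); [exact: mulrCA|exact: mulrA].
have Du := D_unit Uz.
(* The inverse metric is the inverse frame metric carried to coordinates by the dual frame; its 00
   entry is unchanged because row 0 of [F] is trivial. *)
have GE : G = F z *m invmx (D (z 0 0)) *m (F z)^T.
  have H : met z *m (F z *m invmx (D (z 0 0)) *m (F z)^T) = 1%:M.
    rewrite /met !mulmxA -[_ *m E z *m F z]mulmxA frame_coframeK mulmx1.
    by rewrite -[_ *m D _ *m _]mulmxA mulmxV // mulmx1 -trmx_mul FE trmx1.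
  by rewrite /G -[LHS]mulmx1 -H mulKmx //; exact: (mulmx1_unit H).1.
congr (_ - _ * _).
  rewrite mulrC; congr (_ * _).
  rewrite (bigD1 0) //= [X in _ + X]big1 ?addr0 => [|i /negPf->]; last first.
    by rewrite big1 // => j _; rewrite mul0r mulr0.
  rewrite (bigD1 0) //= [X in _ + X]big1 ?addr0 => [|i /negPf->]; last first.
    by rewrite !mulr0.
  rewrite ?eqxx mulr1 mulr1 GE -mulmxA mxE.
  rewrite (bigD1 0) //= [X in _ + X]big1 ?addr0 => [|i /negPf i0]; last first.
    by rewrite F0 eq_sym i0 mul0r.
  rewrite F0 ?eqxx mul1r mxE.
  rewrite (bigD1 0) //= [X in _ + X]big1 ?addr0 => [|i /negPf i0]; last first.
    by rewrite mxE F0 eq_sym i0 mulr0.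
  by rewrite mxE F0 ?eqxx mulr1.
have Gam0 i j : Gam i z 0 j = \sum_m \sum_l W (z 0 0) m 0 l * (E z m i * E z l j).
  rewrite /Gam mxE [(- Cm i) _ _]mxE [Cm i _ _]mxE c0 oppr0 add0r -mulmxA mxE.
  rewrite (bigD1 0) //= [X in _ + X]big1 ?addr0 => [|p /negPf p0]; last first.
    by rewrite F0 eq_sym p0 mul0r.
  rewrite F0 ?eqxx mul1r mulmx_suml summxE; apply: eq_bigr => m _.
  rewrite -scalemxAl mxE [(W _ _ *m _) _ _]mxE mulr_sumr.
  by apply: eq_bigr => l _; rewrite mulrCA.
have GEE m l : \sum_i \sum_j G i j * (E z m i * E z l j) = invmx (D (z 0 0)) m l.
  transitivity ((E z *m G *m (E z)^T) m l).
    rewrite -mulmxA mxE; apply: eq_bigr => i _; rewrite [(G *m _) _ _]mxE mulr_sumr.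
    by apply: eq_bigr => j _; rewrite [(E z)^T _ _]mxE; ring.
  rewrite GE !mulmxA frame_coframeK mul1mx -mulmxA -trmx_mul frame_coframeK trmx1.
  by rewrite mulmx1.
transitivity (\sum_i \sum_j \sum_m \sum_l W (z 0 0) m 0 l * (G i j * (E z m i * E z l j))).
  apply: eq_bigr => i _; apply: eq_bigr => j _; rewrite Gam0 mulr_sumr.
  by apply: eq_bigr => m _; rewrite mulr_sumr; apply: eq_bigr => l _; rewrite mulrCA.
under eq_bigr => i _ do rewrite exchange_big /=.
rewrite exchange_big /=; apply: eq_bigr => m _.
under eq_bigr => i _ do rewrite exchange_big /=.
rewrite exchange_big /=; apply: eq_bigr => l _.
under eq_bigr => i _ do rewrite -mulr_sumr.
by rewrite -mulr_sumr GEE mulrC.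
Qed.

End Connection.

End Frame.

(** * The Ricci tensor of a diagonal metric *)

Section DiagonalMetric.
Context {R : realType} {n : nat}.
Local Notation d := n.+1.
Local Notation I' := 'I_n.+1.

Variable c : I' -> I' -> I' -> R.
Hypothesis c_l : forall k i j p q, c k i j * c i p q = 0.
Hypothesis c_r : forall k i j p q, c k i j * c j p q = 0.
Hypothesis c0 : forall i j, c 0 i j = 0.
Hypothesis c_0l : forall k j, c k 0 j = 0.
Hypothesis c_0r : forall k i, c k i 0 = 0.
Let C k i j : R := c k i j - c k j i.

(** Prescribing [eta' = 2 h eta] gives the logarithmic derivatives of scale factors and lapse
    without square roots, and treats the negative time coefficient like the spatial ones. *)
Variables (I : set R) (eta h h' : I' -> R -> R).
Hypothesis oI : open I.
Hypothesis eta_neq0 : forall k s, I s -> eta k s != 0.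
Hypothesis eta_der : forall k s, I s -> is_derive s 1 (eta k) (2 * h k s * eta k s).
Hypothesis h_der : forall k s, I s -> is_derive s 1 (h k) (h' k s).

Definition diag_frame_metric (z : 'rV[R]_d) : 'M[R]_d :=
  (frame_coframe c z)^T *m diag_mx (\row_k eta k (z 0 0)) *m frame_coframe c z.

(* [w s k i j] is the [theta^k]-component of [nabla_(e_i) e_j], by Koszul. *)
Let w s (k i j : I') : R :=
  (i == 0)%:R * (j == k)%:R * h k s + (j == 0)%:R * (i == k)%:R * h k s
  - (k == 0)%:R * (i == j)%:R * (h i s * eta i s / eta 0 s)
  + 2^-1 * (C k i j - eta i s / eta k s * C i j k - eta j s / eta k s * C j i k).
Let w' s k i j : R := derive1 (fun r => w r k i j) s.
Let D s : 'M[R]_d := diag_mx (\row_k eta k s).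
Let D' s : 'M[R]_d := diag_mx (\row_k (2 * h k s * eta k s)).
Let W s i : 'M[R]_d := \matrix_(k, j) w s k i j.
Let W' s i : 'M[R]_d := \matrix_(k, j) w' s k i j.

Local Lemma CN k i j : C k j i = - C k i j.
Proof. by rewrite /C opprB. Qed.

Local Lemma C_l k i j p q : C k i j * C i p q = 0.
Proof. by rewrite /C !mulrBl !mulrBr !c_l !c_r !subr0. Qed.

Local Lemma C_r k i j p q : C k i j * C j p q = 0.
Proof. by rewrite CN mulNr C_l oppr0. Qed.

Local Lemma C0 i j : C 0 i j = 0. Proof. by rewrite /C !c0 subr0. Qed.
Local Lemma C0l k j : C k 0 j = 0. Proof. by rewrite /C c_0l c_0r subr0. Qed.
Local Lemma C0r k i : C k i 0 = 0. Proof. by rewrite CN C0l oppr0. Qed.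

(** Two-step nilpotency makes the square of this single entry vanish. *)
Local Lemma Ckk k j : C k k j = 0.
Proof. by apply/eqP; rewrite -[_ == 0]orbb -mulf_eq0 C_l. Qed.

Local Lemma Ckk_r k j : C k j k = 0. Proof. by rewrite CN Ckk oppr0. Qed.

Local Lemma Cjj k j : C k j j = 0. Proof. by rewrite /C subrr. Qed.

Local Lemma D_unit s : I s -> D s \in unitmx.
Proof.
move=> Is; rewrite unitmxE det_diag unitfE; apply/prodf_neq0 => k _.
by rewrite mxE; exact: eta_neq0.
Qed.

Local Lemma D_sym s : (D s)^T = D s. Proof. exact: tr_diag_mx. Qed.

Local Lemma D_der s k l : I s -> is_derive s 1 (fun r => D r k l) (D' s k l).
Proof.
move=> Is; case: (eqVneq k l) => [<-|kl].
  rewrite (_ : (fun r => D r k k) = eta k); last first.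
    by apply/funext => r; rewrite !mxE eqxx mulr1n.
  by rewrite !mxE eqxx mulr1n; exact: eta_der.
rewrite (_ : (fun r => D r k l) = cst 0); last first.
  by apply/funext => r; rewrite !mxE (negPf kl).
by rewrite !mxE (negPf kl); exact: is_derive_cst.
Qed.

Local Lemma eta_derivable k s : I s -> derivable (eta k) s 1.
Proof. by move=> /(eta_der k) []. Qed.

Local Lemma h_derivable k s : I s -> derivable (h k) s 1.
Proof. by move=> /(h_der k) []. Qed.

Local Lemma w_der s k i j : I s -> is_derive s 1 (fun r => w r k i j) (w' s k i j).
Proof.
move=> Is; apply: DeriveDef; last by rewrite /w' derive1E.
have dc (a : R) : derivable (cst a) s 1 by exact: derivable_cst.
have dh a : derivable (h a) s 1 by exact: h_derivable.
have de a : derivable (eta a) s 1 by exact: eta_derivable.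
have dq a b : derivable (fun r => eta a r / eta b r) s 1.
  by apply: derivableM => //; apply: derivableV => //; exact: eta_neq0.
apply: derivableD; last first.
  apply: derivableM; first exact: dc.
  by apply: derivableB; [apply: derivableB; [exact: dc|]|];
    apply: derivableM => //; exact: dc.
apply: derivableB; last first.
  apply: derivableM; first exact: dc.
  apply: derivableM; first exact: derivableM.
  by apply: derivableV => //; exact: eta_neq0.
by apply: derivableD; apply: derivableM => //; exact: dc.
Qed.

Local Lemma w_tors s : I s -> forall k i j, W s i k j - W s j k i = C k i j.
Proof.
move=> Is k i j; rewrite !mxE /w (CN k j i) (eq_sym j i).
case: (eqVneq i j) => [->|ij]; rewrite /= ?mulr1 ?mulr0 ?mul0r ?Cjj; field;
  rewrite ?eta_neq0 //.
Qed.

(** After lowering the upper index with [eta], the bracket terms and the two mixed [h] terms are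
    antisymmetric. Only the first [h] term survives symmetrization, and it doubles to the derivative
    of [eta]. *)
Local Lemma w_compat s : I s ->
  forall m, D s *m W s m + (D s *m W s m)^T = (m == 0)%:R *: D' s.
Proof.
move=> Is m; apply/matrixP => k j.
have DW a b : (D s *m W s m) a b = eta a s * w s a m b.
  by rewrite mul_diag_mx !mxE.
rewrite mxE [(_^T) _ _]mxE !DW [RHS]mxE [D' _ _ _]mxE [(\row__ _) _ _]mxE.
have e0 a b : eta a s * ((a == 0)%:R * (m == b)%:R * (h m s * eta m s / eta 0 s)) =
    (a == 0)%:R * (m == b)%:R * (h b s * eta b s).
  case: eqVneq => [->|]; last by rewrite !mul0r mulr0.
  case: eqVneq => [->|]; last by rewrite !mulr0 !mul0r mulr0.
  by rewrite !mul1r mulrC divfK // eta_neq0.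
have etw a b : eta a s * w s a m b =
    (m == 0)%:R * (b == a)%:R * (h a s * eta a s)
    + (b == 0)%:R * (m == a)%:R * (h a s * eta a s)
    - (a == 0)%:R * (m == b)%:R * (h b s * eta b s)
    + 2^-1 * (eta a s * C a m b - eta m s * C m b a - eta b s * C b m a).
  rewrite /w mulrDr mulrBr e0; congr (_ - _ + _); first by ring.
  by field; rewrite ?eta_neq0 //.
rewrite !etw (CN m k j).
by case: (eqVneq k j) => [->|kj]; rewrite ?mulr1n ?mulr0n; ring.
Qed.

Local Lemma frame_D_der (z : 'rV[R]_d) :
  I (z 0 0) -> forall k l, is_derive (z 0 0) 1 (fun r => D r k l) (D' (z 0 0) k l).
Proof. by move=> Iz k l; exact: D_der. Qed.

Local Lemma frame_W_der (z : 'rV[R]_d) m : I (z 0 0) ->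
  forall k l, is_derive (z 0 0) 1 (fun r => W r m k l) (W' (z 0 0) m k l).
Proof.
move=> Iz k l; rewrite [W' _ _ _ _]mxE.
rewrite (_ : (fun r => _) = fun r => w r k m l); first exact: w_der.
by apply/funext => r; rewrite mxE.
Qed.

Definition diag_ricci_mx s : 'M[R]_d := frame_ricci_mx c W W' s.

Lemma diag_ricci (z : 'rV[R]_d) : I (z 0 0) -> ricci diag_frame_metric z =
  (frame_coframe c z)^T *m diag_ricci_mx (z 0 0) *m frame_coframe c z.
Proof.
move=> Iz.
exact: (frame_ricci c_l c_r c0 oI D_unit D_sym frame_D_der frame_W_der w_tors w_compat Iz).
Qed.

(** * Evaluation of the Ricci components for the Koszul connection *)

Local Lemma W_mul s a b m : (W s b *m W s a) b m = \sum_l w s b b l * w s l a m.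
Proof. by rewrite mxE; apply: eq_bigr => l _; rewrite !mxE. Qed.

Local Lemma diag_ricci_sum s a m : diag_ricci_mx s a m =
  - (\sum_b \sum_p C p b a * w s b p m) + w' s 0 a m
  - (a == 0)%:R * (\sum_b w' s b b m)
  + \sum_l (\sum_b w s b b l) * w s l a m - \sum_b \sum_l w s b a l * w s l b m.
Proof.
rewrite [LHS]mxE.
transitivity (\sum_b (- (\sum_p C p b a * w s b p m) + (b == 0)%:R * w' s b a m
    - (a == 0)%:R * w' s b b m
    + (\sum_l w s b b l * w s l a m - \sum_l w s b a l * w s l b m))).
  have mN (A : 'M[R]_d) p q : (- A) p q = - A p q by rewrite mxE.
  have mD (A B : 'M[R]_d) p q : (A + B) p q = A p q + B p q by rewrite mxE.
  have mZ r (A : 'M[R]_d) p q : (r *: A) p q = r * A p q by rewrite mxE.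
  have mW a' p q : W s a' p q = w s p a' q by rewrite mxE.
  have mW' a' p q : W' s a' p q = w' s p a' q by rewrite mxE.
  apply: eq_bigr => b _; rewrite !mD !mN !mZ W_mul summxE !mW'.
  congr (- _ + _ - _ + (_ - _)).
    by apply: eq_bigr => p _; rewrite mZ mW.
  by rewrite mxE; apply: eq_bigr => p _; rewrite !mW.
rewrite big_split /= sumrB big_split /= sumrN sumrB -mulr_sumr.
rewrite addrA; congr (_ + _ - _ + _ - _).
  rewrite (bigD1 0) //= big1 => [|b /negPf->]; last by rewrite mul0r.
  by rewrite mul1r addr0.
by rewrite exchange_big; apply: eq_bigr => l _; rewrite mulr_suml.
Qed.

(** Summed over [b] this is the divergence of [e_l]. The bracket terms vanish for each [b]
    separately, a strong form of unimodularity. *)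
Local Lemma w_trace s b l : I s -> w s b b l = (l == 0)%:R * h b s.
Proof.
move=> Is; rewrite /w Ckk Ckk_r Cjj !mulr0 !subr0 mulr0 addr0 eqxx mulr1.
case: (eqVneq b 0) => [->|_]; rewrite ?mulr1 ?mul1r ?mul0r ?subr0 ?add0r //.
rewrite mulfK; last exact: eta_neq0.
by rewrite [l == 0]eq_sym; ring.
Qed.

Local Lemma derive1_eq f g s (df : R) : {in I, f =1 g} -> I s ->
  is_derive s 1 g df -> derive1 f s = df.
Proof.
move=> fg Is dg; rewrite derive1E.
have /near_eq_is_derive/(_ dg)[] // : \near s, g s = f s.
by apply: filterS (open_nbhs_nbhs (conj oI Is)) => y Iy; rewrite fg ?inE.
Qed.

Local Lemma w'_trace s b l : I s -> w' s b b l = (l == 0)%:R * h' b s.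
Proof.
move=> Is; apply: (derive1_eq (g := fun r => (l == 0)%:R * h b r)) => // [r|].
  by rewrite inE => Ir; exact: w_trace.
by have := is_deriveZ (l == 0)%:R (h_der b Is).
Qed.

Local Lemma w0 s a m : I s -> w s 0 a m =
  (a == m)%:R * ((a == 0)%:R * (2 * h 0 s) - h a s * eta a s / eta 0 s).
Proof.
move=> Is; rewrite /w C0 C0r C0r !mulr0 !subr0 mulr0 addr0 eqxx mul1r.
case: (eqVneq a m) => [<-|am].
  by case: (a == 0); rewrite /=; ring.
case: (eqVneq a 0) => [a0|_]; last by rewrite /= mulr0; ring.
by rewrite a0 eq_sym in am; rewrite (negPf am) /=; ring.
Qed.

Local Lemma w'0 s a m : I s -> w' s 0 a m =
  (a == m)%:R * ((a == 0)%:R * (2 * h' 0 s)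
  - eta a s / eta 0 s * (h' a s + 2 * h a s ^+ 2 - 2 * h a s * h 0 s)).
Proof.
move=> Is.
pose g r := (a == m)%:R * ((a == 0)%:R * (2 * h 0 r) - h a r * eta a r / eta 0 r).
have E : {in I, (fun r => w r 0 a m) =1 g} by move=> r; rewrite inE => Ir; exact: w0.
apply: (derive1_eq E Is).
have e0 := eta_neq0 0 Is.
have dV := is_deriveV e0 (eta_der 0 Is).
have dp := is_deriveM (is_deriveM (h_der a Is) (eta_der a Is)) dV.
have dq := is_deriveZ (a == 0)%:R (is_deriveZ 2 (h_der 0 Is)).
have := is_deriveZ (a == m)%:R (is_deriveB dq dp).
move/is_derive_eq; apply.
rewrite /GRing.scale /= -[(h a * eta a) s]/(h a s * eta a s); congr (_ * _).
by field; exact: eta_neq0.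
Qed.

Local Lemma w_0l s k j : I s -> w s k 0 j = (j == k)%:R * h k s.
Proof.
move=> Is; rewrite /w C0 C0l C0l !mulr0 !subr0 mulr0 addr0 mul1r.
case: (eqVneq k 0) => [->|k0]; last by rewrite /= mulr0 !mul0r addr0 subr0.
rewrite mulfK; last exact: eta_neq0.
by rewrite [0 == j]eq_sym; case: (j == 0); rewrite /=; ring.
Qed.

Local Lemma w_0r s k i : I s -> i != 0 -> w s k i 0 = (i == k)%:R * h k s.
Proof.
move=> Is i0; rewrite /w C0 C0l C0r !mulr0 !subr0 mulr0 addr0 (negPf i0) eqxx.
by rewrite /=; ring.
Qed.

(** The bracket part of [w]: the Levi-Civita coefficients of the left-invariant metric on one time
    slice. *)
Let q s k i j : R :=
  2^-1 * (C k i j - eta i s / eta k s * C i j k - eta j s / eta k s * C j i k).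

Local Lemma q0 s i j : q s 0 i j = 0.
Proof. by rewrite /q C0 !C0r !mulr0 !subr0 mulr0. Qed.

Local Lemma q0l s k j : q s k 0 j = 0.
Proof. by rewrite /q C0 !C0l !mulr0 !subr0 mulr0. Qed.

Local Lemma q0r s k i : q s k i 0 = 0.
Proof. by rewrite /q C0 C0l C0r !mulr0 !subr0 mulr0. Qed.

Local Lemma sum_delta (f : I' -> R) a : \sum_b (b == a)%:R * f b = f a.
Proof.
rewrite (bigD1 a) //= big1 => [|b /negPf->]; last by rewrite mul0r.
by rewrite eqxx mul1r addr0.
Qed.

Local Lemma sum_qq s a m : I s -> \sum_b \sum_l q s b a l * q s l b m =
  - (4^-1 * \sum_b \sum_l eta a s * eta m s / (eta b s * eta l s) * (C a b l * C m b l)).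
Proof.
move=> Is.
(* [G] pairs [q s b a l] with the part of [q s l b m] that is symmetric in [b] and [l] after
   lowering. It is antisymmetric in [b] and [l], so it sums to zero, and subtracting it makes the
   identity hold summand by summand up to the products [z1], [z2]. *)
pose G b l := (eta b s * C b a l - eta l s * C l a b + eta a s * C a b l)
  * (eta l s * C l b m + eta b s * C b l m) / (4 * (eta b s * eta l s)).
have G0 : \sum_b \sum_l G b l = 0.
  apply/eqP; rewrite -[_ == 0](mulrn_eq0 _ 2) mulr2n.
  rewrite {1}exchange_big -big_split big1 //= => b _; rewrite -big_split big1 //= => l _.
  by rewrite /G (CN a l b) [eta l s * eta b s]mulrC; ring.
transitivity (\sum_b \sum_l (q s b a l * q s l b m - G b l)).
  by under [RHS]eq_bigr => b _ do rewrite sumrB; rewrite sumrB G0 subr0.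
rewrite mulr_sumr -sumrN; apply: eq_bigr => b _.
rewrite mulr_sumr -sumrN; apply: eq_bigr => l _.
have z1 : C m b l * C b a l = 0 by exact: C_l.
have z2 : C m b l * C l a b = 0 by exact: C_r.
have eb : eta b s != 0 by exact: eta_neq0.
have el : eta l s != 0 by exact: eta_neq0.
rewrite /q /G (CN a b l) (CN b l m).
transitivity (- (4^-1 * (eta a s * eta m s / (eta b s * eta l s) * (C a b l * C m b l)))
  - (eta m s / eta l s / 4) * (C m b l * C b a l)
  + (eta m s / eta b s / 4) * (C m b l * C l a b)); last first.
  by rewrite z1 z2 !mulr0 addr0 subr0.
field.
by rewrite el eb.
Qed.

Local Lemma ricci_term_C s a m b p : I s -> C p b a * w s b p m =
  2^-1 * (eta p s / eta b s * (C p a b * C p m b)).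
Proof.
move=> Is; rewrite /w.
(* Each [h] term forces an upper or lower time index, or two equal indices, on [C p b a], which then
   vanishes. *)
have S0 : C p b a * ((p == 0)%:R * (m == b)%:R * h b s + (m == 0)%:R * (p == b)%:R * h b s
   - (b == 0)%:R * (p == m)%:R * (h p s * eta p s / eta 0 s)) = 0.
  case: (eqVneq p 0) => [->|_]; first by rewrite C0 mul0r.
  case: (eqVneq b 0) => [->|_]; first by rewrite C0l mul0r.
  case: (eqVneq p b) => [->|_]; first by rewrite Ckk mul0r.
  by rewrite /=; ring.
rewrite mulrDr S0 add0r.
have z1 : C p b a * C b p m = 0.
  by rewrite (CN p a b) mulNr C_r oppr0.
have z2 : C m p b * C p b a = 0 by exact: C_l.
transitivity (2^-1 * (C p b a * C b p m) - 2^-1 * (eta p s / eta b s) * (C p b a * C p m b)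
  - 2^-1 * (eta m s / eta b s) * (C m p b * C p b a)); first by ring.
by rewrite z1 z2 (CN p a b); ring.
Qed.

Local Lemma ricci_sum_C s a m : I s -> \sum_b \sum_p C p b a * w s b p m =
  2^-1 * \sum_b \sum_p eta p s / eta b s * (C p a b * C p m b).
Proof.
move=> Is; rewrite mulr_sumr; apply: eq_bigr => b _; rewrite mulr_sumr.
by apply: eq_bigr => p _; rewrite ricci_term_C.
Qed.

Local Lemma ricci_sum_trace s a m : I s ->
  \sum_l (\sum_b w s b b l) * w s l a m = (\sum_b h b s) * w s 0 a m.
Proof.
move=> Is; rewrite -(sum_delta (fun l => (\sum_b h b s) * w s l a m) 0).
apply: eq_bigr => l _; rewrite mulrA mulr_sumr; congr (_ * _).
by apply: eq_bigr => b _; exact: w_trace.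
Qed.

Local Lemma ricci_sum_trace' s m : I s ->
  \sum_b w' s b b m = (m == 0)%:R * \sum_b h' b s.
Proof.
by move=> Is; rewrite mulr_sumr; apply: eq_bigr => b _; exact: w'_trace.
Qed.

(** The sums include the time index; its contributions cancel and leave the Raychaudhuri form, minus
    the spatial sum of [h_b' + h_b^2 - h_0 h_b]. *)
Lemma diag_ricci_00 s : I s -> diag_ricci_mx s 0 0 =
  h' 0 s - \sum_b h' b s + (\sum_b h b s) * h 0 s - \sum_b h b s ^+ 2.
Proof.
move=> Is; rewrite diag_ricci_sum ricci_sum_C // ricci_sum_trace // ricci_sum_trace' //.
rewrite big1 => [|b _]; last first.
  by rewrite big1 // => p _; rewrite C0l mul0r mulr0.
rewrite w'0 // w0 // !eqxx mulr0 oppr0 add0r !mul1r.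
have -> : \sum_b \sum_l w s b 0 l * w s l b 0 = \sum_b h b s ^+ 2.
  apply: eq_bigr => b _.
  rewrite -(sum_delta (fun l => h b s ^+ 2) b).
  apply: eq_bigr => l _; rewrite w_0l //.
  case: (eqVneq l b) => [->|_]; last by rewrite !mul0r.
  by rewrite w_trace // ?eqxx /=; ring.
by field; exact: eta_neq0.
Qed.

(** The momentum constraint holds identically: [w s b 0 l] is diagonal, which leaves traces with a
    spatial index, and these vanish by [w_trace]. *)
Lemma diag_ricci_0r s m : I s -> m != 0 -> diag_ricci_mx s 0 m = 0.
Proof.
move=> Is m0; rewrite diag_ricci_sum ricci_sum_C // ricci_sum_trace // ricci_sum_trace' //.
rewrite big1 => [|b _]; last first.
  by rewrite big1 // => p _; rewrite C0l mul0r mulr0.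
rewrite w'0 // w0 // [0 == m]eq_sym (negPf m0) !mul0r !mulr0 !oppr0 ?add0r ?addr0 ?add0r.
rewrite big1 ?oppr0 // => b _; rewrite big1 // => l _.
rewrite w_0l //; case: (eqVneq l b) => [->|_]; last by rewrite !mul0r.
by rewrite w_trace // (negPf m0) mul0r mulr0.
Qed.

Lemma diag_ricci_r0 s a : I s -> a != 0 -> diag_ricci_mx s a 0 = 0.
Proof.
move=> Is a0; rewrite diag_ricci_sum ricci_sum_C // ricci_sum_trace // ricci_sum_trace' //.
rewrite big1 => [|b _]; last first.
  by rewrite big1 // => p _; rewrite C0l mulr0 mulr0.
rewrite w'0 // w0 // (negPf a0) !mul0r !mulr0 !oppr0 ?add0r ?addr0 ?add0r.
rewrite big1 ?oppr0 // => b _; rewrite big1 // => l _.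
have [->|b0] := eqVneq b 0.
  rewrite w_0l // w0 // !(eq_sym 0); case: (eqVneq l 0) => [->|l0];
    last by rewrite mul0r mulr0.
  by rewrite (negPf a0) !mul0r.
rewrite w_0r //; case: (eqVneq b l) => [<-|_]; last by rewrite mul0r mulr0.
rewrite /w (negPf a0) (negPf b0) Ckk_r Cjj.
by rewrite /=; ring.
Qed.

(** The first line comes from the evolution of the slices, the last two are the Ricci tensor of a
    left-invariant metric on a two-step nilpotent group. *)
Lemma diag_ricci_spatial s a m : I s -> a != 0 -> m != 0 -> diag_ricci_mx s a m =
  - ((a == m)%:R * (eta a s / eta 0 s *
       (h' a s + ((\sum_b h b s) - 2 * h 0 s) * h a s)))
  - 2^-1 * (\sum_b \sum_p eta p s / eta b s * (C p a b * C p m b))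
  + 4^-1 * \sum_b \sum_l eta a s * eta m s / (eta b s * eta l s) * (C a b l * C m b l).
Proof.
move=> Is a0 m0.
rewrite diag_ricci_sum ricci_sum_C // ricci_sum_trace // (negPf a0) mul0r subr0.
rewrite w'0 // w0 // (negPf a0) !mul0r !sub0r.
(* Quadratic terms with [b] or [l] equal to 0 give the extrinsic part, counted twice by symmetry;
   the others involve only [q]. *)
have -> : \sum_b \sum_l w s b a l * w s l b m =
    - (2 * ((a == m)%:R * (h a s ^+ 2 * eta a s / eta 0 s)))
    + \sum_b \sum_l q s b a l * q s l b m.
  set k := (a == m)%:R * _.
  transitivity (\sum_b \sum_l ((b == a)%:R * ((l == 0)%:R * (- k))
      + (b == 0)%:R * ((l == a)%:R * (- k)) + q s b a l * q s l b m)).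
    apply: eq_bigr => b _; apply: eq_bigr => l _.
    rewrite [w s b a l]/w [w s l b m]/w -/(q s b a l) -/(q s l b m) (negPf a0) (negPf m0)
      /k.
    have [->|l0] := eqVneq l 0; have [->|b0] := eqVneq b 0;
      rewrite ?q0 ?q0l ?q0r ?(eq_sym 0) ?(negPf a0) ?(negPf m0) /=.
    - ring.
    - have [->|ab] := eqVneq b a; rewrite /=; last by ring.
      by have [->|am] := eqVneq a m; rewrite /=; ring.
    - have [->|ab] := eqVneq l a; rewrite /=; last by ring.
      by have [->|am] := eqVneq a m; rewrite /=; ring.
    - ring.
  under eq_bigr => b _.
    rewrite !big_split /= -!mulr_sumr !sum_delta; over.
  by rewrite !big_split /= !sum_delta mulr2n; ring.
rewrite sum_qq //.
set S1 := \sum_b \sum_p _; set S2 := \sum_b \sum_l _; set H := \sum_b _.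
case: (a == m); rewrite /=; last by ring.
by field; exact: eta_neq0.
Qed.

Lemma diag_box (phi : R -> R) (z : 'rV[R]_d) : I (z 0 0) ->
  (forall s, I s -> derivable phi s 1) ->
  (forall s, I s -> derivable (derive1 phi) s 1) ->
  box diag_frame_metric (fun y => phi (y 0 0)) z =
  (derive1n 2 phi (z 0 0) - (2 * h 0 (z 0 0) - \sum_b h b (z 0 0)) * derive1 phi (z 0 0))
  / eta 0 (z 0 0).
Proof.
move=> Iz dp ddp.
rewrite (frame_box c_l c_r c0 oI D_unit D_sym frame_D_der w_tors w_compat Iz dp ddp).
set s := z 0 0.
have e0 k : eta k s != 0 by exact: eta_neq0.
have invD m l : invmx (D s) m l = (l == m)%:R * (eta m s)^-1.
  have H : D s *m diag_mx (\row_k (eta k s)^-1) = 1%:M.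
    apply/matrixP => i j; rewrite mul_diag_mx !mxE.
    by case: eqP => [->|_]; rewrite ?mulr1n ?mulr0n ?mulr0 // mulfV.
  have -> : invmx (D s) = diag_mx (\row_k (eta k s)^-1).
    by rewrite -[LHS]mulmx1 -H mulKmx // D_unit.
  by rewrite !mxE eq_sym; case: (l == m); rewrite ?mulr1n ?mulr0n ?mul1r ?mul0r.
have -> : \sum_m \sum_l invmx (D s) m l * W s m 0 l = (2 * h 0 s - \sum_b h b s) / eta 0 s.
  transitivity (\sum_m ((m == 0)%:R * (2 * h 0 s / eta 0 s) - h m s / eta 0 s)).
    apply: eq_bigr => m _.
    rewrite -(sum_delta (fun=> (m == 0)%:R * (2 * h 0 s / eta 0 s) - h m s / eta 0 s) m).
    apply: eq_bigr => l _; rewrite invD mxE w0 //.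
    case: (eqVneq l m) => _; last by rewrite !mul0r.
    case: (eqVneq m 0) => [->|_]; rewrite /=; by field; rewrite ?e0.
  by rewrite sumrB sum_delta -mulr_suml mulrBl.
by rewrite invD eqxx mul1r; ring.
Qed.

End DiagonalMetric.

(** * Homogeneous spacetimes and their quotients *)

Lemma eq_christoffel (R : realType) (d : nat) (U : set 'rV[R]_d)
    (g g' : 'rV[R]_d -> 'M[R]_d) x : open U -> U x -> {in U, g =1 g'} ->
  forall k i j, christoffel g k i j x = christoffel g' k i j x.
Proof.
move=> oU Ux gg' k i j; rewrite /christoffel gg' ?inE //.
have pdg a b l : pd l (fun y => g y a b) x = pd l (fun y => g' y a b) x.
  by apply: (eq_pd l oU Ux) => y Uy; rewrite gg'.
by congr (_ * _); apply: eq_bigr => l _; rewrite !pdg.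
Qed.

Lemma eq_ricci (R : realType) (d : nat) (U : set 'rV[R]_d)
    (g g' : 'rV[R]_d -> 'M[R]_d) x : open U -> U x -> {in U, g =1 g'} ->
  ricci g x = ricci g' x.
Proof.
move=> oU Ux gg'; have ch y : y \in U -> forall k i j,
    christoffel g k i j y = christoffel g' k i j y.
  by rewrite inE => Uy; exact: eq_christoffel Uy gg'.
have xU : x \in U by rewrite inE.
apply/matrixP => j k; rewrite mxE [RHS]mxE.
have e1 : \sum_i pd i (christoffel g i j k) x = \sum_i pd i (christoffel g' i j k) x.
  by apply: eq_bigr => i _; exact: (eq_pd i oU Ux (fun y Uy => ch y Uy i j k)).
have e2 : \sum_i pd j (christoffel g i i k) x = \sum_i pd j (christoffel g' i i k) x.
  by apply: eq_bigr => i _; exact: (eq_pd j oU Ux (fun y Uy => ch y Uy i i k)).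
apply: (f_equal2 (fun p q => p + q) (f_equal2 (fun p q => p - q) e1 e2)).
apply: eq_bigr => i _; apply: eq_bigr => l _.
by rewrite (ch x xU i i l) (ch x xU l j k) (ch x xU i j l) (ch x xU l i k).
Qed.

Lemma eq_box (R : realType) (d : nat) (U : set 'rV[R]_d)
    (g g' : 'rV[R]_d -> 'M[R]_d) (f f' : 'rV[R]_d -> R) x :
  open U -> U x -> {in U, g =1 g'} -> {in U, f =1 f'} ->
  box g f x = box g' f' x.
Proof.
move=> oU Ux gg' ff'; rewrite /box gg' ?inE //.
have pdf i y : y \in U -> pd i f y = pd i f' y.
  by rewrite inE => Uy; exact: eq_pd Uy ff'.
apply: eq_bigr => i _; apply: eq_bigr => j _.
have -> : pd i (pd j f) x = pd i (pd j f') x.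
  exact: (eq_pd i oU Ux (fun y Uy => pdf j y Uy)).
have -> : \sum_k christoffel g k i j x * pd k f x =
          \sum_k christoffel g' k i j x * pd k f' x.
  by apply: eq_bigr => k _; rewrite pdf ?inE // (eq_christoffel oU Ux gg').
by [].
Qed.

(** Used for chart changes of the slab: they are the identity on the image only, since [loc] takes
    the default value 0 elsewhere. *)
Lemma jacobian_near_id (R : realType) (d : nat) (U : set 'rV[R]_d)
    (u : 'rV[R]_d -> 'rV[R]_d) x :
  open U -> U x -> {in U, u =1 id} -> 'J u x = 1%:M.
Proof.
move=> oU Ux uid; apply/matrixP => i j.
have ej : {in U, (fun y : 'rV[R]_d => y 0 j) =1 (fun y => u y 0 j)}.
  by move=> y Uy; rewrite uid.
rewrite jacobianE; last first.
  apply: differentiable_row => k.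
  have ek : {in U, (fun y : 'rV[R]_d => y 0 k) =1 (fun y => u y 0 k)}.
    by move=> y Uy; rewrite uid.
  exact: (eq_differentiable oU Ux ek (differentiable_coor k x)).
by rewrite -(eq_pd i oU Ux ej) pd_coor mxE.
Qed.

Section Homogeneous.
Context {R : realType} {n : nat}.
Variable brk : bracket.
Local Notation d := n.+1.

Definition two_step := forall k i j p q,
  brk k i j -> ~~ brk i p q && ~~ brk j p q.

(* Coordinate 0 is the time, so that spatial indices are shifted by one. *)
Definition structure_constant (k i j : nat) : R :=
  if (k, i, j) is (k'.+1, i'.+1, j'.+1) then (brk k' i' j')%:R else 0.

Definition metric_coef (N : R -> R) (a : nat -> R -> R) (k : nat) (t : R) : R :=
  if k is i.+1 then a i t ^+ 2 else - N t ^+ 2.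

Let c (k i j : 'I_d) : R := structure_constant k i j.

Hypothesis brk2 : two_step.

Lemma structure_constant_l (k i j p q : 'I_d) : c k i j * c i p q = 0.
Proof.
rewrite /c; case: k i j p q => [[|k] ?] [[|i] ?] [[|j] ?] [[|p] ?] [[|q] ?] /=;
  rewrite ?mulr0 ?mul0r //.
rewrite -natrM mulnb; case: andP => // -[kij ipq].
by have := brk2 p q kij; rewrite ipq.
Qed.

Lemma structure_constant_r (k i j p q : 'I_d) : c k i j * c j p q = 0.
Proof.
rewrite /c; case: k i j p q => [[|k] ?] [[|i] ?] [[|j] ?] [[|p] ?] [[|q] ?] /=;
  rewrite ?mulr0 ?mul0r //.
rewrite -natrM mulnb; case: andP => // -[kij jpq].
by have := brk2 p q kij; rewrite jpq andbF.
Qed.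

Lemma structure_constant_0 (i j : 'I_d) : c 0 i j = 0. Proof. by []. Qed.

Lemma structure_constant_0l (k j : 'I_d) : c k 0 j = 0.
Proof. by rewrite /c; case: k => [[|k] ?]. Qed.

Lemma structure_constant_0r (k i : 'I_d) : c k i 0 = 0.
Proof. by rewrite /c; case: k i => [[|k] ?] [[|i] ?]. Qed.

Variables (N : R -> R) (a : nat -> R -> R) (phi : R -> R) (I : set R).
Hypothesis oI : open I.

Let eta (k : 'I_d) : R -> R := metric_coef N a k.
Let Hom := homogeneous brk n I N a phi.
Let U : set 'rV[R]_d := [set z | I (z 0 0)].

Lemma diagonal_metricE (z : 'rV[R]_d) :
  diagonal_metric brk N a z = diag_frame_metric c eta z.
Proof.
have oE : (ord0 : 'I_d) = lshift n (ord0 : 'I_1) by exact: val_inj.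
have EE : frame_coframe c z = block_mx 1%:M 0 0 (coframe brk (space_of z)) :> 'M[R]_(1 + n).
  apply/matrixP => k j; rewrite frame_coframeE.
  case: (split_ordP k) => k' ->; case: (split_ordP j) => j' ->.
  - rewrite block_mxEul mxE !ord1 eqxx big1 ?subr0 // => i _.
    by rewrite -oE structure_constant_0 mulr0.
  - rewrite block_mxEur mxE !ord1 big1 ?subr0 // => i _.
    by rewrite -oE structure_constant_0 mulr0.
  - rewrite block_mxEdl mxE !ord1 big1 ?subr0 // => i _.
    by rewrite -oE structure_constant_0r mulr0.
  - rewrite block_mxEdr mxE big_ord_recl [c _ _ _]structure_constant_0l mulr0 add0r.
    congr (_ - _).
    rewrite [RHS]big_mkcond /=; apply: eq_bigr => i _.
    rewrite [space_of z 0 i]mxE (_ : rshift 1 i = lift ord0 i); last exact: val_inj.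
    by rewrite /c /structure_constant lift0 /= !add0n; case: (brk _ _ _);
      rewrite ?mulr1 ?mulr0.
have DE : diag_mx (\row_k eta k (z 0 0)) =
    block_mx (- (N (time_of z)) ^+ 2)%:M 0 0
      (diag_mx (\row_(i < n) (a i (time_of z)) ^+ 2)) :> 'M[R]_(1 + n).
  apply/matrixP => k j.
  case: (split_ordP k) => k' ->; case: (split_ordP j) => j' ->.
  - by rewrite block_mxEul !mxE !ord1 eqxx.
  - rewrite block_mxEur [LHS]mxE [RHS]mxE !ord1.
    by have -> : (lshift n (0 : 'I_1) == rshift 1 j' :> 'I_d) = false by [].
  - rewrite block_mxEdl [LHS]mxE [RHS]mxE !ord1.
    by have -> : (rshift 1 k' == lshift n (0 : 'I_1) :> 'I_d) = false by [].
  - rewrite block_mxEdr !mxE.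
    by have -> : (rshift 1 k' == rshift 1 j' :> 'I_d) = (k' == j') by [].
have key (A B : 'M[R]_n) (x : R) : (block_mx (1%:M : 'M[R]_1) 0 0 A)^T
    *m block_mx (x%:M : 'M[R]_1) 0 0 B *m block_mx (1%:M : 'M[R]_1) 0 0 A =
    block_mx x%:M 0 0 (A^T *m B *m A).
  rewrite tr_block_mx !mulmx_block !trmx0 !trmx1.
  by rewrite !mul0mx !mulmx0 !mul1mx !mulmx1 !addr0 !add0r mul0mx.
by rewrite /diag_frame_metric EE DE; exact/esym/key.
Qed.

Local Lemma insubE (z : 'rV[R]_d) (Iz : I (time_of z)) :
  ichart (tt : ix (@slab R n I)) z = Some (exist _ z (asboolT Iz)).
Proof.
by rewrite /= (insubT (fun z : 'rV[R]_d => `[< I (time_of z) >]) (asboolT Iz)).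
Qed.

Lemma slab_image (b : ix (@slab R n I)) : Defs.image b = U.
Proof.
case: b; apply/seteqP; split=> z.
  by move=> [p zp _]; move: zp => /=; case: insubP => // u /asboolP.
by move=> Iz; exists (exist _ z (asboolT Iz)) => //; exact: insubE.
Qed.

Local Lemma slab_in_chart_dom (b b' : ix (@slab R n I)) : in_chart b (dom b') = U.
Proof.
rewrite -(slab_image b); apply/seteqP; split=> z [p zp pb]; exists p => //.
by case: b' => /=; rewrite /dom /= valK.
Qed.

Local Lemma slab_ichart (b : ix (@slab R n I)) z p : ichart b z = Some p -> val p = z.
Proof. by case: b => /=; case: insubP => // u _ <- [<-]. Qed.

Local Lemma slab_loc (W : zmodType) (f : 'rV[R]_d -> W) (b : ix (@slab R n I)) z :
  U z -> loc b (fun p : @slab R n I => f (val p)) z = f z.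
Proof. by move=> Iz; case: b; rewrite /loc insubE. Qed.

Local Lemma open_U : open U. Proof. exact: open_time_slab. Qed.

Lemma slab_manifold : manifold (@slab R n I).
Proof.
split.
- split=> [p|b x p]; last by case: b => /slab_ichart.
  by exists tt; rewrite /dom /= valK.
- by move=> b b'; rewrite slab_in_chart_dom; exact: open_U.
- move=> b b' i; rewrite slab_in_chart_dom.
  apply: (smooth_eq open_U (f := fun z : 'rV[R]_d => z 0 i));
    last exact: smooth_coor open_U i.
  by move=> z; rewrite inE => Uz; rewrite (slab_loc id).
- move=> p q pq.
  have vpq : val p != val q by apply/eqP => /val_inj.
  have hd : hausdorff_space 'rV[R]_d by exact: norm_hausdorff.
  move: hd; rewrite open_hausdorff => /(_ _ _ vpq) [[A B] /= [pA qB] [oA oB /eqP AB]].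
  have opn V : open V -> mopen [set r : @slab R n I | V (val r)].
    move=> oV b; rewrite (_ : in_chart _ _ = V `&` U); first exact: openI oV open_U.
    apply/seteqP; split=> z.
      move=> [r zr Vr]; have rz := slab_ichart zr; split; first by rewrite -rz.
      by rewrite -(slab_image b); exists r.
    by move=> [Vz]; rewrite -(slab_image b) => -[r zr _]; exists r;
      rewrite //= (slab_ichart zr).
  exists [set r | A (val r)], [set r | B (val r)]; split.
  - exact: opn.
  - exact: opn.
  - by rewrite inE in pA.
  - by rewrite inE in qB.
  - apply/seteqP; split=> // r [/= Ar Br].
    by have : (A `&` B) (val r) by []; rewrite AB.
- exists [set: ix (@slab R n I)]; first exact: countableP.
  by move=> p; exists tt => //; rewrite /dom /= valK.
Qed.

Hypothesis N_neq0 : forall t, I t -> N t != 0.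
Hypothesis a_neq0 : forall i t, (i < n)%N -> I t -> a i t != 0.
Hypothesis eta_smooth : forall k : 'I_d,
  Ck_on None U (fun z => eta k (z 0 0)).

Local Lemma eta_neq0 (k : 'I_d) t : I t -> eta k t != 0.
Proof.
move=> It; rewrite /eta /metric_coef; case: k => [[|k] kn] /=.
  by rewrite oppr_eq0 expf_neq0 // N_neq0.
by rewrite expf_neq0 // a_neq0.
Qed.

Local Lemma slab_jacobian (b b' : ix (@slab R n I)) x :
  U x -> 'J (loc b (chart b')) x = 1%:M.
Proof.
move=> Ux; apply: jacobian_near_id open_U Ux _ => y.
by rewrite inE => Uy; case: b'; rewrite (slab_loc id).
Qed.

Lemma homogeneous_spacetime : spacetime_axioms Hom.
Proof.
have mE b x : st_metric Hom b x = diag_frame_metric c eta x by exact: diagonal_metricE.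
have F00 z : (diag_frame_metric c eta z) 0 0 = - N (z 0 0) ^+ 2.
  rewrite -diagonal_metricE /diagonal_metric -[z 0 0]/(time_of z).
  have -> : (0 : 'I_d) = lshift n (ord0 : 'I_1) by exact: val_inj.
  by apply: etrans (block_mxEul _ _ _ _ _ _) _; rewrite mxE eqxx.
split.
- exact: slab_manifold.
- split; first split.
  + move=> b i j; rewrite slab_image.
    rewrite (_ : (fun x => _) = fun x => \sum_k
       (\sum_l frame_coframe c x l i * (eta l (x 0 0) *+ (l == k))) * frame_coframe c x k
         j).
      apply: (smooth_sum open_U) => k _; apply: (smoothM open_U).
        apply: (smooth_sum open_U) => l _; apply: (smoothM open_U).
          under eq_fun do rewrite frame_coframeE.
          apply: (smoothD open_U); first exact: (smooth_cst open_U).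
          apply: (smoothN open_U); apply: (smooth_sum open_U) => p _.
          by apply: (smoothM open_U);
            [exact: (smooth_coor open_U)|exact: (smooth_cst open_U)].
        by case: (l == k) => /=; [exact: eta_smooth|exact: (smooth_cst open_U)].
      under eq_fun do rewrite frame_coframeE.
      apply: (smoothD open_U); first exact: (smooth_cst open_U).
      apply: (smoothN open_U); apply: (smooth_sum open_U) => p _.
      by apply: (smoothM open_U); [exact: (smooth_coor open_U)|exact: (smooth_cst open_U)].
    apply/funext => x; rewrite mE mxE; apply: eq_bigr => k _; rewrite mxE; congr (_ * _).
    by apply: eq_bigr => l _;
      rewrite [(_^T) _ _]mxE [(diag_mx _) _ _]mxE [(\row__ _) _ _]mxE.
  + by move=> b x _; rewrite mE /diag_frame_metric !trmx_mul trmxK tr_diag_mx mulmxA.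
  + move=> b b' x; rewrite slab_in_chart_dom => Ux.
    rewrite /pullback_mx slab_jacobian // mul1mx trmx1 mulmx1 !mE.
    by case: b'; rewrite (slab_loc id).
- move=> b x; rewrite slab_image => Ux.
  have It : I (x 0 0) by [].
  (* [F^T] undoes the coframe and leaves the diagonal matrix of [eta]; rescaling by the inverse
     lapse and inverse scale factors then gives the Minkowski matrix. *)
  pose r : 'rV[R]_d := \row_k (if (k : nat) is i.+1 then (a i (x 0 0))^-1 else (N (x 0
    0))^-1).
  have EF := frame_coframeK structure_constant_r x.
  set F := (_ + _) in EF.
  exists (diag_mx r *m F^T).
    rewrite unitmx_mul unitmx_tr (mulmx1_unit EF).2 andbT.
    rewrite unitmxE det_diag unitfE; apply/prodf_neq0 => k _; rewrite mxE.
    case: k => [[|k] kn] /=; rewrite invr_eq0; [exact: N_neq0|exact: a_neq0].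
  rewrite trmx_mul trmxK tr_diag_mx mE /diag_frame_metric.
  rewrite !mulmxA -[_ *m frame_coframe _ _ *m F]mulmxA EF mulmx1.
  rewrite -[_ *m F^T *m _]mulmxA -trmx_mul EF trmx1 mulmx1.
  apply/matrixP => i j; rewrite !mul_diag_mx mul_mx_diag !mxE.
  case: (eqVneq i j) => [<-|_]; last by rewrite !mulr0n mulr0 mul0r.
  rewrite !mulr1n /eta /metric_coef; case: i => [[|i] ii] /=.
    by have := N_neq0 It; move: (N _) => v v0; field.
  by have := a_neq0 (ii : (i < n)%N) It; move: (a _ _) => v v0; field.
- by move=> b i; rewrite slab_image; exact: (smooth_cst open_U).
- move=> b x; rewrite slab_image => Ux.
  have It : I (x 0 0) by [].
  rewrite /pairing mE.
  rewrite -rowE trmx_delta -colE mxE mxE.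
  rewrite F00 oppr_lt0 exprn_even_gt0 //=; exact: N_neq0.
- move=> b b' x; rewrite slab_in_chart_dom => Ux.
  by rewrite slab_jacobian // mulmx1.
Qed.

Variables h h' : 'I_d -> R -> R.
Hypothesis eta_der : forall k t, I t -> is_derive t 1 (eta k) (2 * h k t * eta k t).
Hypothesis h_der : forall k t, I t -> is_derive t 1 (h k) (h' k t).
Hypothesis phi_smooth : smooth_on I phi.

(** The field equations stripped of the frame: the matrix of [d phi] squared has only its 00 entry,
    and the wave equation is multiplied by [eta 0]. *)
Definition reduced_equations :=
  forall t, I t ->
    (forall k m : 'I_d, diag_ricci_mx c eta h t k m =
       (k == 0)%:R * (m == 0)%:R * derive1 phi t ^+ 2) /\
    derive1n 2 phi t = (2 * h 0 t - \sum_k h k t) * derive1 phi t.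

Local Lemma phi_loc (b : ix Hom) : {in U, loc b (dev_field Hom) =1 (fun z => phi (z 0 0))}.
Proof.
by move=> z; rewrite inE => Uz; exact: (slab_loc (fun z : 'rV[R]_d => phi (z 0 0))).
Qed.

Local Lemma pd_phi (b : ix Hom) i z : U z ->
  pd i (loc b (dev_field Hom)) z = derive1 phi (z 0 0) * (i == 0)%:R.
Proof.
move=> Uz; rewrite (eq_pd i open_U Uz (phi_loc b)) (@pd_comp _ _ phi (fun z => z 0 0)).
- by rewrite pd_coor.
- exact: (phi_smooth (j := 0%N)).
- exact: differentiable_coor.
Qed.

Local Lemma metric_funE : diagonal_metric brk N a = diag_frame_metric c eta.
Proof. by apply/funext => z; exact: diagonal_metricE. Qed.

Local Lemma ricci_Hom z : U z -> ricci (diagonal_metric brk N a) z =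
  (frame_coframe c z)^T *m diag_ricci_mx c eta h (z 0 0) *m frame_coframe c z.
Proof.
move=> Uz; rewrite metric_funE.
exact: (diag_ricci structure_constant_l structure_constant_r structure_constant_0
  oI eta_neq0 eta_der h_der Uz).
Qed.

Local Lemma box_Hom (b : ix Hom) z : U z ->
  box (diagonal_metric brk N a) (loc b (dev_field Hom)) z =
  (derive1n 2 phi (z 0 0) - (2 * h 0 (z 0 0) - \sum_k h k (z 0 0)) * derive1 phi (z 0 0))
  / eta 0 (z 0 0).
Proof.
move=> Uz; rewrite metric_funE.
rewrite (@eq_box _ _ U _ (diag_frame_metric c eta) _ (fun z => phi (z 0 0)) z open_U Uz) //.
  apply: (diag_box structure_constant_l structure_constant_r structure_constant_0
    structure_constant_0l structure_constant_0r oI eta_neq0 eta_der Uz).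
  - exact: (phi_smooth (j := 0%N)).
  - exact: (phi_smooth (j := 1%N)).
exact: phi_loc.
Qed.

Lemma homogeneous_einstein :
  reduced_equations -> einstein_scalar (st_metric Hom) (dev_field Hom).
Proof.
move=> eqs; split.
- move=> b; rewrite slab_image.
  apply: (smooth_eq open_U (f := fun z => phi (z 0 0))).
    by move=> z Uz; rewrite phi_loc.
  by apply: (smooth_comp open_U phi_smooth) => //; exact: (smooth_coor open_U).
- move=> b x; rewrite slab_image => Ux; rewrite ricci_Hom //.
  have [Rc _] := eqs _ Ux.
  apply/matrixP => i j; rewrite [RHS]mxE !pd_phi //.
  (* Row 0 of the coframe is trivial, so conjugating a matrix supported at 00 does not change it. *)
  have E0 l : frame_coframe c x 0 l = (l == 0)%:R.
    rewrite frame_coframeE big1 ?subr0 1?eq_sym // => m _.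
    by rewrite structure_constant_0 mulr0.
  rewrite mxE (bigD1 0) //= big1 ?addr0 => [|m m0].
    rewrite E0 [X in X * _]mxE (bigD1 0) //= big1 ?addr0 => [|m m0].
      by rewrite [(_^T) _ _]mxE E0 Rc !eqxx /=; ring.
    by rewrite Rc (negPf m0) !mul0r mulr0.
  rewrite [X in X * _]mxE big1 ?mul0r // => l _.
  by rewrite Rc (negPf m0) mulr0 mul0r mulr0.
- move=> b x; rewrite slab_image => Ux; rewrite box_Hom //.
  by have [_ ->] := eqs _ Ux; rewrite subrr mul0r.
Qed.

(** At spatial coordinates 0, the neutral element of the group, the coframe is the identity matrix,
    and the coordinate equations are already the reduced ones. *)
Lemma einstein_homogeneous :
  einstein_scalar (st_metric Hom) (dev_field Hom) -> reduced_equations.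
Proof.
move=> [_ Rc bx] t It.
pose z : 'rV[R]_d := t *: delta_mx 0 0.
have z00 : z 0 0 = t by rewrite !mxE eqxx mulr1.
have Uz : U z by rewrite /U /= z00.
have Iz : Defs.image (tt : ix Hom) z by rewrite slab_image.
have E1 : frame_coframe c z = 1%:M.
  apply/matrixP => k j; rewrite frame_coframeE [RHS]mxE big1 ?subr0 // => i _.
  rewrite !mxE /=; case: (eqVneq i 0) => [->|_].
    by rewrite structure_constant_0l mulr0.
  by rewrite mulr0 mul0r.
split=> [k m|].
  have := Rc tt z Iz; rewrite ricci_Hom // E1 trmx1 mul1mx mulmx1 z00.
  move=> /(congr1 (fun A : 'M[R]_d => A k m)) ->.
  by rewrite mxE !pd_phi // z00; ring.
have := bx tt z Iz; rewrite box_Hom // z00 => /eqP.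
rewrite mulf_eq0 invr_eq0 (negPf (eta_neq0 _ It)) orbF subr_eq0 => /eqP.
by [].
Qed.

End Homogeneous.

(** Charts of the quotient are local sections of the projection, so on their open images metric and
    field have the slab expressions. The equations are local and transfer chart by chart. *)
Lemma quotient_scalar_development (R : realType) (n : nat) (brk : bracket)
    (I : set R) (N : R -> R) (a : nat -> R -> R) (phi : R -> R) (D : development R n R) :
  scalar_development (homogeneous brk n I N a phi) ->
  development_or_quotient brk I N a phi D -> scalar_development D.
Proof.
set H := homogeneous _ _ _ _ _ _ => -[spH einH].
case=> [-> //|[Gam [_ spD [pr [_ _ chE metE fE]]]]]; split=> //.
have mD : manifold D by case: spD.
have oim b : open (Defs.image (b : ix D)) by exact: open_image.
have sub b : Defs.image (b : ix D) `<=` Defs.image (tt : ix H).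
  move=> x [y xy _]; have [p px _] := chE b x y xy.
  by exists p => //; rewrite /= -px valK.
have locE b : {in Defs.image (b : ix D), loc b (dev_field D) =1 loc (tt : ix H)
  (dev_field H)}.
  move=> x; rewrite inE => -[y xy _]; have [p px py] := chE b x y xy.
  by rewrite /loc xy /= -py fE -px valK.
have mE b : {in Defs.image (b : ix D), st_metric D b =1 diagonal_metric brk N a}.
  by move=> x; rewrite inE => bx; have [] := metE b x bx.
have [sm ric bx] := einH; split.
- move=> b; apply: (smooth_eq (oim b) (f := loc (tt : ix H) (dev_field H))).
    by move=> x xb; rewrite locE.
  exact: sub_smooth (sub b) (sm tt).
- move=> b x xb; rewrite (eq_ricci (oim b) xb (mE b)).
  rewrite (ric tt x (sub b x xb)); apply/matrixP => i j; rewrite !mxE.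
  by rewrite !(eq_pd _ (oim b) xb (locE b)).
- move=> b x xb; rewrite (eq_box (oim b) xb (mE b) (locE b)).
  exact: bx tt x (sub b x xb).
Qed.

(** [compose_field] keeps [dev_st] definitionally, so the three global comparisons reduce to
    reflexivity. *)
Lemma scalar_gives_sigma (R : realType) (n e : nat) (T : atlas R e) (G : tensor2 T)
    (gamma : R -> T) (D : development R n R) :
  geodesic G setT gamma -> unit_speed G gamma ->
  scalar_development D -> gives_sigma_development G gamma D.
Proof.
move=> hgeo hunit [spD einD]; split.
- split; first exact: spD.
  have [mD _ _ _ _] := spD.
  exact: (geodesic_einstein_sigma mD hgeo hunit einD).
- by split=> // K; split.
- by move=> k; split.
- by split=> // J c; split.
Qed.

(** * Products with Euclidean space *)

Lemma sum_ord_widen (V : nmodType) (n m : nat) (F : nat -> V) :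
  (m <= n)%N -> (forall k, (m <= k)%N -> F k = 0) -> \sum_(k < n) F k = \sum_(k < m) F k.
Proof.
move=> mn F0; rewrite -(big_mkord xpredT F) -(big_mkord xpredT F).
rewrite (big_cat_nat (leq0n m) mn) /= [X in _ + X](_ : _ = 0) ?addr0 //.
rewrite big_nat_cond big1 // => k /andP[/andP[mk _] _]; exact: F0.
Qed.

Lemma two_step_heis3_heis3 : two_step heis3_heis3.
Proof.
by move=> k i j p q; rewrite /heis3_heis3 !inE => /orP[] /eqP[_ -> ->].
Qed.

Lemma open_upto (R : realType) (b : \bar R) : open (upto b).
Proof.
rewrite (_ : upto b = [set t | 0 < t] `&` [set t | (t%:E < b)%E]) //.
apply: openI; first exact: open_gt.
case: b => [r| |].
- rewrite (_ : [set t | _] = [set t | t < r]); first exact: open_lt.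
  by apply/seteqP; split=> t /=; rewrite lte_fin.
- rewrite (_ : [set t | _] = setT); first exact: openT.
  by apply/seteqP; split=> t //= _; exact: ltry.
- rewrite (_ : [set t | _] = set0); first exact: open0.
  by apply/seteqP; split=> t.
Qed.

Section EuclideanFactors.
Context {R : realType}.
Variables (b : \bar R) (a : nat -> R -> R) (phi : R -> R).
Hypothesis sol : diagonal_solution b a phi.

Local Notation I := (upto b).
Local Notation aE := (euclidean_factors a).
Local Notation coef := (metric_coef (fun=> 1) aE).
Local Notation sc := (@structure_constant R heis3_heis3).

Let h (k : nat) : R -> R :=
  if k is i.+1 then (if (i < 6)%N then fun t => derive1 (a i) t / a i t else cst 0)
  else cst 0.
Let h' k : R -> R := derive1 (h k).

Local Lemma a_smooth i : (i < 6)%N -> smooth_on I (a i).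
Proof. by case: sol => + _ _ _; exact. Qed.

Local Lemma a_gt0 i t : (i < 6)%N -> I t -> 0 < a i t.
Proof. by case: sol => _ + _ _; move=> H i6 It; exact: H. Qed.

Local Lemma aE_neq0 n i t : (i < n)%N -> I t -> aE i t != 0.
Proof.
move=> _ It; rewrite /euclidean_factors; case: ifP => [i6|_]; last exact: oner_neq0.
exact: lt0r_neq0 (a_gt0 i6 It).
Qed.

Local Lemma phi_sm : smooth_on I phi.
Proof. by case: sol. Qed.

Local Lemma euclidean_coef_smooth n (k : 'I_n.+1) :
  Ck_on None [set z : 'rV[R]_n.+1 | I (z 0 0)] (fun z => coef k (z 0 0)).
Proof.
have oU := open_time_slab (n := n) (@open_upto R b).
rewrite /metric_coef; case: (k : nat) => [|i]; first exact: (smooth_cst oU).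
rewrite /euclidean_factors; case: ifP => [i6|_]; last exact: (smooth_cst oU).
apply: (smoothX oU); apply: (smooth_comp oU (a_smooth i6)) => //.
exact: (smooth_coor oU).
Qed.

Local Lemma euclidean_coef_der n (k : 'I_n.+1) t :
  I t -> is_derive t 1 (coef k) (2 * h k t * coef k t).
Proof.
move=> It; rewrite /metric_coef /h /euclidean_factors.
case: (k : nat) => [|i]; last case: ifP => [i6|_].
- by apply: is_derive_eq; rewrite mulr0 mul0r.
- have da : is_derive t 1 (a i) (derive1 (a i) t).
    by rewrite derive1E; apply: DeriveDef => //; exact: (a_smooth i6 (j := 0%N)).
  have := is_deriveX 2 da; rewrite (_ : a i ^+ 2 = fun s => a i s ^+ 2) //.
  move/is_derive_eq; apply; rewrite /GRing.scale /=.
  have : a i t != 0 by exact: lt0r_neq0 (a_gt0 i6 It).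
  by move: (a i t) => x x0; field.
- by apply: is_derive_eq; rewrite mulr0 mul0r.
Qed.

Local Lemma euclidean_h_der n (k : 'I_n.+1) t : I t -> is_derive t 1 (h k) (h' k t).
Proof.
move=> It; apply: DeriveDef; last by rewrite /h' derive1E.
rewrite /h; case: (k : nat) => [|i]; last case: ifP => [i6|_].
- exact: derivable_cst.
- apply: derivableM; first exact: (a_smooth i6 (j := 1%N)).
  apply: derivableV; first exact: lt0r_neq0 (a_gt0 i6 It).
  exact: (a_smooth i6 (j := 0%N)).
- exact: derivable_cst.
Qed.

(** The bound 7 counts the time index together with the six group directions. *)
Local Lemma h_0 k : (7 <= k)%N -> h k = cst 0.
Proof. by case: k => // i; rewrite ltnS /h => i6; rewrite ltnNge i6. Qed.

Local Lemma h'_0 k t : (7 <= k)%N -> h' k t = 0.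
Proof. by move=> k7; rewrite /h' h_0 // derive1_cst. Qed.

Local Lemma sc_0 k i j : (7 <= maxn k (maxn i j))%N -> sc k i j = 0.
Proof.
case: k i j => [|k] [|i] [|j] //; rewrite /structure_constant /heis3_heis3 !inE.
by case: (boolP (_ || _)) => // /orP[] /eqP[-> -> ->].
Qed.

Let C k i j : R := sc k i j - sc k j i.

Local Lemma C_0 k i j : (7 <= maxn k (maxn i j))%N -> C k i j = 0.
Proof. by move=> kij; rewrite /C !sc_0 ?subr0 // [maxn j i]maxnC. Qed.

Local Notation spatial_terms n k m t :=
  (- ((k == m)%:R * (coef k t / coef 0%N t *
       (h' k t + ((\sum_(b < n) h b t) - 2 * h 0%N t) * h k t)))
  - 2^-1 * (\sum_(b < n) \sum_(p < n) coef p t / coef b t * (C p k b * C p m b))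
  + 4^-1 * \sum_(b < n) \sum_(l < n) coef k t * coef m t / (coef b t * coef l t)
      * (C k b l * C m b l)).

Local Lemma sumE2 n (F : nat -> nat -> R) : (7 <= n)%N ->
  (forall i j, (7 <= maxn i j)%N -> F i j = 0) ->
  \sum_(i < n) \sum_(j < n) F i j = \sum_(i < 7) \sum_(j < 7) F i j.
Proof.
move=> n7 F0; rewrite (sum_ord_widen (F := fun i => \sum_(j < n) F i j) n7).
  apply: eq_bigr => i _; rewrite (sum_ord_widen (F := F i) n7) // => j j7.
  by rewrite F0 // leq_max j7 orbT.
by move=> k k7; rewrite big1 // => j _; rewrite F0 // leq_max k7.
Qed.

Local Lemma spatial_terms_widen n k m t : (7 <= n)%N ->
  spatial_terms n k m t = spatial_terms 7 k m t.
Proof.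
move=> n7.
rewrite (sum_ord_widen (F := fun k => h k t) n7); last by move=> j /h_0->.
rewrite (sumE2 (F := fun b p => coef p t / coef b t * (C p k b * C p m b)) n7).
  rewrite (sumE2 (F := fun b l => coef k t * coef m t / (coef b t * coef l t)
      * (C k b l * C m b l)) n7) // => i j ij.
  by rewrite C_0 ?mul0r ?mulr0 // leq_max ij orbT.
move=> i j; rewrite leq_max => ij.
by rewrite C_0 ?mul0r ?mulr0 // !leq_max; case/orP: ij => ->; rewrite ?orbT.
Qed.

(** Equations along a Euclidean direction are trivial: no bracket involves it, and its constant
    scale factor has [h = h' = 0]. *)
Local Lemma spatial_terms_large n k m t : (7 <= k)%N || (7 <= m)%N ->
  spatial_terms n k m t = 0.
Proof.
move=> km.
have e1 (b' p : nat) : C p k b' * C p m b' = 0.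
  case/orP: km => km; last rewrite mulrC.
    by rewrite C_0 ?mul0r // !leq_max km ?orbT.
  by rewrite C_0 ?mul0r // !leq_max km ?orbT.
have e2 (b' l : nat) : C k b' l * C m b' l = 0.
  case/orP: km => km; last rewrite mulrC.
    by rewrite C_0 ?mul0r // !leq_max km ?orbT.
  by rewrite C_0 ?mul0r // !leq_max km ?orbT.
rewrite [X in _ - 2^-1 * X]big1 => [|i _]; last by rewrite big1 // => j _; rewrite e1 mulr0.
rewrite [X in _ + 4^-1 * X]big1 => [|i _]; last by rewrite big1 // => j _; rewrite e2 mulr0.
rewrite !mulr0 subr0 addr0; case: eqP => [kmE|_]; last by rewrite mul0r oppr0.
rewrite -kmE orbb in km.
by rewrite h'_0 // h_0 // /cst /=; ring.
Qed.

(** Passing from ordinals to natural indices lets the equations in dimensions 6 and [n] be written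
    with the same terms, differing only in the ranges of summation. *)
Local Lemma reducedE n :
  reduced_equations (n := n) heis3_heis3 (fun=> 1) aE phi I h <->
  forall t, I t ->
    [/\ h' 0%N t - \sum_(k < n.+1) h' k t + (\sum_(k < n.+1) h k t) * h 0%N t
         - \sum_(k < n.+1) h k t ^+ 2 = derive1 phi t ^+ 2,
        forall k m, (0 < k < n.+1)%N -> (0 < m < n.+1)%N -> spatial_terms n.+1 k m t = 0
      & derive1n 2 phi t = (2 * h 0%N t - \sum_(k < n.+1) h k t) * derive1 phi t].
Proof.
have two := two_step_heis3_heis3.
have cl := structure_constant_l (R := R) (n := n) two.
have cr := structure_constant_r (R := R) (n := n) two.
have c0 := @structure_constant_0 R n heis3_heis3.
have c0l := @structure_constant_0l R n heis3_heis3.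
have c0r := @structure_constant_0r R n heis3_heis3.
have e0 (k : 'I_n.+1) t : I t -> coef k t != 0.
  move=> It; case: k => [[|k] kn] /=.
    by rewrite expr1n oppr_eq0 oner_neq0.
  by rewrite expf_neq0 // (@aE_neq0 n k).
have R00 := diag_ricci_00 cl cr c0 c0l c0r (@open_upto R b) e0 (@euclidean_coef_der n)
  (@euclidean_h_der n).
have R0r := diag_ricci_0r cl cr c0 c0l c0r (@open_upto R b) e0 (@euclidean_coef_der n)
  (@euclidean_h_der n).
have Rr0 := diag_ricci_r0 cl cr c0 c0l c0r (@open_upto R b) e0 (@euclidean_coef_der n)
  (@euclidean_h_der n).
have Rs := diag_ricci_spatial cl cr c0 c0l c0r (@open_upto R b) e0 (@euclidean_coef_der
  n) (@euclidean_h_der n).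
split=> H t It.
  have [Hr Hb] := H t It; split=> // [|k m /andP[k0 kn] /andP[m0 mn]].
    by have := Hr 0 0; rewrite R00 // !eqxx !mul1r.
  have k0' : Ordinal kn != 0 by rewrite -val_eqE /= -lt0n.
  have m0' : Ordinal mn != 0 by rewrite -val_eqE /= -lt0n.
  have := Hr (Ordinal kn) (Ordinal mn); rewrite Rs // (negPf k0') !mul0r.
  by [].
have [H0 Hs Hb] := H t It; split=> // k m.
have [->|k0] := eqVneq k 0; have [->|m0] := eqVneq m 0.
- by rewrite R00 // !mul1r.
- by rewrite R0r // mulr0 mul0r.
- by rewrite Rr0 // !mul0r.
rewrite !mul0r Rs //; apply: Hs.
  by rewrite ltn_ord andbT lt0n.
by rewrite ltn_ord andbT lt0n.
Qed.

Lemma euclidean_product_solution n : (6 <= n)%N ->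
  scalar_development (homogeneous heis3_heis3 n I (fun=> 1) aE phi).
Proof.
move=> n6; have two := two_step_heis3_heis3; have oI := @open_upto R b.
have N0 t : I t -> (fun=> 1 : R) t != 0 by move=> _; exact: oner_neq0.
split; first exact: (homogeneous_spacetime two phi oI N0 (@aE_neq0 n)
  (@euclidean_coef_smooth n)).
apply: (homogeneous_einstein two oI N0 (@aE_neq0 n) (@euclidean_coef_der n)
  (@euclidean_h_der n) phi_sm).
have n7 : (7 <= n.+1)%N by [].
have [_ _ _ [_ ein6]] := sol.
(* The six-dimensional field equations are part of the given solution; they are converted back into
   differential equations for the scale factors. *)
have red6 : reduced_equations (n := 6) heis3_heis3 (fun=> 1) aE phi I h.
  apply: (einstein_homogeneous two oI N0 (@aE_neq0 6) (@euclidean_coef_der 6)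
    (@euclidean_h_der 6) phi_sm).
  suff aEE : diagonal_metric heis3_heis3 (fun=> 1) a =
      diagonal_metric (n := 6) heis3_heis3 (fun=> 1) aE.
    by move: ein6; rewrite /homogeneous /= aEE.
  apply/funext => z; rewrite /diagonal_metric.
  have -> // : \row_(i < 6) (aE i (time_of z)) ^+ 2 = \row_(i < 6) (a i (time_of z)) ^+ 2.
  by apply/rowP => i; rewrite !mxE /euclidean_factors ltn_ord.
move/reducedE : red6 => red6; apply/reducedE => t It.
have [H0 Hs Hb] := red6 t It.
have hn0 k : (7 <= k)%N -> h k t = 0 by move=> /h_0->.
have sumh := sum_ord_widen (F := fun k => h k t) n7 hn0.
have sumh' := sum_ord_widen (F := fun k => h' k t) n7 (fun k => @h'_0 k t).
have sumhX : \sum_(k < n.+1) h k t ^+ 2 = \sum_(k < 7) h k t ^+ 2.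
  by apply: (sum_ord_widen (F := fun k => h k t ^+ 2) n7) => k /hn0->; rewrite expr0n.
split; [by rewrite sumh sumh' sumhX| |by rewrite sumh].
move=> k m /andP[k0 _] /andP[m0 _].
have [km|] := boolP ((7 <= k)%N || (7 <= m)%N); first exact: spatial_terms_large.
rewrite negb_or -!ltnNge => /andP[k7 m7].
by rewrite spatial_terms_widen // Hs // ?k0 ?m0.
Qed.

End EuclideanFactors.

(** * The Heisenberg solutions *)

Lemma sum_double (V : nmodType) (m : nat) (F : nat -> V) :
  \sum_(k < m.*2) F k = \sum_(r < m) (F r.*2 + F r.*2.+1).
Proof.
elim: m => [|m IHm]; first by rewrite !big_ord0.
by rewrite doubleS !big_ord_recr /= IHm addrA.
Qed.

Lemma two_step_heisenberg : two_step heisenberg.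
Proof.
move=> k i j p q; rewrite /heisenberg => /and3P[_ oi /eqP->].
by rewrite andbT; case: i oi.
Qed.

Lemma smooth_expR (R : realType) : smooth_on setT (@expR R).
Proof.
have dE j : derive1n j (@expR R) = expR.
  elim: j => // j IHj; rewrite derive1nS IHj.
  by apply/funext => t; rewrite derive1E; have [_ ->] := is_derive_expR t.
by move=> j t _; rewrite dE; exact: derivable_expR.
Qed.

Lemma is_derive_scale (R : realType) (c t : R) (u : R -> R) (du : R) :
  is_derive t 1 u du -> is_derive t 1 (fun s => c * u s) (c * du).
Proof. by move=> du'; exact: is_deriveZ. Qed.

Lemma is_derive_expRM (R : realType) (c t : R) :
  is_derive t 1 (fun s => expR (c * s)) (c * expR (c * t)).
Proof.
have dc : is_derive t 1 (fun s : R => c * s) c.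
  by have := is_deriveZ c (is_derive_id t 1); rewrite /GRing.scale /= mulr1.
have := is_derive1_comp (f := expR) (g := fun s => c * s) (is_derive_expR (c * t)) dc.
by rewrite mulrC.
Qed.

(** For [z = 0] both sides vanish by the convention for division by zero, so only [y] has to be
    nonzero. *)
Lemma div_mul_cancel (R : fieldType) (x y z w : R) :
  y != 0 -> x / (y * z) = w -> x / z = w * y.
Proof.
move=> y0 <-; have [->|z0] := eqVneq z 0; first by rewrite mulr0 !invr0 !mulr0 mul0r.
by field; rewrite y0 z0.
Qed.

Section HeisenbergSolution.
Context {R : realType}.
Variables (m : nat) (A p : nat -> R) (q phi0 : R).
Hypothesis data : heis_data m A p q.

Local Notation n := m.*2.+1.
Local Notation ch := (chi p).
Local Notation F := (FF A p).
Local Notation lapse := (heis_lapse m A p).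
Local Notation scale := (heis_scale m A p).

Let K r : R := kappa A r ^+ 2 / (4 * ch r ^+ 2).
(** [f r] is the logarithmic derivative of [F_r]. It solves the logistic equation
    [f' = f (2 chi - f)], whose right-hand side is named [g r]. *)
Let f r t : R := 2 * ch r * (K r * expR (2 * ch r * t)) / F r t.
Let g r t : R := f r t * (2 * ch r - f r t).
Let P t : R := \prod_(r < m) F r t.

(** Index 0 is the lapse, 1 the centre [omega^0], and [j.+2] is [omega^(j+1)], which belongs to the
    pair numbered [j./2]. *)
Let h (k : nat) (t : R) : R :=
  match k with
  | 0%N => 1 + 2^-1 * \sum_(r < m) f r t
  | 1%N => p 0%N - 2^-1 * \sum_(r < m) f r t
  | j.+2 => p j.+1 + 2^-1 * f j./2 t
  end.
Let h' (k : nat) (t : R) : R :=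
  match k with
  | 0%N => 2^-1 * \sum_(r < m) g r t
  | 1%N => - (2^-1 * \sum_(r < m) g r t)
  | j.+2 => 2^-1 * g j./2 t
  end.
(** The squared lapse and scale factors, free of square roots. The factors 1 in the lapse give it
    the shape treated by [sqr_exp_der]. *)
Let coef (k : nat) (t : R) : R :=
  match k with
  | 0%N => - ((1 * expR (1 * t)) ^+ 2 * P t)
  | 1%N => (A 0%N * expR (p 0%N * t)) ^+ 2 / P t
  | j.+2 => (A j.+1 * expR (p j.+1 * t)) ^+ 2 * F j./2 t
  end.

Local Lemma A_gt0 i : (i <= m.*2)%N -> 0 < A i.
Proof. by case: data => _ + _ _ _; exact. Qed.

Local Lemma chi_gt0 r : (r < m)%N -> 0 < ch r.
Proof. by case: data => _ _ _ _; exact. Qed.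

Local Lemma K_ge0 r : 0 <= K r.
Proof. by apply: divr_ge0; [exact: sqr_ge0|apply: mulr_ge0;
  [exact: ler0n|exact: sqr_ge0]]. Qed.

Local Lemma heis_FE r t : F r t = 1 + K r * expR (2 * ch r * t).
Proof. by []. Qed.

Local Lemma F_gt0 r t : 0 < F r t.
Proof. by rewrite heis_FE ltr_wpDr // mulr_ge0 ?K_ge0 ?expR_ge0. Qed.

Local Lemma P_gt0 t : 0 < P t.
Proof. by apply: prodr_gt0 => r _; exact: F_gt0. Qed.

Local Lemma sqrtP t : (\prod_(r < m) Num.sqrt (F r t)) ^+ 2 = P t.
Proof.
by rewrite -prodrXl; apply: eq_bigr => r _; rewrite sqr_sqrtr // ltW // F_gt0.
Qed.

Local Lemma metric_coefE k t : metric_coef lapse scale k t = coef k t.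
Proof.
case: k => [|[|j]] /=.
- by rewrite /heis_lapse exprMn sqrtP !mul1r.
- by rewrite /heis_scale exprMn exprVn sqrtP.
- by rewrite /heis_scale exprMn sqr_sqrtr // ltW // F_gt0.
Qed.

Local Lemma F_der r (t : R) : is_derive t 1 (F r) (f r t * F r t).
Proof.
have := is_deriveD (is_derive_cst (1 : R) t (1 : R)) (is_derive_scale (K r)
  (is_derive_expRM (2 * ch r) t)).
move/is_derive_eq; apply; rewrite /f divfK ?gt_eqF ?F_gt0 //.
by rewrite /GRing.scale /=; ring.
Qed.

Local Lemma f_der r (t : R) : is_derive t 1 (f r) (g r t).
Proof.
have F0 : F r t != 0 by rewrite gt_eqF ?F_gt0.
have dV := is_deriveV F0 (F_der r t).
have dE := is_derive_scale (2 * ch r) (is_derive_scale (K r) (is_derive_expRM (2 * ch r)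
  t)).
have := is_deriveM dE dV.
move/is_derive_eq; apply; rewrite /g /f /GRing.scale /=.
by move: (F r t) F0 => x x0; field.
Qed.

Local Lemma P_der (t : R) : is_derive t 1 P (P t * \sum_(r < m) f r t).
Proof.
rewrite /P; elim: m => [|k IHk].
  rewrite !big_ord0 mulr0 (_ : (fun _ => _) = cst 1); first exact: is_derive_cst.
  by apply/funext => s; rewrite big_ord0.
rewrite (_ : (fun s => _) = fun s => (\prod_(r < k) F r s) * F k s); last first.
  by apply/funext => s; rewrite big_ord_recr.
have := is_deriveM IHk (F_der k t); move/is_derive_eq; apply.
by rewrite !big_ord_recr /GRing.scale /=; ring.
Qed.

Local Lemma sumf_der (e : nat -> R -> R) (e' : nat -> R -> R) k (t : R) :
  (forall r, is_derive t 1 (e r) (e' r t)) ->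
  is_derive t 1 (fun s => \sum_(r < k) e r s) (\sum_(r < k) e' r t).
Proof.
move=> de; elim: k => [|k IHk].
  rewrite big_ord0 (_ : (fun _ => _) = cst 0); first exact: is_derive_cst.
  by apply/funext => s; rewrite big_ord0.
rewrite (_ : (fun s => _) = fun s => (\sum_(r < k) e r s) + e k s); last first.
  by apply/funext => s; rewrite big_ord_recr.
by have := is_deriveD IHk (de k); move/is_derive_eq; apply; rewrite big_ord_recr.
Qed.

Local Lemma heis_h_der k (t : R) : is_derive t 1 (h k) (h' k t).
Proof.
have ds := is_derive_scale (2^-1 : R) (sumf_der m (fun r => f_der r t)).
case: k => [|[|j]] /=.
- by have := is_deriveD (is_derive_cst (1 : R) t (1 : R)) ds; move/is_derive_eq; apply;
  rewrite add0r.
- by have := is_deriveB (is_derive_cst (p 0%N) t 1) ds; move/is_derive_eq; apply;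
  rewrite sub0r.
- have := is_deriveD (is_derive_cst (p j.+1) t 1) (is_derive_scale (2^-1 : R) (f_der j./2
  t)).
  by move/is_derive_eq; apply; rewrite add0r.
Qed.

Local Lemma sqr_exp_der (a c t : R) :
  is_derive t 1 (fun s => (a * expR (c * s)) ^+ 2) (2 * c * (a * expR (c * t)) ^+ 2).
Proof.
have := is_deriveX 2 (is_derive_scale a (is_derive_expRM c t)); move/is_derive_eq; apply.
by rewrite /GRing.scale /=; ring.
Qed.

Local Lemma heis_coef_der k (t : R) : is_derive t 1 (coef k) (2 * h k t * coef k t).
Proof.
have P0 : P t != 0 by rewrite gt_eqF ?P_gt0.
case: k => [|[|j]] /=.
- have := is_deriveN (is_deriveM (sqr_exp_der 1 1 t) (P_der t)); move/is_derive_eq.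
  by apply; rewrite /GRing.scale /=; move: (\sum_(r < m) _) => S; field.
- have := is_deriveM (sqr_exp_der (A 0%N) (p 0%N) t) (is_deriveV P0 (P_der t)).
  move/is_derive_eq; apply; rewrite /GRing.scale /=.
  by move: (\sum_(r < m) _) (P t) P0 => S x x0; field.
- have := is_deriveM (sqr_exp_der (A j.+1) (p j.+1) t) (F_der j./2 t).
  by move/is_derive_eq; apply; rewrite /GRing.scale /=; field.
Qed.

Local Lemma heis_coef_smooth (k : nat) (d : nat) (U : set 'rV[R]_d.+1) : open U ->
  Ck_on None U (fun z => coef k (z 0 0)).
Proof.
move=> oU.
have sE (c : R) : Ck_on None U (fun z : 'rV[R]_d.+1 => expR (c * z 0 0)).
  apply: (smooth_comp oU (@smooth_expR R)) => //.
  by apply: (smoothM oU); [exact: (smooth_cst oU)|exact: (smooth_coor oU)].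
have sF r : Ck_on None U (fun z : 'rV[R]_d.+1 => F r (z 0 0)).
  apply: (smoothD oU); first exact: (smooth_cst oU).
  by apply: (smoothM oU); [exact: (smooth_cst oU)|exact: sE].
have sP : Ck_on None U (fun z : 'rV[R]_d.+1 => P (z 0 0)).
  by apply: (smooth_prod oU) => r _; exact: sF.
have sA i : Ck_on None U (fun z : 'rV[R]_d.+1 => (A i * expR (p i * z 0 0)) ^+ 2).
  by apply: (smoothX oU); apply: (smoothM oU); [exact: (smooth_cst oU)|exact: sE].
case: k => [|[|j]] /=.
- apply: (smoothN oU); apply: (smoothM oU) => //.
  by apply: (smoothX oU); apply: (smoothM oU); [exact: (smooth_cst oU)|exact: sE].
- apply: (smoothM oU) => //; apply: (smoothV oU) => // z _.
  by rewrite gt_eqF ?P_gt0.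
- exact: (smoothM oU).
Qed.

(** * Brackets, Kasner sums and the Ricci equations on the Heisenberg group *)

Local Notation sc := (@structure_constant R heisenberg).
Let C k i j : R := sc k i j - sc k j i.

Local Lemma C_neq1 k i j : k != 1%N -> C k i j = 0.
Proof. by rewrite /C; case: k i j => [|[|k]] [|i] [|j] //= _; rewrite subr0. Qed.

Local Lemma C_low i j : (i <= 1)%N || (j <= 1)%N -> C 1 i j = 0.
Proof.
rewrite /C /structure_constant /heisenberg.
by case: i j => [|[|i]] [|[|j]] //= _; rewrite ?andbF ?subr0 ?subrr.
Qed.

Local Lemma scE i j : sc 1 i.+2 j.+2 = (~~ odd i && (j == i.+1))%:R.
Proof. by rewrite /structure_constant /heisenberg /= eqSS. Qed.

(** The r-th pair of coframe elements sits at the spacetime indices [r.*2.+2] and [r.*2.+3]. The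
    parity cases show that brackets couple only the two members of one pair. *)
Local Lemma C_ee r s : C 1 r.*2.+2 s.*2.+2 = 0.
Proof.
rewrite /C !scE !odd_double /=.
have E a b : (a.*2 == b.*2.+1) = false by apply/eqP => /(congr1 odd) /=;
  rewrite !odd_double.
by rewrite !E subr0.
Qed.

Local Lemma C_eo r s : C 1 r.*2.+2 s.*2.+3 = (s == r)%:R.
Proof. by rewrite /C !scE /= !odd_double /= eqSS (inj_eq double_inj) subr0. Qed.

Local Lemma C_oe r s : C 1 r.*2.+3 s.*2.+2 = - (r == s)%:R.
Proof. by rewrite /C -C_eo /C opprB. Qed.

Local Lemma C_oo r s : C 1 r.*2.+3 s.*2.+3 = 0.
Proof. by rewrite /C !scE /= !odd_double subr0. Qed.

Local Lemma sum_spacetime (G : nat -> R) : \sum_(k < n.+1) G k =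
  G 0%N + G 1%N + \sum_(r < m) (G r.*2.+2 + G r.*2.+3).
Proof. by rewrite !big_ord_recl /= addrA (sum_double m (fun k => G k.+2)). Qed.

Local Lemma spatial_index (k : nat) : (0 < k < n.+1)%N ->
  [\/ k = 1%N, exists2 r : 'I_m, k = r.*2.+2 & true | exists2 r : 'I_m, k = r.*2.+3 & true].
Proof.
case: k => [|[|k]] //; first by constructor 1.
rewrite /= !ltnS => km.
have hm : (k./2 < m)%N by rewrite -ltn_double; apply: leq_ltn_trans km;
  rewrite -{2}[k]odd_double_half leq_addl.
have := odd_double_half k; case: (odd k) => /= <-.
  by constructor 3; exists (Ordinal hm).
by constructor 2; exists (Ordinal hm).
Qed.

Local Lemma sum_p : \sum_(r < m) (p r.*2.+1 + p r.*2.+2) = 1 - p 0%N.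
Proof.
case: data => _ _ <- _ _.
by rewrite big_ord_recl /= addrC addKr (sum_double m (fun k => p k.+1)).
Qed.

Local Lemma sum_p2 :
  \sum_(r < m) (p r.*2.+1 ^+ 2 + p r.*2.+2 ^+ 2) = 1 - q ^+ 2 - p 0%N ^+ 2.
Proof.
case: data => _ _ _ <- _.
rewrite big_ord_recl /= (sum_double m (fun k => p k.+1 ^+ 2)).
by move: (\sum_(r < m) _) => S; ring.
Qed.

Local Lemma half_doubleS r : (r.*2.+1)./2 = r. Proof. exact: uphalf_double. Qed.

Local Lemma h_even r t : h r.*2.+2 t = p r.*2.+1 + 2^-1 * f r t.
Proof. by rewrite /h doubleK. Qed.

Local Lemma h_odd r t : h r.*2.+3 t = p r.*2.+2 + 2^-1 * f r t.
Proof. by rewrite /h half_doubleS. Qed.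

Local Lemma h'_even r t : h' r.*2.+2 t = 2^-1 * g r t.
Proof. by rewrite /h' doubleK. Qed.

Local Lemma h'_odd r t : h' r.*2.+3 t = 2^-1 * g r t.
Proof. by rewrite /h' half_doubleS. Qed.

(** Infinitesimal form of the lapse being proportional to the product of the scale factors, that is,
    of the time being harmonic; it rests on the exponents summing to 1. *)
Local Lemma sum_h t : \sum_(k < n.+1) h k t = 2 * h 0%N t.
Proof.
rewrite (sum_spacetime (fun k => h k t)).
have -> : \sum_(r < m) (h r.*2.+2 t + h r.*2.+3 t) = 1 - p 0%N + \sum_(r < m) f r t.
  by rewrite -sum_p -big_split; apply: eq_bigr => r _; rewrite h_even h_odd /=; field.
by rewrite /h; move: (\sum_(r < m) _) => S; field.
Qed.

Local Lemma sum_h' t : \sum_(k < n.+1) h' k t = 2 * h' 0%N t.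
Proof.
rewrite (sum_spacetime (fun k => h' k t)).
have -> : \sum_(r < m) (h' r.*2.+2 t + h' r.*2.+3 t) = \sum_(r < m) g r t.
  by apply: eq_bigr => r _; rewrite h'_even h'_odd; field.
by rewrite /h'; move: (\sum_(r < m) _) => S; field.
Qed.

Local Lemma sum_h2 t : \sum_(k < n.+1) h k t ^+ 2 =
  - h' 0%N t + 2 * h 0%N t ^+ 2 - q ^+ 2.
Proof.
rewrite (sum_spacetime (fun k => h k t ^+ 2)).
(* Writing [f^2 = 2 chi f - g] turns the coefficient of [f r] into the sum of the two exponents plus
   [chi_r], which is [1 + p_0] for every [r]. *)
have -> : \sum_(r < m) (h r.*2.+2 t ^+ 2 + h r.*2.+3 t ^+ 2) =
    (1 - q ^+ 2 - p 0%N ^+ 2) + (1 + p 0%N) * \sum_(r < m) f r t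
    - 2^-1 * \sum_(r < m) g r t.
  rewrite -sum_p2 !mulr_sumr -!big_split -sumrB; apply: eq_bigr => r _.
  by rewrite h_even h_odd /g /chi /=; field.
rewrite /h /h'.
by move: (\sum_(r < m) f r t) (\sum_(r < m) g r t) => S T; field.
Qed.

(* The relation fixing the constant [kappa_r^2 / (4 chi_r^2)] in [F_r]. *)
Local Lemma curvature_balance r t : (r < m)%N ->
  g r t * (coef r.*2.+2 t * coef r.*2.+3 t) = - coef 0%N t * coef 1%N t.
Proof.
move=> rm; have c0 := chi_gt0 rm.
have A1 : 0 < A r.*2.+1 by apply: A_gt0; rewrite ltn_double.
have A2 : 0 < A r.*2.+2 by apply: A_gt0; rewrite -doubleS leq_double.
rewrite /coef doubleK half_doubleS /g /f.
have FE' := heis_FE r t; have F0 := F_gt0 r t; have P0 := P_gt0 t.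
(* The definition of [chi_r] balances the exponents: with the two exponents of the pair it adds up
   to [1 + p_0]. *)
have EE : expR (p r.*2.+1 * t) * expR (p r.*2.+2 * t) * expR (ch r * t) =
    expR (1 * t) * expR (p 0%N * t).
  rewrite -!expRD; congr expR; rewrite /chi; ring.
have E2 : expR (2 * ch r * t) = expR (ch r * t) ^+ 2.
  by rewrite expr2 -expRD; congr expR; ring.
rewrite E2 in FE' *.
have KE : K r * (4 * ch r ^+ 2) = (A 0%N / (A r.*2.+1 * A r.*2.+2)) ^+ 2.
  by rewrite /K divfK // gt_eqF // mulr_gt0 // exprn_gt0.
move: EE FE' KE.
move: (F r t) (P t) F0 P0 (K r) (ch r) c0 => x y x0 y0 k c c0.
move: (expR (p r.*2.+1 * t)) (expR (p r.*2.+2 * t)) (expR (c * t)) => e1 e2 e3.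
move: (expR (1 * t)) (expR (p 0%N * t)) => e4 e5 EE FE' KE.
have x0' : x != 0 by rewrite gt_eqF.
have y0' : y != 0 by rewrite gt_eqF.
have A1' : A r.*2.+1 != 0 by rewrite gt_eqF.
have A2' : A r.*2.+2 != 0 by rewrite gt_eqF.
(* With [x = F] and [k * e3 ^+ 2 = F - 1] one has [2 chi - f = 2 chi / F], so [g] is
   [4 chi^2 K exp(2 chi t) / F^2]. The squares of [F] cancel against the pair, and [KE] replaces the
   constant by [kappa^2]. *)
transitivity ((k * (4 * c ^+ 2)) * (e1 * e2 * e3) ^+ 2 * (A r.*2.+1 * A r.*2.+2) ^+ 2 *
  (x - k * e3 ^+ 2)).
  by field.
have -> : x - k * e3 ^+ 2 = 1 by rewrite FE'; ring.
by rewrite KE EE; field; rewrite A1' A2' y0'.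
Qed.

Local Lemma sum_C k (G : nat -> nat -> R) :
  \sum_(b < n.+1) \sum_(l < n.+1) G l b * C l k b =
  \sum_(r < m) (G 1%N r.*2.+2 * C 1 k r.*2.+2 + G 1%N r.*2.+3 * C 1 k r.*2.+3).
Proof.
have inner b : \sum_(l < n.+1) G l b * C l k b = G 1%N b * C 1 k b.
  rewrite big_ord_recl C_neq1 // mulr0 add0r big_ord_recl big1 ?addr0 // => l _.
  by rewrite C_neq1 // mulr0.
under eq_bigr => b _ do rewrite inner.
rewrite (sum_spacetime (fun b => G 1%N b * C 1 k b)).
by rewrite !C_low ?orbT // !mulr0 addr0 add0r.
Qed.

Local Notation spatial_terms k l t :=
  (- ((k == l)%:R * (coef k t / coef 0%N t *
       (h' k t + ((\sum_(b < n.+1) h b t) - 2 * h 0%N t) * h k t)))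
  - 2^-1 * (\sum_(b < n.+1) \sum_(x < n.+1) coef x t / coef b t * (C x k b * C x l b))
  + 4^-1 * \sum_(b < n.+1) \sum_(x < n.+1) coef k t * coef l t / (coef b t * coef x t)
      * (C k b x * C l b x)).

Local Lemma sum_delta_ord (G : nat -> R) (r : 'I_m) :
  \sum_(s < m) (s == r :> nat)%:R * G s = G r.
Proof.
rewrite (bigD1 r) //= eqxx mul1r big1 ?addr0 // => s sr.
by rewrite -val_eqE /= in sr; rewrite (negPf sr) mul0r.
Qed.

Local Lemma coef_neq0 k t : (k < n.+1)%N -> coef k t != 0.
Proof.
have e0 (c : R) : expR (c * t) != 0 by rewrite gt_eqF ?expR_gt0.
have P0 : P t != 0 by rewrite gt_eqF ?P_gt0.
case: k => [|[|j]] /=.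
- by rewrite oppr_eq0 mulf_neq0 // expf_neq0 // mul1r.
- move=> _; rewrite mulf_neq0 ?invr_eq0 // expf_neq0 // mulf_neq0 //.
  by rewrite gt_eqF // A_gt0.
- rewrite !ltnS => jm; rewrite mulf_neq0 //; last by rewrite gt_eqF ?F_gt0.
  by rewrite expf_neq0 // mulf_neq0 // gt_eqF // A_gt0.
Qed.

Local Lemma ric_sum1 k l t :
  \sum_(b < n.+1) \sum_(x < n.+1) coef x t / coef b t * (C x k b * C x l b) =
  \sum_(r < m) (coef 1 t / coef r.*2.+2 t * C 1 l r.*2.+2 * C 1 k r.*2.+2
               + coef 1 t / coef r.*2.+3 t * C 1 l r.*2.+3 * C 1 k r.*2.+3).
Proof.
rewrite -(sum_C k (fun x b => coef x t / coef b t * C x l b)).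
by apply: eq_bigr => b _; apply: eq_bigr => x _; rewrite [C x k b * _]mulrC mulrA.
Qed.

Local Lemma ric_sum1_1 l t :
  \sum_(b < n.+1) \sum_(x < n.+1) coef x t / coef b t * (C x 1 b * C x l b) = 0.
Proof. by rewrite ric_sum1 big1 // => r _; rewrite !(@C_low 1 _ isT) !mulr0 addr0. Qed.

Local Lemma ric_sum1_even (a : 'I_m) l t :
  \sum_(b < n.+1) \sum_(x < n.+1) coef x t / coef b t * (C x a.*2.+2 b * C x l b) =
  coef 1 t / coef a.*2.+3 t * C 1 l a.*2.+3.
Proof.
rewrite ric_sum1 -(sum_delta_ord (fun r => coef 1 t / coef r.*2.+3 t * C 1 l r.*2.+3) a).
by apply: eq_bigr => r _; rewrite C_ee C_eo mulr0 add0r mulrC.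
Qed.

Local Lemma ric_sum1_odd (a : 'I_m) l t :
  \sum_(b < n.+1) \sum_(x < n.+1) coef x t / coef b t * (C x a.*2.+3 b * C x l b) =
  - (coef 1 t / coef a.*2.+2 t * C 1 l a.*2.+2).
Proof.
rewrite ric_sum1 -(sum_delta_ord (fun r => coef 1 t / coef r.*2.+2 t * C 1 l r.*2.+2) a).
by rewrite -sumrN; apply: eq_bigr => r _; rewrite C_oo C_oe mulr0 addr0 mulrN mulrC eq_sym.
Qed.

Local Lemma ric_sum2_0 k l t : (k != 1%N) || (l != 1%N) ->
  \sum_(b < n.+1) \sum_(x < n.+1) coef k t * coef l t / (coef b t * coef x t)
      * (C k b x * C l b x) = 0.
Proof.
move=> kl; rewrite big1 // => b _; rewrite big1 // => x _.
by case/orP: kl => kl; rewrite (C_neq1 _ _ kl) ?mul0r ?mulr0.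
Qed.

Local Lemma balance_div r t : (r < m)%N ->
  coef 1 t / (coef r.*2.+2 t * coef r.*2.+3 t) = - (g r t / coef 0%N t).
Proof.
move=> rm; have c2 : coef r.*2.+2 t != 0.
  by apply: coef_neq0; rewrite !ltnS ltn_double.
have c3 : coef r.*2.+3 t != 0.
  by apply: coef_neq0; rewrite !ltnS -doubleS leq_double.
have c0 : coef 0%N t != 0 by exact: coef_neq0.
have c23 := mulf_neq0 c2 c3.
apply/eqP; rewrite eq_sym -mulNr (eqr_div _ _ c0 c23).
by rewrite mulNr curvature_balance // mulNr opprK mulrC.
Qed.

(** The factor 2 arises because each pair occurs in both orders; [balance_div] converts either
    occurrence into [g r]. *)
Local Lemma ric_sum2_1 t :
  \sum_(b < n.+1) \sum_(x < n.+1) coef 1 t * coef 1 t / (coef b t * coef x t)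
      * (C 1 b x * C 1 b x) = - (2 * (coef 1 t / coef 0%N t) * \sum_(r < m) g r t).
Proof.
pose G b x := coef 1 t * coef 1 t / (coef b t * coef x t) * (C 1 b x * C 1 b x).
have low b x : (b <= 1)%N || (x <= 1)%N -> G b x = 0.
  by move=> bx; rewrite /G C_low // mul0r mulr0.
rewrite (sum_spacetime (fun b => \sum_(x < n.+1) G b x)).
rewrite big1 ?add0r => [|x _]; last exact: low.
rewrite big1 ?add0r => [|x _]; last exact: low.
rewrite mulr_sumr -sumrN; apply: eq_bigr => r _.
have inner b : \sum_(x < n.+1) G b x = \sum_(s < m) (G b s.*2.+2 + G b s.*2.+3).
  by rewrite (sum_spacetime (G b)) !low ?orbT // !add0r.
have Ge s : G r.*2.+2 s.*2.+2 + G r.*2.+2 s.*2.+3 =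
    (s == r)%:R * (coef 1 t * coef 1 t / (coef r.*2.+2 t * coef s.*2.+3 t)).
  by rewrite /G C_ee C_eo; case: (s == r) => /=; ring.
have Go s : G r.*2.+3 s.*2.+2 + G r.*2.+3 s.*2.+3 =
    (s == r)%:R * (coef 1 t * coef 1 t / (coef r.*2.+3 t * coef s.*2.+2 t)).
  by rewrite /G C_oo C_oe eq_sym; case: (s == r :> nat) => /=; ring.
rewrite !inner; under eq_bigr => s _ do rewrite Ge.
under [X in _ + X]eq_bigr => s _ do rewrite Go.
rewrite (sum_delta_ord (fun s => coef 1 t * coef 1 t / (coef r.*2.+2 t * coef s.*2.+3 t))
  r).
rewrite (sum_delta_ord (fun s => coef 1 t * coef 1 t / (coef r.*2.+3 t * coef s.*2.+2 t))
  r).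
move: (balance_div t (ltn_ord r)).
move: (coef 1 t) (coef r.*2.+2 t) (coef r.*2.+3 t) (coef 0 t) (g r t) => x y z w v bal.
rewrite [z * y]mulrC -[x * x / _]mulrA bal.
ring.
Qed.

(** Harmonic time leaves only [h'] in the evolution term. At the centre [- 1/2] of the sum of the
    [g r] meets the quadratic bracket sum, within a pair [1/2] of [g] meets one curvature quotient;
    off the diagonal the brackets vanish. *)
Local Lemma heis_spatial_terms k l t : (0 < k < n.+1)%N -> (0 < l < n.+1)%N ->
  spatial_terms k l t = 0.
Proof.
move=> kn ln; rewrite sum_h subrr mul0r addr0.
have [k1|[a ka _]|[a ka _]] := spatial_index kn.
- rewrite k1 ric_sum1_1 mulr0 subr0.
  have [<-|l1] := eqVneq 1%N l.
    rewrite ric_sum2_1 /h'.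
    by move: (\sum_(r < m) _) (coef 1 t / coef 0%N t) => S x /=; field.
  rewrite ric_sum2_0; last by rewrite eq_sym l1 orbT.
  by rewrite /=; ring.
- have bal := balance_div t (ltn_ord a).
  have c2 : coef a.*2.+2 t != 0 by apply: coef_neq0; rewrite -ka; case/andP: kn.
  rewrite ric_sum2_0 ?ka // mulr0 addr0 ric_sum1_even h'_even.
  have [l1|[b lb _]|[b lb _]] := spatial_index ln.
  + by rewrite l1 C_low // mulr0 /=; ring.
  + rewrite lb C_eo !eqSS (inj_eq double_inj).
    case: (eqVneq (a : nat) b) => [_|_]; last by rewrite /=; ring.
    have -> : coef 1 t / coef a.*2.+3 t = - (g a t / coef 0%N t) * coef a.*2.+2 t.
      exact: div_mul_cancel c2 bal.
    by move: (coef a.*2.+2 t) (g a t) (coef 0%N t)^-1 => x y z; rewrite /=; field.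
  + rewrite lb C_oo mulr0.
    have -> : (a.*2.+2 == b.*2.+3) = false.
      by apply/eqP => /(congr1 odd) /=; rewrite !odd_double.
    by rewrite /=; ring.
- have bal := balance_div t (ltn_ord a).
  have c3 : coef a.*2.+3 t != 0 by apply: coef_neq0; rewrite -ka; case/andP: kn.
  rewrite ric_sum2_0 ?ka // mulr0 addr0 ric_sum1_odd h'_odd.
  have [l1|[b lb _]|[b lb _]] := spatial_index ln.
  + by rewrite l1 C_low // mulr0 /=; ring.
  + rewrite lb C_ee mulr0.
    have -> : (a.*2.+3 == b.*2.+2) = false.
      by apply/eqP => /(congr1 odd) /=; rewrite !odd_double.
    by rewrite /=; ring.
  + rewrite lb C_oe !eqSS (inj_eq double_inj) eq_sym.
    case: (eqVneq (b : nat) a) => [_|_]; last by rewrite /=; ring.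
    have -> : coef 1 t / coef a.*2.+2 t = - (g a t / coef 0%N t) * coef a.*2.+3 t.
      by apply: div_mul_cancel c3 _; rewrite [_ * coef a.*2.+2 t]mulrC.
    by move: (coef a.*2.+3 t) (g a t) (coef 0%N t)^-1 => x y z; rewrite /=; field.
Qed.

Lemma heisenberg_solution :
  scalar_development (homogeneous heisenberg n setT lapse scale (fun t => q * t + phi0)).
Proof.
have two := two_step_heisenberg.
have cl := structure_constant_l (R := R) (n := n) two.
have cr := structure_constant_r (R := R) (n := n) two.
have c0 := @structure_constant_0 R n heisenberg.
have c0l := @structure_constant_0l R n heisenberg.
have c0r := @structure_constant_0r R n heisenberg.
have oT : open [set: R] by exact: openT.
have mE (k : 'I_n.+1) : metric_coef lapse scale k = coef k.
  by apply/funext => t; exact: metric_coefE.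
have N0 t : [set: R] t -> lapse t != 0.
  by move=> _; rewrite gt_eqF // mulr_gt0 ?expR_gt0 // prodr_gt0 // => r _;
    rewrite sqrtr_gt0 F_gt0.
have a0 i t : (i < n)%N -> [set: R] t -> scale i t != 0.
  move=> i_n _; rewrite -sqrf_eq0 -[_ ^+ 2]/(metric_coef lapse scale i.+1 t) metric_coefE.
  exact: coef_neq0.
have eD (k : 'I_n.+1) t : [set: R] t ->
    is_derive t 1 (metric_coef lapse scale k) (2 * h k t * metric_coef lapse scale k t).
  by move=> _; rewrite mE; exact: heis_coef_der.
have hD (k : 'I_n.+1) t : [set: R] t -> is_derive t 1 (h k) (h' k t).
  by move=> _; exact: heis_h_der.
have dphi : derive1 (fun t : R => q * t + phi0) = cst q.
  apply/funext => t; rewrite derive1E.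
  have dq : is_derive t 1 (fun s : R => q * s) q.
    by have := is_derive_scale q (is_derive_id t (1 : R)); rewrite mulr1.
  have [_] := is_deriveD dq (is_derive_cst phi0 t (1 : R)).
  by rewrite addr0.
have sphi : smooth_on setT (fun t : R => q * t + phi0).
  move=> [|j] t _.
    apply: derivableD; last exact: derivable_cst.
    by apply: derivableM; [exact: derivable_cst|exact: derivable_id].
  rewrite derive1Sn dphi (_ : derive1n j (cst q) = cst (if j is 0%N then q else 0)).
    exact: derivable_cst.
  elim: j => // j IHj; rewrite derive1nS IHj; apply/funext => s.
  by rewrite derive1_cst.
split.
  apply: (homogeneous_spacetime two _ oT N0 a0) => k; rewrite mE.
  exact/heis_coef_smooth/open_time_slab.
apply: (homogeneous_einstein two oT N0 a0 eD hD sphi) => t It.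
rewrite dphi; split; last first.
  rewrite -[derive1n 2 _]/(derive1 (derive1 _)) dphi derive1_cst.
  by rewrite sum_h subrr mul0r.
have eD' (k : 'I_n.+1) s : [set: R] s -> is_derive s 1 (coef k) (2 * h k s * coef k s).
  by move=> _; exact: heis_coef_der.
have e0' (k : 'I_n.+1) s : [set: R] s -> coef k s != 0 by move=> _; exact: coef_neq0.
have -> : (fun k : 'I_n.+1 => metric_coef lapse scale k) = (fun k : 'I_n.+1 => coef k).
  by apply/funext => k; exact: mE.
move=> k l; have [->|k0] := eqVneq k 0; have [->|l0] := eqVneq l 0.
(* By the three sums, [h_0' - 2 h_0' + 2 h_0^2] minus the sum of squares leaves [q^2]: this is where
   the quadratic Kasner relation enters. *)
- rewrite (diag_ricci_00 cl cr c0 c0l c0r oT e0' eD' hD It).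
  rewrite sum_h sum_h' sum_h2 /=.
  by move: (h 0%N t) (h' 0%N t) => x y; rewrite /cst; ring.
- by rewrite (diag_ricci_0r cl cr c0 c0l c0r oT e0' eD' hD It l0) mulr0 mul0r.
- by rewrite (diag_ricci_r0 cl cr c0 c0l c0r oT e0' eD' hD It k0) !mul0r.
rewrite (diag_ricci_spatial cl cr c0 c0l c0r oT e0' eD' hD It k0 l0) !mul0r.
have pos (i : 'I_n.+1) : i != 0 -> (0 < i < n.+1)%N by move=> i0;
  rewrite ltn_ord andbT lt0n.
exact: heis_spatial_terms (pos k k0) (pos l l0).
Qed.

End HeisenbergSolution.

Theorem corollary1p2 (R : realType) (e : nat) (T : atlas R e) (G : tensor2 T)
    (gamma : R -> T)
    (hT : manifold T) (hG : riemannian G) (hcomplete : complete G)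
    (hgeo : geodesic G setT gamma) (hunit : unit_speed G gamma) :
  (forall (n : nat) (M : atlas R n.+1) (g : tensor2 M) (phi : M -> R),
     manifold M -> lorentzian None g -> einstein_scalar g phi ->
     einstein_sigma g G (gamma \o phi)) /\
  [/\ (* (a) *)
      forall (m : nat) (A p : nat -> R) (q phi0 : R), heis_data m A p q ->
        forall D : development R m.*2.+1 R,
          development_or_quotient heisenberg setT (heis_lapse m A p)
            (heis_scale m A p) (fun tau => q * tau + phi0) D ->
          gives_sigma_development G gamma D,
      (* (b), the two displayed data *)
      forall x : datum, x = scalar_datum \/ x = vacuum_datum ->
        forall (b : \bar R) (a : nat -> R -> R) (phi : R -> R),
          maximal_expanding b a phi ->
          kasner_asymptotics (3 / 5) x.1 x.2 a phi ->
          forall D : development R 6 R,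
            development_or_quotient heis3_heis3 (upto b) (fun=> 1) a phi D ->
            gives_sigma_development G gamma D,
      (* (b), the nearby Kasner data *)
      forall x : datum, x = scalar_datum \/ x = vacuum_datum ->
        exists2 delta : R, 0 < delta &
        forall (p : nat -> R) (q eps : R),
          (forall i, (i < 6)%N -> `|p i - x.1 i| < delta) -> `|q - x.2| < delta ->
          kasner p q -> 0 < eps ->
          forall (b : \bar R) (a : nat -> R -> R) (phi : R -> R),
            maximal_expanding b a phi -> kasner_asymptotics eps p q a phi ->
            forall D : development R 6 R,
              development_or_quotient heis3_heis3 (upto b) (fun=> 1) a phi D ->
              gives_sigma_development G gamma D
    & (* (c) *)
      forall n : nat, (6 <= n)%N ->
      forall x : datum, x = scalar_datum \/ x = vacuum_datum ->
        forall (b : \bar R) (a : nat -> R -> R) (phi : R -> R),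
          maximal_expanding b a phi ->
          kasner_asymptotics (3 / 5) x.1 x.2 a phi ->
          forall D : development R n R,
            development_or_quotient heis3_heis3 (upto b) (fun=> 1)
              (euclidean_factors a) phi D ->
            gives_sigma_development G gamma D].
Proof.
split=> [n M g phi hM _ hsol|].
  exact: geodesic_einstein_sigma hM hgeo hunit hsol.
(* All four families reduce to the scalar equations on the covering homogeneous development. *)
have scal n brk I N a phi (D : development R n R) :
    scalar_development (homogeneous brk n I N a phi) ->
    development_or_quotient brk I N a phi D -> gives_sigma_development G gamma D.
  move=> sol DQ; apply: scalar_gives_sigma hgeo hunit _.
  exact: quotient_scalar_development sol DQ.
split.
- move=> m A p q phi0 data D; apply: scal; exact: heisenberg_solution data.
- by move=> x _ b a phi [_ [_ _ _ sol] _ _] _ D; exact: scal.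
(* The radius is a free choice: the field equations come with [maximal_expanding] through
   [diagonal_solution]. *)
- move=> x _; exists 1; first exact: ltr01.
  by move=> p q eps _ _ _ _ b a phi [_ [_ _ _ sol] _ _] _ D; exact: scal.
- move=> n n6 x _ b a phi [_ sol _ _] _ D; apply: scal.
  exact: euclidean_product_solution sol n n6.
Qed.
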